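(* Let $n\ge 1$ and let $S$ be a compact subset of $\mathbb{T}^n$. Then: (i) $S$ is an interpolation set for $A(\mathbb{D}^n)$ if and only if it is an interpolation set for $A_{\vec 0}(\mathbb{D}^n)$; (ii) $S$ is a null set for $A_{\vec 0}(\mathbb{D}^n)^\perp$ if and only if it is a null set for $A(\mathbb{D}^n)^\perp$. Consequently, $S$ has the property that for every $f\in C(S)$ there exists $g\in A_{\vec 0}(\mathbb{D}^n)$ with $g|_S=f$ if and only if $S$ is a null set for $A_{\vec 0}(\mathbb{D}^n)^\perp$.
   Context: $M(\mathbb{T}^n)$ denotes the complex Borel measures of bounded variation on $\mathbb{T}^n$. $A(\mathbb{D}^n)$ is the polydisc algebra (functions continuous on $\overline{\mathbb{D}}^n$ and holomorphic on $\mathbb{D}^n$), regarded via restriction as a subspace of $C(\mathbb{T}^n)$ with the supremum norm. $A_{\vec 0}(\mathbb{D}^n)=\{z_1z_2\cdots z_n f(z): f\in A(\mathbb{D}^n)\}$. For a subspace $X\subset C(\mathbb{T}^n)$, $X^\perp$ is the set of $\mu\in M(\mathbb{T}^n)$ with $\int_{\mathbb{T}^n} f\,d\mu=0$ for all $f\in X$. A compact set $S\subset\mathbb{T}^n$ is a null set for $X^\perp$ if $|\mu|(S)=0$ for every $\mu\in X^\perp$. $S$ is an interpolation set for $X$ if for every $f\in C(S)$ there is $g\in X$ with $g|_S=f$. *)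

(* Defs.v *)
From HB Require Import structures.
From mathcomp Require Import all_boot all_order all_algebra.
From mathcomp Require Import all_classical all_reals all_analysis.
From mathcomp Require Import complex.
Set Implicit Arguments. Unset Strict Implicit. Unset Printing Implicit Defensive.
Import Order.TTheory GRing.Theory Num.Theory.
Import numFieldNormedType.Exports.
Local Open Scope classical_set_scope.
Local Open Scope ring_scope.

(* The complex plane: R[i] (complex numbers over a real type R), seen with its
   normed/topological structure (the regular module R[i]^o).
   Points of C^n are row vectors 'rV[R[i]]_n, with the product topology. *)

Section Polydisc.
Variable R : realType.
Variable n : nat.

Notation Cn := 'rV[R[i]^o]_n.
Notation C := (R[i]^o).

Definition torus : set Cn := [set z | forall j, `|z ord0 j| = 1].
Definition cpolydisc : set Cn := [set z | forall j, `|z ord0 j| <= 1].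
Definition opolydisc : set Cn := [set z | forall j, `|z ord0 j| < 1].

Definition upd (z : Cn) (j : 'I_n) (w : C) : Cn :=
  \row_k (if k == j then w else z ord0 k).

(* holomorphic on the open polydisc: complex differentiable in each variable
   separately at every point (for continuous functions this is equivalent to
   joint holomorphy, Osgood/Hartogs) *)
Definition holo_on_polydisc (g : Cn -> C) : Prop :=
  forall z, opolydisc z -> forall j : 'I_n,
    derivable (fun w : C => g (upd z j w)) (z ord0 j : C) 1.

Definition inA (g : Cn -> C) : Prop :=
  {within cpolydisc, continuous g} /\ holo_on_polydisc g.

Definition inA0 (g : Cn -> C) : Prop :=
  exists h, inA h /\
    forall z, cpolydisc z -> g z = (\prod_(j < n) z ord0 j) * h z.

Definition BCn := g_sigma_algebraType (@open Cn).

(* A complex Borel measure on T^n, given (Jordan decomposition) as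
   mu = nu_0 + i nu_1 - nu_2 - i nu_3 = sum_k i^k nu_k with nu_k finite
   positive Borel measures concentrated on T^n. Every complex Borel measure of
   bounded variation on T^n is of this form. *)
Record cmeasure := CMeasure {
  cm_part : 'I_4 -> {finite_measure set BCn -> \bar R} ;
  cm_supp : forall k, cm_part k (~` torus) = 0%E }.

Definition iC : R[i] := Complex 0 1.

Definition cmval (mu : cmeasure) (E : set BCn) : R[i] :=
  \sum_(k < 4) iC ^+ k * real_complex R (fine (cm_part mu k E)).

Definition cint (mu : cmeasure) (g : Cn -> C) : R[i] :=
  \sum_(k < 4) iC ^+ k *
    (real_complex R (Rintegral (cm_part mu k) (torus : set BCn) (fun x => complex.Re (g x)))
     + iC * real_complex R (Rintegral (cm_part mu k) (torus : set BCn) (fun x => complex.Im (g x)))).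

Definition borel_partition (S : set BCn) (s : seq (set BCn)) : Prop :=
  (forall E, E \in s -> measurable E) /\
  (forall i j, (i < j < size s)%N -> nth set0 s i `&` nth set0 s j = set0) /\
  \big[setU/set0]_(E <- s) E = S.

Definition ctotvar (mu : cmeasure) (S : set BCn) : \bar R :=
  ereal_sup [set (\sum_(E <- s) ComplexField.Normc.normc (cmval mu E))%:E | s in borel_partition S].

Definition annihilates (X : (Cn -> C) -> Prop) (mu : cmeasure) : Prop :=
  forall g, X g -> cint mu g = 0.

Definition null_for_perp (X : (Cn -> C) -> Prop) (S : set Cn) : Prop :=
  forall mu, annihilates X mu -> ctotvar mu S = 0%E.

Definition interpolation_set (X : (Cn -> C) -> Prop) (S : set Cn) : Prop :=
  forall f : Cn -> C, {within S, continuous f} ->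
    exists g, X g /\ forall z, S z -> g z = f z.

End Polydisc.

(* Main.v *)
(* Let P be the product of the coordinates, which is unimodular on T^n. Since A_0 = P A,
   interpolating f by A_0 on S amounts to interpolating f P^* by A, and a null set for
   the annihilator of A_0 is one for the smaller annihilator of A. It remains to go from
   "null for the annihilator of A" to "interpolation for A", and from there to "null for
   the annihilator of A_0".

   Suppose f in C(S), |f| <= 1, has a continuous extension F that no g in A approximates
   within e on S and within 2 off S. Hahn-Banach and Riesz give mu orthogonal to A with
   Re int F dmu = 1 and Re int u dmu <= 1/2 for every u of size at most 1 vanishing on S.
   As mu does not charge S, int F dmu is a limit of such integrals: a contradiction.
   Approximation within e by elements of bounded norm is turned into interpolation by
   summing a geometric series.

   Conversely let mu be orthogonal to A_0. There are bumps r_m on T^n, with values in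
   [0, 1] and tending to 1 on S and to 0 off S, such that P^N r_m is in A for N large.
   If w in A interpolates v P^(-N-1) on S then int w P^(N+1) r_m dmu = 0, so that
   int_S v r_m dmu is controlled by sup |w| times the integral of r_m off S, which tends to
   0. The uniform boundedness principle makes this control uniform in m, whence
   int_S v dmu = 0 for every v in C(S). *)
Require Import Defs.
From HB Require Import structures.
From mathcomp Require Import all_boot all_order all_algebra.
From mathcomp Require Import all_classical all_reals all_analysis.
From mathcomp Require Import measurable_realfun complex ring lra.
Set Implicit Arguments. Unset Strict Implicit. Unset Printing Implicit Defensive.
Import Order.TTheory GRing.Theory Num.Theory.
Import numFieldNormedType.Exports.
Local Open Scope classical_set_scope.
Local Open Scope ring_scope.

(** Two analytic facts are used throughout: the size of an element of A on the closed polydisc is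
    governed by its values on T^n, and A is closed under uniform limits. Both reduce to one
    variable, where they are proved without Cauchy's integral formula: Goursat's theorem gives the
    maximum principle through a discrete Laplacian, and the maximum principle for powers of a
    difference quotient gives Weierstrass' theorem. For the Riesz theorem, Hahn-Banach is run on all
    bounded functions and not only on continuous ones. Every subset of a compact set then has a
    mass, and the representing measure is the image of Lebesgue measure on an interval. As a complex
    measure is given by four positive parts, a complex function is replaced by the real parts of its
    products with 1, i, -1, -i, so that only positive functionals have to be represented. In the
    converse the functions v P^(-N-1) stay bounded but change with m, so that no single interpolant
    serves for all m; hence the appeal to uniform boundedness. *)

Lemma sum_ord4 (V : nmodType) (F : 'I_4 -> V) :
  \sum_(k < 4) F k = F 0 + (F 1 + (F 2%:R + F 3%:R)).
Proof.
rewrite !big_ord_recl big_ord0 addr0.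
by congr (F _ + (F _ + (F _ + F _))); exact/val_inj.
Qed.

(** * Real-valued modulus of complex numbers *)

Section ComplexModulus.
Context {R : realType}.
Implicit Types z w : R[i].

Definition cabs z : R := ComplexField.Normc.normc z.

Arguments cabs : simpl never.

Lemma ReD z w : complex.Re (z + w) = complex.Re z + complex.Re w.
Proof. by case: z; case: w. Qed.
Lemma ImD z w : complex.Im (z + w) = complex.Im z + complex.Im w.
Proof. by case: z; case: w. Qed.
Lemma ReN z : complex.Re (- z) = - complex.Re z. Proof. by case: z. Qed.
Lemma ImN z : complex.Im (- z) = - complex.Im z. Proof. by case: z. Qed.
Lemma ReM z w : complex.Re (z * w) =
  complex.Re z * complex.Re w - complex.Im z * complex.Im w.
Proof. by case: z; case: w. Qed.
Lemma ImM z w : complex.Im (z * w) =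
  complex.Re z * complex.Im w + complex.Im z * complex.Re w.
Proof. by case: z; case: w. Qed.

Lemma complex_ext z w :
  complex.Re z = complex.Re w -> complex.Im z = complex.Im w -> z = w.
Proof. by case: z => a b; case: w => c d /= -> ->. Qed.

Lemma cabsE z : `|z| = (cabs z)%:C%C. Proof. by []. Qed.

Lemma cabsRI z : cabs z = Num.sqrt (complex.Re z ^+ 2 + complex.Im z ^+ 2).
Proof. by case: z. Qed.

Lemma cabs_ge0 z : 0 <= cabs z.
Proof. by rewrite cabsRI sqrtr_ge0. Qed.

Lemma cabs0 : cabs 0 = 0. Proof. exact: ComplexField.Normc.normc0. Qed.
Lemma cabs1 : cabs 1 = 1. Proof. exact: ComplexField.Normc.normc1. Qed.

Lemma cabs_eq0 z : cabs z = 0 -> z = 0.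
Proof. exact: ComplexField.Normc.eq0_normc. Qed.

Lemma cabs_gt0 z : z != 0 -> 0 < cabs z.
Proof.
move=> z0; rewrite lt_neqAle cabs_ge0 andbT eq_sym.
by apply: contra z0 => /eqP/cabs_eq0 ->.
Qed.

Lemma cabsM z w : cabs (z * w) = cabs z * cabs w.
Proof. exact: ComplexField.Normc.normcM. Qed.

Lemma cabsV z : cabs z^-1 = (cabs z)^-1.
Proof. exact: ComplexField.Normc.normcV. Qed.

Lemma cabsX z m : cabs (z ^+ m) = cabs z ^+ m.
Proof. by elim: m => [|m IH]; rewrite ?expr0 ?cabs1// !exprS cabsM IH. Qed.

Lemma cabs_prod (I : Type) (s : seq I) (F : I -> R[i]) :
  cabs (\prod_(i <- s) F i) = \prod_(i <- s) cabs (F i).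
Proof.
by elim: s => [|a s IH]; rewrite ?big_nil ?cabs1// !big_cons cabsM IH.
Qed.

Lemma cabsN z : cabs (- z) = cabs z.
Proof. by rewrite !cabsRI; case: z => a b /=; rewrite !sqrrN. Qed.

Lemma cabsD z w : cabs (z + w) <= cabs z + cabs w.
Proof. by rewrite -lecR rmorphD /= -!cabsE; apply: ler_normD. Qed.

Lemma cabsBC z w : cabs (z - w) = cabs (w - z).
Proof. by rewrite -cabsN opprB. Qed.

Lemma cabsB z w : cabs (z - w) <= cabs z + cabs w.
Proof. by rewrite -(cabsN w); apply: cabsD. Qed.

Lemma cabs_sum (I : Type) (s : seq I) (F : I -> R[i]) :
  cabs (\sum_(i <- s) F i) <= \sum_(i <- s) cabs (F i).
Proof.
elim: s => [|a s IH]; rewrite ?big_nil ?cabs0// !big_cons.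
by apply: le_trans (cabsD _ _) _; rewrite lerD2l.
Qed.

Lemma Re_cabs z : `|complex.Re z| <= cabs z.
Proof. by rewrite cabsRI -sqrtr_sqr ler_wsqrtr// lerDl sqr_ge0. Qed.

Lemma Im_cabs z : `|complex.Im z| <= cabs z.
Proof. by rewrite cabsRI -sqrtr_sqr ler_wsqrtr// lerDr sqr_ge0. Qed.

Lemma cabs_real (x : R) : cabs x%:C%C = `|x|.
Proof. by rewrite cabsRI /= expr0n /= addr0 sqrtr_sqr. Qed.

Lemma cabs_imag (x : R) : cabs (Complex 0 x) = `|x|.
Proof. by rewrite cabsRI /= expr0n /= add0r sqrtr_sqr. Qed.

Lemma cabs_le z : cabs z <= `|complex.Re z| + `|complex.Im z|.
Proof.
case: z => a b /=.
have -> : Complex a b = a%:C%C + Complex 0 b :> R[i].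
  by apply: complex_ext; rewrite ?ReD ?ImD /= ?addr0 ?add0r.
by apply: le_trans (cabsD _ _) _; rewrite cabs_real cabs_imag.
Qed.

Lemma cabs_conj z : cabs z^*%C = cabs z.
Proof. by rewrite !cabsRI; case: z => a b /=; rewrite sqrrN. Qed.

Lemma cabs_iC : cabs (iC R) = 1.
Proof. by rewrite /iC cabs_imag normr1. Qed.

Lemma sqr_cabs z : (cabs z ^+ 2)%:C%C = z * z^*%C.
Proof. by rewrite rmorphXn/= -cabsE sqr_normc. Qed.

(** Reduces a bound on a modulus to a bound on a real part, as in the passage from [max_Re_disc] to
    [max_modulus_disc]. *)
Lemma cabs_rotate z : exists u, cabs u = 1 /\ complex.Re (u * z) = cabs z.
Proof.
have [->|z0] := eqVneq z 0.
  by exists 1; rewrite cabs1 mulr0 cabs0.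
exists (z^*%C / (cabs z)%:C%C).
have c0 := cabs_gt0 z0; split.
  by rewrite cabsM cabs_conj cabsV cabs_real gtr0_norm// divff ?gt_eqF.
rewrite mulrAC [_ * z]mulrC -sqr_cabs rmorphXn expr2 mulfK//.
by rewrite (inj_eq (@complexI R) _ 0) gt_eqF.
Qed.

End ComplexModulus.
Arguments cabs : simpl never.

(** * Epsilon-delta continuity for real-valued distances *)

Section EpsilonDelta.
Context {R : realType}.

(** The norm of [R[i]^o] takes its values in [R[i]]. A distance with values in [R] and the same
    neighbourhoods lets all estimates be made in an ordered field. *)
Definition metrizes {T : topologicalType} (d : T -> T -> R) :=
  [/\ forall x y, d x y = d y x,
      forall x y z, d x z <= d x y + d y z,
      forall x, d x x = 0 &
      forall x U, nbhs x U <-> exists2 r : R, 0 < r & forall y, d x y < r -> U y].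

Definition cont_on {T U : Type} (dT : T -> T -> R) (dU : U -> U -> R)
  (K : set T) (f : T -> U) :=
  forall x, K x -> forall e : R, 0 < e ->
    exists2 r : R, 0 < r & forall y, K y -> dT x y < r -> dU (f x) (f y) < e.

Lemma within_cont_on (T U : topologicalType) dT dU (K : set T) (f : T -> U) :
  metrizes dT -> metrizes dU ->
  {within K, continuous f} <-> cont_on dT dU K f.
Proof.
move=> [_ _ _ nT] [_ _ dU0 nU]; rewrite subspace_continuousP; split.
- move=> cf x Kx e e0; have /cf : K x by [].
  have /nU /[swap]/[apply] : exists2 r : R, 0 < r &
      forall y, dU (f x) y < r -> [set y | dU (f x) y < e] y by exists e.
  move=> /nT [r r0 rP]; exists r => // y Ky xy.
  exact: rP.
- move=> cf x Kx V /nU[e e0 eV].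
  have [r r0 rP] := cf _ Kx _ e0.
  by apply/nT; exists r => // y xy Ky; apply/eV/rP.
Qed.

(** Heine-Cantor. With compactness in near-covering form, the sought radius is a parameter tending
    to 0 from the right, and only points near a given one have to be treated. *)
Lemma cont_on_unif {T : topologicalType} {U : Type} dT (dU : U -> U -> R)
    (K : set T) (f : T -> U) :
  metrizes dT -> (forall x y, dU x y = dU y x) ->
  (forall x y z, dU x z <= dU x y + dU y z) ->
  compact K -> cont_on dT dU K f ->
  forall e : R, 0 < e -> exists2 r : R, 0 < r &
    forall x y, K x -> K y -> dT x y < r -> dU (f x) (f y) < e.
Proof.
move=> [sT tT d0 nT] sU tU /compact_near_coveringP cK cf e e0.
have /cK : forall x, K x -> \forall x' \near x & r \near 0^'+,
    (fun (r : R) x => K x -> forall y, K y -> dT x y < r -> dU (f x) (f y) < e) r x'.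
  move=> x Kx; have [r r0 rP] := cf _ Kx _ (divr_gt0 e0 (ltr0n _ 2)).
  have r20 : 0 < r / 2 by rewrite divr_gt0.
  exists ([set x' | dT x x' < r / 2], [set s | 0 < s < r / 2]) => /=.
    split; first by apply/nT; exists (r/2).
    by near=> s; apply/andP; split; [near: s; exact: nbhs_right_gt | near: s; exact: nbhs_right_lt].
  move=> [x' s] [/= xx' /andP[s0 sr]] Kx' y Ky x'y.
  have xy : dT x y < r.
    apply: le_lt_trans (tT _ x' _) _.
    by rewrite [r]splitr ltrD// (lt_trans x'y).
  have xx'r : dT x x' < r.
    by apply: lt_trans xx' _; rewrite ltr_pdivrMr// ltr_pMr// ltr1n.
  apply: le_lt_trans (tU _ (f x) _) _.
  by rewrite [e]splitr ltrD// ?(sU (f x')) rP.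
move=> [r /= r0 rP]; exists (r / 2); first by rewrite divr_gt0.
move=> x y Kx Ky xy.
apply: (rP (r/2)) => //=; last by rewrite divr_gt0.
by rewrite /ball/= sub0r normrN gtr0_norm ?divr_gt0// ltr_pdivrMr// ltr_pMr// ltr1n.
Unshelve. all: by end_near. Qed.

End EpsilonDelta.

Section Distances.
Context {R : realType}.

Definition rdist (x y : R) : R := `|x - y|.
Definition cdist1 (x y : R[i]) : R := cabs (x - y).
Definition cdist {n} (x y : 'rV[R[i]^o]_n) : R :=
  \sum_(j < n) cabs (x ord0 j - y ord0 j).

Lemma rdist_sym x y : rdist x y = rdist y x.
Proof. exact: distrC. Qed.

Lemma rdist_triangle x y z : rdist x z <= rdist x y + rdist y z.
Proof. exact: ler_distD. Qed.

Lemma rdist_metrizes : metrizes (rdist : R^o -> R^o -> R).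
Proof.
split=> [x y|x y z|x|x U]; [exact: rdist_sym|exact: rdist_triangle|
  by rewrite /rdist subrr normr0|].
split; first by move=> /nbhs_ballP[e /= e0 eU]; exists e.
by move=> [r r0 rU]; apply/nbhs_ballP; exists r.
Qed.

Lemma cdist1_sym (x y : R[i]) : cdist1 x y = cdist1 y x.
Proof. exact: cabsBC. Qed.

Lemma cdist1_triangle (x y z : R[i]) : cdist1 x z <= cdist1 x y + cdist1 y z.
Proof.
by apply: le_trans (cabsD _ _); rewrite addrA subrK.
Qed.

Lemma cdist1_metrizes : metrizes (cdist1 : R[i]^o -> R[i]^o -> R).
Proof.
split=> [x y|x y z|x|x U]; [exact: cdist1_sym|exact: cdist1_triangle|
  by rewrite /cdist1 subrr cabs0|].
split.
  move=> /nbhs_ballP[[e e'] /=]; rewrite ltcE /= => /andP[/eqP e'0 e0] eU.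
  exists e => // y xy; apply: eU.
  by rewrite /ball/= e'0 -[Complex e 0]/(e%:C%C) cabsE ltcR.
move=> [r r0 rU]; apply/nbhs_ballP; exists r%:C%C; first by rewrite /= ltcR.
by move=> y; rewrite /ball/= cabsE ltcR => /rU.
Qed.

Lemma cdist_metrizes n : metrizes (@cdist n).
Proof.
split=> [x y|x y z|x|x U].
- by apply: eq_bigr => j _; rewrite cabsBC.
- rewrite -big_split; apply: ler_sum => j _.
  exact: cdist1_triangle.
- by apply: big1 => j _; rewrite subrr cabs0.
have [_ _ _ nC] := cdist1_metrizes; split.
- move=> [P Px PU].
  have /choice[r rP] : forall j : 'I_n, exists r : R, 0 < r /\
      forall w, cdist1 (x ord0 j) w < r -> P ord0 j w.
    by move=> j; have /nC[r r0 rP] := Px ord0 j; exists r.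
  exists (\big[Num.min/1]_j r j).
    by rewrite lt_bigmin// => j _; case: (rP j).
  move=> y xy; apply: PU => i j; rewrite (ord1 i); apply: (rP j).2.
  have jr : \big[Num.min/1]_j r j <= r j by exact: bigmin_le.
  apply: lt_le_trans jr; apply: le_lt_trans xy.
  rewrite /cdist (bigD1 j)//= lerDl.
  by apply: sumr_ge0 => k _; exact: cabs_ge0.
- move=> [r r0 rU].
  have r1 : 0 < r / n.+1%:R by rewrite divr_gt0.
  exists (fun i j => [set w : R[i]^o | cdist1 (x i j) w < r / n.+1%:R]).
    by move=> i j; apply/nC; exists (r / n.+1%:R).
  move=> y /= xy; apply: rU.
  have : cdist x y <= \sum_(j < n) (r / n.+1%:R).
    by apply: ler_sum => j _; exact/ltW/xy.
  move=> /le_lt_trans; apply.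
  rewrite sumr_const card_ord -[ltLHS]mulr_natr.
  by rewrite mulrAC ltr_pdivrMr// ltr_pM2l// ltr_nat.
Qed.

Lemma cdist_coord n (x y : 'rV[R[i]^o]_n) j :
  cabs (x ord0 j - y ord0 j) <= cdist x y.
Proof.
rewrite /cdist (bigD1 j)//= lerDl.
by apply: sumr_ge0 => k _; exact: cabs_ge0.
Qed.

Lemma cdist_ge0 n (x y : 'rV[R[i]^o]_n) : 0 <= cdist x y.
Proof. by apply: sumr_ge0 => k _; exact: cabs_ge0. Qed.

(** Makes compact sets closed, hence Borel. *)
Lemma cdist_hausdorff n : hausdorff_space 'rV[R[i]^o]_n.
Proof.
have [sT tT d0 nT] := cdist_metrizes n.
move=> p q pq.
suff /eqP : cdist p q = 0.
  rewrite psumr_eq0; last by move=> *; exact: cabs_ge0.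
  move=> /allP pq0; apply/rowP => j.
  have /pq0/eqP/cabs_eq0/eqP : j \in index_enum 'I_n by rewrite mem_index_enum.
  by rewrite subr_eq0 => /eqP.
apply/eqP; rewrite eq_le cdist_ge0 andbT leNgt; apply/negP => c0.
have c20 : 0 < cdist p q / 2 by rewrite divr_gt0.
have [] := pq [set y | cdist p y < cdist p q / 2] [set y | cdist q y < cdist p q / 2].
- by apply/nT; exists (cdist p q / 2).
- by apply/nT; exists (cdist p q / 2).
move=> y [/= py qy]; have := tT p y q.
rewrite leNgt => /negP; apply; rewrite (sT y) [X in _ < X]splitr.
exact: ltrD.
Qed.

(** The disc is a closed part of the image of a square under [Complex], so its compactness comes
    from that of segments. *)
Lemma cdist1_compact_disc (r : R) : compact [set z : R[i]^o | cabs z <= r].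
Proof.
pose f (p : R^o * R^o) : R[i]^o := Complex p.1 p.2.
have [sC tC _ nC] := cdist1_metrizes.
have fc : continuous f.
  move=> p V /nC[e e0 eV].
  have e20 : 0 < e / 2 by rewrite divr_gt0.
  exists (ball p.1 (e/2), ball p.2 (e/2)) => /=.
    by split; apply: nbhsx_ballx.
  move=> [a b] [/= pa pb]; apply: eV.
  apply: le_lt_trans (cabs_le _) _.
  by rewrite [e]splitr ltrD.
have seg : compact (`[- r, r]%classic `*` `[- r, r]%classic : set (R^o * R^o)).
  by apply: compact_setX; exact: segment_compact.
have := continuous_compact _ seg => /(_ _ f); move=> /(_ (continuous_subspaceT fc)).
move=> cim; apply: (subclosed_compact _ cim).
- rewrite -(@setCK _ [set z | _]); apply: open_closedC.
  rewrite openE => z /= /negP; rewrite -ltNge => rz.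
  apply/nC; exists (cabs z - r); first by rewrite subr_gt0.
  move=> w zw /=; apply/negP; rewrite -ltNge.
  rewrite ltrBrDl -ltrBrDr in zw.
  apply: lt_le_trans zw _; rewrite lerBlDr.
  by rewrite -[z in X in X <= _](subrK w) addrC; apply: cabsD.
- move=> z /= zr; exists (complex.Re z, complex.Im z); last by case: (z).
  by split; rewrite /= in_itv /= -ler_norml; apply: le_trans zr;
     [exact: Re_cabs|exact: Im_cabs].
Qed.

End Distances.

(** * Goursat's theorem, maximum modulus and Weierstrass' theorem on the disc *)

Section IntervalIntegral.
Context {R : realType}.
Implicit Types (a b c p q e : R) (phi psi : R -> R).

Definition itv_int a b phi : R :=
  \int[@lebesgue_measure R]_(x in `[a, b]) phi x.

Definition itv_cont a b phi : Prop := {within `[a, b], continuous phi}.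

Lemma itv_cont_sub a b c d phi : a <= c -> d <= b ->
  itv_cont a b phi -> itv_cont c d phi.
Proof.
move=> ac db; apply: continuous_subspaceW => x /=.
by rewrite !in_itv /= => /andP[cx xd]; rewrite (le_trans ac) ?(le_trans xd).
Qed.

Lemma itv_cont_all a b phi : continuous phi -> itv_cont a b phi.
Proof. exact: continuous_subspaceT. Qed.

Lemma itv_integrable a b phi : itv_cont a b phi ->
  (@lebesgue_measure R).-integrable `[a, b] (EFin \o phi).
Proof. by apply: continuous_compact_integrable; exact: segment_compact. Qed.

Lemma itv_int_split a b c phi : a <= b -> b <= c -> itv_cont a c phi ->
  itv_int a c phi = itv_int a b phi + itv_int b c phi.
Proof.
move=> ab bc /itv_integrable iphi.
have := @Rintegral_itvB R phi (BLeft a) (BRight c) b iphi.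
rewrite !bnd_simp => /(_ ab bc) h.
rewrite /itv_int -[LHS](subrK (\int[@lebesgue_measure R]_(x in `[a, b]) phi x)) h addrC.
rewrite Rintegral_itv_obnd_cbnd//.
apply: integrableS iphi => //.
by apply: subset_itv; rewrite !bnd_simp.
Qed.

Lemma itv_intB a b phi psi : itv_cont a b phi -> itv_cont a b psi ->
  itv_int a b (fun x => phi x - psi x) = itv_int a b phi - itv_int a b psi.
Proof. by move=> /itv_integrable ? /itv_integrable ?; rewrite /itv_int RintegralB. Qed.

Lemma lebesgue_itv a b : a <= b ->
  fine (@lebesgue_measure R `[a, b]%classic) = b - a.
Proof.
move=> ab; rewrite lebesgue_measure_itv /= lte_fin.
by case: ltgtP ab => //= -> _; rewrite subrr.
Qed.

Lemma itv_int_le a b phi e : a <= b -> itv_cont a b phi ->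
  (forall x, a <= x <= b -> `|phi x| <= e) -> `|itv_int a b phi| <= e * (b - a).
Proof.
move=> ab cphi phie; have iphi := itv_integrable cphi.
rewrite -(lebesgue_itv ab) -Rintegral_cst//.
apply: le_trans (le_normr_Rintegral _ iphi) _ => //.
apply: le_Rintegral => //.
- have := integrable_abse iphi; apply: eq_integrable => //.
- apply: itv_integrable; apply: itv_cont_all; exact: cst_continuous.
Qed.

Lemma affine_continuous p q m : continuous (fun x : R => p + q * (x - m)).
Proof.
move=> x; apply/differentiable_continuous/derivable1_diffP.
have : is_derive x 1 (fun x : R => p + q * (x - m)) q.
  by apply: is_derive_eq; rewrite /GRing.scale/=; lra.
by case.
Qed.

Lemma itv_int_affine a b p q m : a <= b ->
  itv_int a b (fun x => p + q * (x - m)) =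
  p * (b - a) + q * ((b - m) ^+ 2 - (a - m) ^+ 2) / 2.
Proof.
rewrite le_eqVlt => /predU1P[->|ab].
  rewrite /itv_int set_itv1 Rintegral_set1; ring.
pose F x : R := p * x + q / 2 * (x - m) ^+ 2.
have dF (x : R) : is_derive x 1 F (p + q * (x - m)).
  by rewrite /F; apply: is_derive_eq; rewrite /GRing.scale/=; lra.
have cF : continuous F.
  by move=> x; apply/differentiable_continuous/derivable1_diffP; case: (dF x).
have := @continuous_FTC2 R (fun x => p + q * (x - m)) F a b ab.
rewrite /itv_int /Rintegral => ->; last 3 first.
- exact/continuous_subspaceT/affine_continuous.
- split; first by move=> x _; case: (dF x).
  + by apply: cvg_at_right_filter; exact: cF.
  + by apply: cvg_at_left_filter; exact: cF.
- by move=> x _; rewrite derive1E; case: (dF x).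
by rewrite /= /F; field.
Qed.

Lemma itv_int_shift a b c phi : a <= b -> itv_cont (a + c) (b + c) phi ->
  itv_int (a + c) (b + c) phi = itv_int a b (fun x => phi (x + c)).
Proof.
rewrite le_eqVlt => /predU1P[->|ab] cphi.
  by rewrite /itv_int !set_itv1 !Rintegral_set1.
have dF (x : R) : is_derive x 1 (fun x : R => x + c) (1 : R).
  by apply: is_derive_eq; rewrite addr0.
have dE : derive1 (fun x : R => x + c) = cst 1.
  by apply/funext => x; rewrite derive1E; case: (dF x).
have cF : continuous (fun x : R => x + c).
  by move=> x; apply/differentiable_continuous/derivable1_diffP; case: (dF x).
rewrite /itv_int /Rintegral; congr fine.
rewrite (@integration_by_substitution_increasing R (fun x => x + c) phi a b (ltW ab)).
- by apply: eq_integral => x _ /=; rewrite dE /= mulr1.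
- by move=> x y _ _ xy; rewrite ltrD2r.
- by rewrite dE => x _; exact: cst_continuous.
- by apply/cvg_ex; exists 1; rewrite dE; apply: cvg_cst.
- by apply/cvg_ex; exists 1; rewrite dE; apply: cvg_cst.
- split; first by move=> x _; case: (dF x).
  + by apply: cvg_at_right_filter; exact: cF.
  + by apply: cvg_at_left_filter; exact: cF.
- exact: cphi.
Qed.

(** This is how differentiability enters integrals: the affine function is a first-order expansion
    centred at [m], which may be an end of the interval or lie outside it. *)
Lemma itv_int_near_affine a b p q m e phi : a <= b -> itv_cont a b phi ->
  (forall x, a <= x <= b -> `|phi x - (p + q * (x - m))| <= e) ->
  `|itv_int a b phi - (p * (b - a) + q * ((b - m) ^+ 2 - (a - m) ^+ 2) / 2)|
    <= e * (b - a).
Proof.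
move=> ab cphi h; rewrite -itv_int_affine// -itv_intB//.
- apply: itv_int_le => //; apply/subspace_continuousP => x xab.
  apply: cvgB; first by move/subspace_continuousP : cphi; exact.
  by apply: cvg_within_filter; exact: affine_continuous.
- exact/continuous_subspaceT/affine_continuous.
Qed.

End IntervalIntegral.
#[global] Opaque itv_int.

Section Goursat.
Context {R : realType}.
Implicit Types (f : R[i] -> R[i]) (z l : R[i]) (x y a b w h : R).

(** Multiplied out, the condition makes sense at [v = 0], so no punctured neighbourhood appears;
    [cderivP] links it to [derivable]. *)
Definition cderiv f z l := forall e : R, 0 < e -> exists2 r : R, 0 < r &
  forall v, cabs v < r -> cabs (f (z + v) - f z - l * v) <= e * cabs v.

Lemma cderiv_cont f z l : cderiv f z l -> forall e : R, 0 < e ->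
  exists2 r : R, 0 < r & forall v, cabs v < r -> cabs (f (z + v) - f z) < e.
Proof.
move=> fl e e0; have [r r0 rP] := fl 1 ltr01.
have L0 : 0 < 2 + cabs l by rewrite ltr_wpDr// cabs_ge0.
exists (Num.min r (e / (2 + cabs l))).
  by rewrite lt_min r0 divr_gt0.
move=> v; rewrite lt_min => /andP[vr ve].
rewrite -(subrK (l * v) (f _ - _)); apply: le_lt_trans (cabsD _ _) _.
move: ve; rewrite ltr_pdivlMr// => ve.
apply: le_lt_trans (lerD (rP _ vr) (lexx _)) _; rewrite cabsM.
apply: le_lt_trans ve; rewrite mulrDr mul1r [cabs l * _]mulrC.
by rewrite lerD2r ler_peMr ?cabs_ge0// ler1n.
Qed.

Lemma itv_contP a b (phi : R -> R) :
  (forall s, a <= s <= b -> forall e : R, 0 < e -> exists2 r : R, 0 < r &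
    forall t, `|t| < r -> `|phi (s + t) - phi s| < e) -> itv_cont a b phi.
Proof.
move=> H; apply/(within_cont_on _ _ rdist_metrizes rdist_metrizes).
move=> s; rewrite /= in_itv /= => sab e /(H _ sab)[r r0 rP]; exists r => // t _.
have := rP (t - s); rewrite (_ : s + (t - s) = t); last by ring.
by rewrite /rdist distrC (distrC (phi t)); exact.
Qed.

Lemma Re_line_cont f a b y :
  (forall s, a <= s <= b -> exists l, cderiv f (Complex s y) l) ->
  itv_cont a b (fun s => complex.Re (f (Complex s y))).
Proof.
move=> H; apply: itv_contP => s /H[l /cderiv_cont fc] e /fc[r r0 rP].
exists r => // t tr; rewrite -ReN -ReD; apply: le_lt_trans (Re_cabs _) _.
have -> : Complex (s + t) y = Complex s y + t%:C%C.
  by apply: complex_ext; rewrite ?ReD ?ImD /= ?addr0.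
by apply: rP; rewrite cabs_real.
Qed.

Lemma Im_line_cont f a b x :
  (forall s, a <= s <= b -> exists l, cderiv f (Complex x s) l) ->
  itv_cont a b (fun s => complex.Im (f (Complex x s))).
Proof.
move=> H; apply: itv_contP => s /H[l /cderiv_cont fc] e /fc[r r0 rP].
exists r => // t tr; rewrite -ImN -ImD; apply: le_lt_trans (Im_cabs _) _.
have -> : Complex x (s + t) = Complex x s + Complex 0 t.
  by apply: complex_ext; rewrite ?ReD ?ImD /= ?addr0.
by apply: rP; rewrite cabs_imag.
Qed.

(* real part of the contour integral of [f] over the boundary of the rectangle
   with lower left corner (x, y), width w and height h *)
Definition contour f x y w h : R :=
  itv_int x (x + w) (fun s => complex.Re (f (Complex s y)))
  - itv_int x (x + w) (fun s => complex.Re (f (Complex s (y + h))))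
  - itv_int y (y + h) (fun s => complex.Im (f (Complex (x + w) s)))
  + itv_int y (y + h) (fun s => complex.Im (f (Complex x s))).

Definition diff_on_rect f x y w h := forall s t,
  x <= s <= x + w -> y <= t <= y + h -> exists l, cderiv f (Complex s t) l.

Lemma diff_on_subrect f x y w h x' y' w' h' :
  x <= x' -> x' + w' <= x + w -> y <= y' -> y' + h' <= y + h ->
  diff_on_rect f x y w h -> diff_on_rect f x' y' w' h'.
Proof.
move=> xx ww yy hh df s t /andP[xs sx] /andP[yt ty]; apply: df.
  by rewrite (le_trans xx xs) (le_trans sx ww).
by rewrite (le_trans yy yt) (le_trans ty hh).
Qed.

(** A side interior to the large rectangle belongs to two quarters, which run through it in opposite
    directions. *)
Lemma contour_split f x y w h : 0 <= w -> 0 <= h ->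
  diff_on_rect f x y (w + w) (h + h) ->
  contour f x y (w + w) (h + h) =
  contour f x y w h + contour f (x + w) y w h
  + contour f x (y + h) w h + contour f (x + w) (y + h) w h.
Proof.
move=> w0 h0 df; rewrite /contour !addrA.
have xw : x <= x + w + w by rewrite -addrA lerDl addr_ge0.
have yh : y <= y + h + h by rewrite -addrA lerDl addr_ge0.
have sp t : y <= t <= y + h + h ->
    itv_int x (x + w + w) (fun s => complex.Re (f (Complex s t))) =
    itv_int x (x + w) (fun s => complex.Re (f (Complex s t)))
  + itv_int (x + w) (x + w + w) (fun s => complex.Re (f (Complex s t))).
  move=> ht; apply: itv_int_split; rewrite ?lerDl//.
  by apply: Re_line_cont => s sx; apply: df; rewrite addrA.
have sp' t : x <= t <= x + w + w ->
    itv_int y (y + h + h) (fun s => complex.Im (f (Complex t s))) =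
    itv_int y (y + h) (fun s => complex.Im (f (Complex t s)))
  + itv_int (y + h) (y + h + h) (fun s => complex.Im (f (Complex t s))).
  move=> ht; apply: itv_int_split; rewrite ?lerDl//.
  by apply: Im_line_cont => s sx; apply: df; rewrite addrA.
rewrite !sp ?sp' ?lexx ?andbT ?lerDl//; ring.
Qed.

(** The contour integral of an affine function vanishes, so only the error remains, integrated over
    a boundary of length [2 * (w + h)]. *)
Lemma contour_near_affine f x y w h a b c l e : 0 <= w -> 0 <= h ->
  diff_on_rect f x y w h ->
  (forall s t, x <= s <= x + w -> y <= t <= y + h ->
    cabs (f (Complex s t) - (c + l * Complex (s - a) (t - b))) <= e) ->
  `|contour f x y w h| <= 2 * e * (w + h).
Proof.
move=> w0 h0 df H.
have xx : x <= x + w by rewrite lerDl.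
have yy : y <= y + h by rewrite lerDl.
have hor t : y <= t <= y + h ->
  `|itv_int x (x + w) (fun s => complex.Re (f (Complex s t)))
   - ((complex.Re c - complex.Im l * (t - b)) * (x + w - x)
     + complex.Re l * ((x + w - a) ^+ 2 - (x - a) ^+ 2) / 2)| <= e * (x + w - x).
  move=> ht; apply: itv_int_near_affine => //.
    by apply: Re_line_cont => s sx; apply: df.
  move=> s sx; apply: le_trans (H s t sx ht); apply: le_trans (Re_cabs _).
  rewrite ReD ReN ReD ReM /= le_eqVlt; apply/orP; left; apply/eqP.
  by congr `|_|; ring.
have ver t : x <= t <= x + w ->
  `|itv_int y (y + h) (fun s => complex.Im (f (Complex t s)))
   - ((complex.Im c + complex.Im l * (t - a)) * (y + h - y)
     + complex.Re l * ((y + h - b) ^+ 2 - (y - b) ^+ 2) / 2)| <= e * (y + h - y).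
  move=> ht; apply: itv_int_near_affine => //.
    by apply: Im_line_cont => s sx; apply: df.
  move=> s sx; apply: le_trans (H t s ht sx); apply: le_trans (Im_cabs _).
  rewrite ImD ImN ImD ImM /= le_eqVlt; apply/orP; left; apply/eqP.
  by congr `|_|; ring.
have := hor y; have := hor (y + h); have := ver x; have := ver (x + w).
rewrite !lexx xx yy /= /contour.
move=> /(_ isT) h1 /(_ isT) h2 /(_ isT) h3 /(_ isT) h4.
move: h1 h2 h3 h4.
rewrite !ler_norml => /andP[? ?] /andP[? ?] /andP[? ?] /andP[? ?].
apply/andP; split; lra.
Qed.

(** Repeated quartering: a nonzero value [B] in modulus would leave at each stage [k] a rectangle
    carrying at least [B / 4 ^+ k], which differentiability at the common point of these nested
    rectangles forbids. *)
Lemma goursat f x y w h : 0 <= w -> 0 <= h -> diff_on_rect f x y w h ->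
  contour f x y w h = 0.
Proof.
move=> w0 h0 df; apply/eqP; rewrite -normr_le0 leNgt; apply/negP => B0.
set B := `|contour f x y w h| in B0.
pose W k : R := w / 2 ^+ k; pose H k : R := h / 2 ^+ k.
have WS k : W k = W k.+1 + W k.+1.
  by rewrite /W exprS invfM; field; rewrite expf_neq0.
have HS k : H k = H k.+1 + H k.+1.
  by rewrite /H exprS invfM; field; rewrite expf_neq0.
have W0 k : 0 <= W k by rewrite divr_ge0 ?exprn_ge0.
have H0 k : 0 <= H k by rewrite divr_ge0 ?exprn_ge0.
(* A state is a stage together with the lower left corner of its rectangle. [P] bounds the contour
   integral from below, and [T] says that the next rectangle lies inside the present one. *)
pose P (s : nat * (R * R)) := let: (k, (u, v)) := s in
  [/\ x <= u, u + W k <= x + w, y <= v, v + H k <= y + h &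
      B / 4 ^+ k <= `|contour f u v (W k) (H k)|].
pose T (s s' : nat * (R * R)) := [/\ s'.1 = s.1.+1,
  s.2.1 <= s'.2.1, s'.2.1 + W s'.1 <= s.2.1 + W s.1,
  s.2.2 <= s'.2.2 & s'.2.2 + H s'.1 <= s.2.2 + H s.1].
have step s : P s -> exists2 s', P s' & T s s'.
  case: s => k [u v] [xu ux yv vy Bk].
  have Bk1 : B / 4 ^+ k = 4 * (B / 4 ^+ k.+1).
    by rewrite exprS invfM; field; rewrite expf_neq0.
  have dk := diff_on_subrect xu ux yv vy df.
  rewrite (WS k) (HS k) in dk.
  move: Bk; rewrite {}Bk1 (WS k) (HS k) contour_split// => Bk.
  move: (WS k) (HS k) (W0 k.+1) (H0 k.+1) => Wk Hk Wk0 Hk0.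
  have [h1|h1] := leP (B / 4 ^+ k.+1) `|contour f u v (W k.+1) (H k.+1)|.
    by exists (k.+1, (u, v)) => //; split=> //=; lra.
  have [h2|h2] := leP (B / 4 ^+ k.+1) `|contour f (u + W k.+1) v (W k.+1) (H k.+1)|.
    by exists (k.+1, (u + W k.+1, v)); split=> //=; lra.
  have [h3|h3] := leP (B / 4 ^+ k.+1) `|contour f u (v + H k.+1) (W k.+1) (H k.+1)|.
    by exists (k.+1, (u, v + H k.+1)); split=> //=; lra.
  have [h4|h4] := leP (B / 4 ^+ k.+1) `|contour f (u + W k.+1) (v + H k.+1) (W k.+1) (H k.+1)|.
    by exists (k.+1, (u + W k.+1, v + H k.+1)); split=> //=; lra.
  exfalso; move: Bk; rewrite leNgt => /negP; apply.
  move: h1 h2 h3 h4; rewrite !ltr_norml => /andP[? ?] /andP[? ?] /andP[? ?] /andP[? ?].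
  by apply/andP; split; lra.
have P0 : P (0%N, (x, y)).
  by rewrite /P /W /H !expr0 !divr1; split.
have [q [q0 qS]] := @dependent_choice {s | P s} (fun s s' => T (sval s) (sval s'))
  (fun s => cid (let: exist s Ps := s return exists s' : {s | P s}, T (sval s) (sval s') in
    let: ex_intro2 s' Ps' Tss := step s Ps in ex_intro _ (exist _ s' Ps') Tss))
  (exist _ _ P0).
pose X k := (sval (q k)).2.1; pose Y k := (sval (q k)).2.2.
have qk k : (sval (q k)).1 = k.
  elim: k => [|k IH]; first by rewrite q0.
  by have [-> _ _ _ _] := qS k; rewrite IH.
have XP k : [/\ x <= X k, X k + W k <= x + w, y <= Y k, Y k + H k <= y + h &
      B / 4 ^+ k <= `|contour f (X k) (Y k) (W k) (H k)|].
  have := svalP (q k); rewrite /P /X /Y.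
  by case: (sval (q k)) (qk k) => k' [u v] /= ->.
have XS k : [/\ X k <= X k.+1, X k.+1 + W k.+1 <= X k + W k,
    Y k <= Y k.+1 & Y k.+1 + H k.+1 <= Y k + H k].
  by have [] := qS k; rewrite !qk.
have nested (U L : nat -> R) : (forall k, 0 <= L k) ->
    (forall k, U k <= U k.+1 /\ U k.+1 + L k.+1 <= U k + L k) ->
    exists c, forall k, U k <= c <= U k + L k.
  move=> L0 UL.
  have mono i j : U i <= U (i + j)%N /\ U (i + j)%N + L (i + j)%N <= U i + L i.
    elim: j => [|j [IH1 IH2]]; first by rewrite addn0.
    rewrite addnS; have [? ?] := UL (i + j)%N.
    by split; [apply: le_trans IH1 _|apply: le_trans IH2].
  have bd i j : U i <= U j + L j.
    case: (leqP i j) => [/subnKC <-|/ltnW/subnKC <-].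
      have [h1 _] := mono i (j - i)%N; apply: le_trans h1 _.
      by rewrite lerDl.
    have [_ h2] := mono j (i - j)%N; apply: le_trans h2.
    by rewrite lerDl.
  have hs : has_sup (range U).
    split; first by exists (U 0%N), 0%N.
    by exists (U 0%N + L 0%N) => _ [i _ <-].
  exists (sup (range U)) => k; apply/andP; split.
    by apply: ub_le_sup; [case: hs|exists k].
  apply: ge_sup; first by case: hs.
  by move=> _ [i _ <-].
have [c cP] := nested X W W0 (fun k => let: And4 a b _ _ := XS k in conj a b).
have [d dP] := nested Y H H0 (fun k => let: And4 _ _ a b := XS k in conj a b).
have [l fl] : exists l, cderiv f (Complex c d) l.
  apply: df.
    have := cP 0%N; have [? ? _ _ _] := XP 0%N.
    by move=> /andP[? ?]; apply/andP; split; lra.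
  have := dP 0%N; have [_ _ ? ? _] := XP 0%N.
  by move=> /andP[? ?]; apply/andP; split; lra.
have wh0 : 0 <= w + h by rewrite addr_ge0.
(* At stage [k] the contour integral is at most [2 * e * (w + h) ^+ 2 / 4 ^+ k], which this [e]
   brings below [B / 4 ^+ k]. The added 1 keeps the denominator positive for a degenerate
   rectangle. *)
pose e := B / (4 * (w + h + 1) ^+ 2).
have wh1 : 0 < w + h + 1 by rewrite ltr_wpDl.
have e0 : 0 < e by rewrite divr_gt0 // mulr_gt0 // exprn_gt0.
have [r r0 rP] := fl _ e0.
have [k kr] : exists k : nat, (w + h) / 2 ^+ k < r.
  exists (Num.truncn ((w + h) / r)).+1.
  rewrite ltr_pdivrMr ?exprn_gt0// mulrC -ltr_pdivrMr//.
  apply: lt_trans (truncnS_gt _) _.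
  by rewrite -natrX ltr_nat ltn_expl.
have [xX Xx yY Yy Bk] := XP k.
have dk : diff_on_rect f (X k) (Y k) (W k) (H k).
  exact: diff_on_subrect df.
have WH : W k + H k = (w + h) / 2 ^+ k by rewrite /W /H mulrDl.
have small s t : X k <= s <= X k + W k -> Y k <= t <= Y k + H k ->
    cabs (Complex (s - c) (t - d)) <= W k + H k.
  have /andP[? ?] := cP k; have /andP[? ?] := dP k.
  move=> /andP[? ?] /andP[? ?]; apply: le_trans (cabs_le _) _ => /=.
  by apply: lerD; rewrite ler_norml; apply/andP; split; lra.
have near s t : X k <= s <= X k + W k -> Y k <= t <= Y k + H k ->
    cabs (f (Complex s t) - (f (Complex c d) + l * Complex (s - c) (t - d)))
      <= e * (W k + H k).
  move=> hs ht; have sm := small s t hs ht.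
  rewrite opprD addrA.
  have -> : Complex s t = Complex c d + Complex (s - c) (t - d).
    by apply: complex_ext; rewrite ?ReD ?ImD /= addrC subrK.
  apply: le_trans (rP _ _) _; first by apply: le_lt_trans sm _; rewrite WH.
  by rewrite ler_pM2l.
have := contour_near_affine (W0 k) (H0 k) dk near.
move=> /(le_trans Bk); rewrite WH leNgt => /negP; apply.
have -> : 2 * (e * ((w + h) / 2 ^+ k)) * ((w + h) / 2 ^+ k) =
    2 * e * (w + h) ^+ 2 / 4 ^+ k.
  rewrite (_ : 4 = 2 * 2 :> R); last by ring.
  by rewrite exprMn; field; rewrite expf_neq0.
rewrite ltr_pM2r ?invr_gt0 ?exprn_gt0// /e.
rewrite (_ : _ * _ = B * ((w + h) ^+ 2 / (2 * (w + h + 1) ^+ 2))); last first.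
  by field; rewrite gt_eqF.
rewrite gtr_pMr// ltr_pdivrMr ?mulr_gt0 ?exprn_gt0// mul1r.
by have := sqr_ge0 (w + h); rewrite (sqrrD _ 1) expr1n mulr1; lra.
Qed.

End Goursat.

Lemma cont_on_max {R : realType} {T : topologicalType} (dT : T -> T -> R)
    (K : set T) (phi : T -> R) :
  metrizes dT -> K !=set0 -> compact K -> cont_on dT rdist K phi ->
  exists2 c, K c & forall t, K t -> phi t <= phi c.
Proof.
move=> mT K0 cK /(within_cont_on _ _ mT rdist_metrizes) cphi.
have [c /set_mem Kc cmax] := compact_EVT_max K0 cK cphi.
by exists c => // t Kt; apply/cmax/mem_set.
Qed.

Section MaximumModulus.
Context {R : realType}.
Implicit Types (f : R[i] -> R[i]) (z l : R[i]).

Definition disc_alg f :=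
  cont_on cdist1 cdist1 [set z : R[i] | cabs z <= 1] f /\
  forall z, cabs z < 1 -> exists l, cderiv f z l.

Lemma disc_alg_unif f : disc_alg f -> forall e : R, 0 < e ->
  exists2 r : R, 0 < r & forall z w, cabs z <= 1 -> cabs w <= 1 ->
    cabs (z - w) < r -> cabs (f z - f w) < e.
Proof.
move=> [fc _]; apply: (cont_on_unif cdist1_metrizes cdist1_sym cdist1_triangle _ fc).
exact: cdist1_compact_disc.
Qed.

(** This is the real part of [G (z + h) - G z] for a primitive [G] of [f]. As [f] is only known to
    have one derivative, second differences of its real part are out of reach, whereas those of this
    integral involve only first-order expansions of [f]. Divided by [h], it is close to the real
    part of [f] for small [h]. *)
Definition hmean f (h : R) (z : R[i]) : R :=
  itv_int (complex.Re z) (complex.Re z + h)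
    (fun s => complex.Re (f (Complex s (complex.Im z)))).

Lemma hmean_near f h z b e : 0 <= h ->
  (forall s, complex.Re z <= s <= complex.Re z + h ->
    exists l, cderiv f (Complex s (complex.Im z)) l) ->
  (forall s, complex.Re z <= s <= complex.Re z + h ->
    `|complex.Re (f (Complex s (complex.Im z))) - b| <= e) ->
  `|hmean f h z - b * h| <= e * h.
Proof.
move=> h0 df H.
have xh : complex.Re z <= complex.Re z + h by rewrite lerDl.
have := @itv_int_near_affine R _ _ b 0 0 e _ xh (Re_line_cont df).
rewrite (_ : complex.Re z + h - complex.Re z = h); last by ring.
rewrite !mul0r addr0; apply => s hs.
by rewrite mul0r addr0; apply: H.
Qed.

(** The constant term cancels between the two halves and the slope contributes [q * k ^+ 2]; each
    half adds an error of [e * k] over a length [k]. *)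
Lemma sym_bracket (phi : R -> R) m p q e k : 0 <= k ->
  itv_cont (m - k) (m + k) phi ->
  (forall t, `|t| <= k -> `|phi (m + t) - (p + q * t)| <= e * k) ->
  `|itv_int m (m + k) phi - itv_int (m - k) m phi - q * k ^+ 2| <= 2 * e * k ^+ 2.
Proof.
move=> k0 cphi H.
have mk : m <= m + k by rewrite lerDl.
have km : m - k <= m by rewrite gerBl.
have near s : m - k <= s <= m + k -> `|phi s - (p + q * (s - m))| <= e * k.
  move=> /andP[h1 h2]; have := H (s - m); rewrite (_ : m + (s - m) = s); last by ring.
  by apply; rewrite ler_norml; apply/andP; split; lra.
have := @itv_int_near_affine R _ _ p q m (e * k) phi mk (itv_cont_sub km (lexx _) cphi).
have := @itv_int_near_affine R _ _ p q m (e * k) phi km (itv_cont_sub (lexx _) mk cphi).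
move=> h1 h2.
have {}h1 := h1 (fun s hs => near s (let: conj a b := andP hs in introT andP (conj a (le_trans b mk)))).
have {}h2 := h2 (fun s hs => near s (let: conj a b := andP hs in introT andP (conj (le_trans km a) b))).
move: h1 h2; rewrite !ler_norml => /andP[? ?] /andP[? ?].
by apply/andP; split; lra.
Qed.

Lemma cderiv_line f z l d (e : R) : cabs d = 1 -> 0 < e -> cderiv f z l ->
  exists2 r : R, 0 < r & forall k : R, 0 < k < r -> forall t, `|t| <= k ->
    cabs (f (z + d * t%:C%C) - (f z + l * d * t%:C%C)) <= e * k.
Proof.
move=> d1 e0 fl; have [r r0 rP] := fl _ e0; exists r => // k /andP[k0 kr] t tk.
have dt : cabs (d * t%:C%C) = `|t| by rewrite cabsM d1 mul1r cabs_real.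
rewrite opprD addrA -mulrA.
apply: le_trans (rP _ _) _; rewrite dt; first exact: le_lt_trans kr.
by rewrite ler_pM2l.
Qed.

(* Second symmetric differences of [hmean] in the two coordinate directions
   cancel to second order; Goursat's theorem gives the vertical ones. *)
Lemma hmean_laplace f h z (r e : R) : 0 < h -> 0 < r -> 0 < e ->
  diff_on_rect f (complex.Re z - r) (complex.Im z - r) (h + r + r) (r + r) ->
  exists2 r' : R, 0 < r' & forall k : R, 0 < k < r' ->
  `|hmean f h (z + k%:C%C) + hmean f h (z - k%:C%C)
    + hmean f h (z + Complex 0 k) + hmean f h (z - Complex 0 k)
    - 4 * hmean f h z| <= 8 * e * k ^+ 2.
Proof.
case: z => x y /= h0 r0 e0 df.
have dfz s t : x - r <= s <= x + h + r -> y - r <= t <= y + r ->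
    exists l, cderiv f (Complex s t) l.
  move=> /andP[? ?] /andP[? ?]; apply: df; apply/andP; split; lra.
have [l0 fl0] : exists l, cderiv f (Complex x y) l.
  by clear -dfz h0 r0; apply: dfz; apply/andP; split; lra.
have [l1 fl1] : exists l, cderiv f (Complex (x + h) y) l.
  by clear -dfz h0 r0; apply: dfz; apply/andP; split; lra.
have [a a0 aP] := cderiv_line cabs1 e0 fl0.
have [b b0 bP] := cderiv_line cabs1 e0 fl1.
have [c c0 cP] := cderiv_line cabs_iC e0 fl0.
have [d d0 dP] := cderiv_line cabs_iC e0 fl1.
exists (Num.min (Num.min r h) (Num.min (Num.min a b) (Num.min c d))).
  by rewrite !lt_min r0 h0 a0 b0 c0 d0.
move=> k; rewrite !lt_min => /andP[k0 /andP[/andP[kr kh] /andP[/andP[ka kb] /andP[kc kd]]]].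
pose phi s := complex.Re (f (Complex s y)).
pose psi u s := complex.Im (f (Complex u s)).
have cphi u v : x - r <= u -> v <= x + h + r -> itv_cont u v phi.
  move=> hu hv; apply: Re_line_cont => s /andP[? ?].
  by apply: dfz; apply/andP; split; lra.
have cpsi u : x - r <= u -> u <= x + h + r -> itv_cont (y - k) (y + k) (psi u).
  move=> hu hv; apply: Im_line_cont => s /andP[? ?].
  by apply: dfz; apply/andP; split; lra.
(* At each end of the path, [hb] expands the real part of [f] horizontally and [vb] the imaginary
   part vertically. Both slopes are the real part of [l]: this equality is the Cauchy-Riemann
   equation that makes the two second differences cancel. *)
have hb m l : x - r + k <= m -> m + k <= x + h + r ->
    (forall t, `|t| <= k ->
      cabs (f (Complex m y + 1 * t%:C%C) - (f (Complex m y) + l * 1 * t%:C%C)) <= e * k) ->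
    `|itv_int m (m + k) phi - itv_int (m - k) m phi - complex.Re l * k ^+ 2|
      <= 2 * e * k ^+ 2.
  move=> m1 m2 H.
  apply: (@sym_bracket _ m (complex.Re (f (Complex m y))));
    [exact: ltW|by clear -cphi m1 m2; apply: cphi; lra|].
  move=> t /H; rewrite !mulr1 !mul1r; apply: le_trans.
  apply: le_trans (Re_cabs _); rewrite ReD ReN ReD ReM /= mulr0 subr0 /phi.
  have -> // : Complex (m + t) y = Complex m y + t%:C%C :> R[i].
  by apply: complex_ext; rewrite ?ReD ?ImD /= ?addr0.
have vb u l : x - r <= u -> u <= x + h + r ->
    (forall t, `|t| <= k ->
      cabs (f (Complex u y + iC R * t%:C%C) - (f (Complex u y) + l * iC R * t%:C%C)) <= e * k) ->
    `|itv_int y (y + k) (psi u) - itv_int (y - k) y (psi u) - complex.Re l * k ^+ 2|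
      <= 2 * e * k ^+ 2.
  move=> m1 m2 H.
  apply: (@sym_bracket _ y (complex.Im (f (Complex u y))));
    [exact: ltW|by apply: cpsi|].
  move=> t /H; apply: le_trans.
  apply: le_trans (Im_cabs _); rewrite /psi.
  have -> : Complex u (y + t) = Complex u y + iC R * t%:C%C :> R[i].
    by apply: complex_ext; rewrite ?ReD ?ImD ?ReM ?ImM /= ?mul0r ?mulr0 ?mul1r ?subr0 ?addr0 ?add0r.
  rewrite le_eqVlt; apply/orP; left; apply/eqP; congr `|_|.
  by rewrite !(ImD, ImN, ReM, ImM) /=; ring.
have k0r : 0 < k < a by rewrite k0 ka.
have h1 := hb x l0 ltac:(clear -k0 kr kh h0 r0; lra) ltac:(clear -k0 kr kh h0 r0; lra) (aP k ltac:(by rewrite k0)).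
have h2 := hb (x + h) l1 ltac:(clear -k0 kr kh h0 r0; lra) ltac:(clear -k0 kr kh h0 r0; lra) (bP k ltac:(by rewrite k0)).
have v1 := vb x l0 ltac:(clear -k0 kr kh h0 r0; lra) ltac:(clear -k0 kr kh h0 r0; lra) (cP k ltac:(by rewrite k0)).
have v2 := vb (x + h) l1 ltac:(clear -k0 kr kh h0 r0; lra) ltac:(clear -k0 kr kh h0 r0; lra) (dP k ltac:(by rewrite k0)).
have spl u v w : x - r <= u -> u <= v -> v <= w -> w <= x + h + r ->
    itv_int u w phi = itv_int u v phi + itv_int v w phi.
  by move=> u1 u2 u3 u4; apply: itv_int_split => //; apply: cphi.
have Ap : itv_int (x + k) (x + k + h) phi =
    itv_int x (x + h) phi - itv_int x (x + k) phi + itv_int (x + h) (x + h + k) phi.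
  have e1 : itv_int x (x + h + k) phi = itv_int x (x + k) phi + itv_int (x + k) (x + h + k) phi.
    by apply: spl; clear -k0 kr kh h0 r0; lra.
  have e2 : itv_int x (x + h + k) phi = itv_int x (x + h) phi + itv_int (x + h) (x + h + k) phi.
    by apply: spl; clear -k0 kr kh h0 r0; lra.
  rewrite (_ : x + k + h = x + h + k); last by ring.
  by clear -e1 e2; lra.
have Am : itv_int (x - k) (x - k + h) phi =
    itv_int x (x + h) phi + itv_int (x - k) x phi - itv_int (x + h - k) (x + h) phi.
  have e1 : itv_int (x - k) (x + h) phi = itv_int (x - k) x phi + itv_int x (x + h) phi.
    by apply: spl; clear -k0 kr kh h0 r0; lra.
  have e2 : itv_int (x - k) (x + h) phi = itv_int (x - k) (x + h - k) phi + itv_int (x + h - k) (x + h) phi.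
    by apply: spl; clear -k0 kr kh h0 r0; lra.
  rewrite (_ : x - k + h = x + h - k); last by ring.
  by clear -e1 e2; lra.
(* Goursat on the thin rectangles above and below the path expresses its vertical translates through
   integrals over the vertical sides. The main terms at the two ends then cancel those of the
   horizontal translates, and four brackets of error [2 * e * k ^+ 2] remain. *)
have Bp : contour f x y h k = 0.
  apply: goursat; [exact: ltW|exact: ltW|]; apply: diff_on_subrect df; clear -k0 kr kh h0 r0; lra.
have Bm : contour f x (y - k) h k = 0.
  apply: goursat; [exact: ltW|exact: ltW|]; apply: diff_on_subrect df; clear -k0 kr kh h0 r0; lra.
rewrite /contour subrK in Bm; rewrite /contour in Bp.
rewrite /hmean !(ReD, ReN, ImD, ImN) /= !(addr0, subr0).
rewrite -/phi in Bp Bm *; rewrite {}Ap {}Am.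
rewrite -/(psi x) -/(psi (x + h)) in Bp Bm.
move: h1 h2 v1 v2; rewrite !ler_norml => /andP[g1 g2] /andP[g3 g4] /andP[g5 g6] /andP[g7 g8].
by clear -g1 g2 g3 g4 g5 g6 g7 g8 Bp Bm; apply/andP; split; lra.
Qed.

End MaximumModulus.

Lemma cont_onD {R : realType} {T : Type} (dT : T -> T -> R) (K : set T)
    (phi psi : T -> R) :
  cont_on dT rdist K phi -> cont_on dT rdist K psi ->
  cont_on dT rdist K (fun x => phi x + psi x).
Proof.
move=> cphi cpsi x Kx e e0; have e20 : 0 < e / 2 by rewrite divr_gt0.
have [a a0 aP] := cphi _ Kx _ e20; have [b b0 bP] := cpsi _ Kx _ e20.
exists (Num.min a b); first by rewrite lt_min a0.
move=> y Ky; rewrite lt_min => /andP[xa xb].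
rewrite /rdist opprD addrACA; apply: le_lt_trans (ler_normD _ _) _.
by rewrite [e]splitr ltrD//; [exact: aP|exact: bP].
Qed.

Section MaximumModulusDisc.
Context {R : realType}.
Implicit Types (f : R[i] -> R[i]) (z l : R[i]).

Lemma cabs_horizontal z (s h : R) : complex.Re z <= s <= complex.Re z + h ->
  cabs (Complex s (complex.Im z) - z) <= h.
Proof.
case: z => x y /= /andP[h1 h2].
have -> : Complex s y - Complex x y = (s - x)%:C%C :> R[i].
  by apply: complex_ext; rewrite ?ReD ?ImD ?ReN ?ImN /= ?subrr.
by rewrite cabs_real ger0_norm ?subr_ge0// lerBlDl.
Qed.

Lemma cabs_triangle3 (z w : R[i]) : cabs w <= cabs z + cabs (w - z).
Proof. by apply: le_trans (cabsD _ _); rewrite addrC subrK. Qed.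

Lemma sqr_cabsE z : cabs z ^+ 2 = complex.Re z ^+ 2 + complex.Im z ^+ 2.
Proof. by rewrite cabsRI sqr_sqrtr// addr_ge0 ?sqr_ge0. Qed.

Lemma hmean_cont f (r h : R) : disc_alg f -> 0 < h -> r + h < 1 ->
  cont_on cdist1 rdist [set z | cabs z <= r] (hmean f h).
Proof.
move=> Af h0 rh z zr e e0.
have eh0 : 0 < e / (2 * h) by rewrite divr_gt0// mulr_gt0.
have [d d0 dP] := disc_alg_unif Af eh0; exists d => // w wr zw.
have shift u : cabs u <= r -> hmean f h u =
    itv_int 0 h (fun s => complex.Re (f (u + s%:C%C))).
  move=> ur; rewrite /hmean addrC -{1}(add0r (complex.Re u)) itv_int_shift.
  - congr itv_int; apply/funext => s; congr (complex.Re (f _)).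
    by apply: complex_ext; rewrite ?ReD ?ImD /= ?addr0// addrC.
  - exact: ltW.
  apply: Re_line_cont => s; rewrite add0r (addrC h) => hs; apply: Af.2.
  apply: le_lt_trans (cabs_triangle3 u _) _; apply: le_lt_trans rh.
  by rewrite lerD// cabs_horizontal.
have lc u : cabs u <= r -> itv_cont 0 h (fun s => complex.Re (f (u + s%:C%C))).
  move=> ur; apply: itv_contP => s /andP[s0 sh] e' e'0.
  have [l /cderiv_cont fl] : exists l, cderiv f (u + s%:C%C) l.
    apply: Af.2; apply: le_lt_trans (cabsD _ _) _; apply: le_lt_trans rh.
    by rewrite lerD// cabs_real ger0_norm.
  have [r' r'0 rP] := fl _ e'0; exists r' => // t tr.
  rewrite -ReN -ReD; apply: le_lt_trans (Re_cabs _) _.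
  by rewrite rmorphD addrA; apply: rP; rewrite cabs_real.
rewrite /rdist !shift// -itv_intB; [|exact: lc..].
apply: (@le_lt_trans _ _ (e / (2 * h) * (h - 0))); last first.
  by rewrite subr0 invfM mulrA mulfVK ?gt_eqF// ltr_pdivrMr// ltr_pMr// ltr1n.
apply: itv_int_le; first exact: ltW.
  have := lc _ zr; have := lc _ wr => cw cz.
  apply/subspace_continuousP => x xab; apply: cvgB.
    by move/subspace_continuousP : cz; exact.
  by move/subspace_continuousP : cw; exact.
move=> s /andP[s0 sh]; rewrite -ReN -ReD; apply: le_trans (Re_cabs _) _.
apply/ltW/dP.
- apply: le_trans (cabsD _ _) _; apply: le_trans (ltW rh).
  by rewrite lerD// cabs_real ger0_norm.
- apply: le_trans (cabsD _ _) _; apply: le_trans (ltW rh).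
  by rewrite lerD// cabs_real ger0_norm.
- by rewrite opprD addrACA subrr addr0.
Qed.

(** If the bound failed, the perturbed mean [v] below would have a maximum at an interior point,
    where its four-point second difference is at most 0. But that of [hmean] is negligible against
    [k ^+ 2], while that of [eta * cabs z ^+ 2] is [4 * eta * k ^+ 2]. *)
Lemma max_Re_disc f (M : R) : disc_alg f ->
  (forall w, cabs w = 1 -> complex.Re (f w) <= M) ->
  forall z, cabs z <= 1 -> complex.Re (f z) <= M.
Proof.
move=> Af fM z0 z01; rewrite leNgt; apply/negP => Mz.
(* With an eighth of the excess as unit, [v] is at most [M + 3 * eta] on the circle of radius [r]
   and at least [M + 7 * eta] at [z0], so its maximum is not on the circle. *)
pose eta := (complex.Re (f z0) - M) / 8.
have eta0 : 0 < eta by rewrite divr_gt0// subr_gt0.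
have Mz0 : complex.Re (f z0) = M + 8 * eta.
  by rewrite /eta mulrC mulfVK// addrC subrK.
clearbody eta.
have [d d0 dP] := disc_alg_unif Af eta0.
pose r : R := 1 - Num.min d 1 / 2.
have m0 : 0 < Num.min d 1 by rewrite lt_min d0 ltr01.
have r1 : r < 1 by rewrite /r ltrBlDr ltrDl divr_gt0.
have rd : 1 - r < d.
  rewrite /r opprB addrC subrK; apply: (@lt_le_trans _ _ (Num.min d 1)).
    by rewrite ltr_pdivrMr// ltr_pMr// ltr1n.
  by rewrite ge_min lexx.
have r0 : 0 < r.
  rewrite /r subr_gt0; apply: (@le_lt_trans _ _ (1/2)).
    by rewrite ler_pM2r ?invr_gt0// ge_min lexx orbT.
  by rewrite ltr_pdivrMr// mul1r ltr1n.
clearbody r.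
have near z : r <= cabs z <= 1 -> complex.Re (f z) <= M + eta.
  move=> /andP[rz z1].
  have cz0 : 0 < cabs z by apply: lt_le_trans rz.
  pose w := z / (cabs z)%:C%C.
  have w1 : cabs w = 1.
    by rewrite cabsM cabsV cabs_real ger0_norm ?divff ?gt_eqF// ltW.
  have zw : cabs (z - w) < d.
    have -> : z - w = z * ((1 - (cabs z)^-1)%:C%C).
      by rewrite rmorphB rmorph1 mulrBr mulr1 /= fmorphV.
    rewrite cabsM cabs_real -{1}(ger0_norm (ltW cz0)) -normrM mulrBr mulr1.
    rewrite divff ?gt_eqF// distrC ger0_norm ?subr_ge0//.
    by apply: le_lt_trans rd; rewrite lerD2l lerN2.
  have := dP _ _ z1 (_ : cabs w <= 1) zw; rewrite w1 lexx => /(_ isT) /ltW.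
  move=> /(le_trans (Re_cabs _)); rewrite ReD ReN ler_norml => /andP[_ h].
  by have := fM _ w1; clear -h; lra.
have z0r : cabs z0 < r.
  rewrite ltNge; apply/negP => rz; have := near z0; rewrite rz z01 => /(_ isT).
  by clear -Mz0 eta0; lra.
pose h := Num.min (d / 2) ((1 - r) / 4).
have h0 : 0 < h by rewrite lt_min !divr_gt0// subr_gt0.
have hd : h <= d / 2 by rewrite ge_min lexx.
have hn : h != 0 by rewrite gt_eqF.
have hr : h <= (1 - r) / 4 by rewrite ge_min lexx orbT.
clearbody h.
pose u z := hmean f h z / h.
have dr z s : cabs z <= r -> complex.Re z <= s <= complex.Re z + h ->
    cabs (Complex s (complex.Im z)) < 1.
  move=> zr hs; apply: le_lt_trans (cabs_triangle3 z _) _.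
  have := cabs_horizontal hs; clear -zr hr r1 => ?; lra.
have u_near z : cabs z <= r -> `|u z - complex.Re (f z)| <= eta.
  move=> zr; rewrite /u -[X in _ - X](mulfK hn) -mulrBl normrM.
  rewrite normfV (ger0_norm (ltW h0)) ler_pdivrMr//.
  apply: hmean_near; first exact: ltW.
    by move=> s hs; apply: Af.2; exact: dr.
  move=> s hs; rewrite -ReN -ReD; apply: le_trans (Re_cabs _) _.
  apply/ltW/dP; [exact/ltW/dr|exact/(le_trans zr)/ltW|].
  apply: le_lt_trans (cabs_horizontal hs) _; apply: le_lt_trans hd _.
  by rewrite ltr_pdivrMr// ltr_pMr// ltr1n.
pose v z := u z + eta * cabs z ^+ 2.
have vc : cont_on cdist1 rdist [set z | cabs z <= r] v.
  apply: cont_onD.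
    move=> z zr e e0; have eh0 : 0 < e * h by rewrite mulr_gt0.
    have rh : r + h < 1 by clear -hr r1; lra.
    have [a a0 aP] := hmean_cont Af h0 rh zr eh0; exists a => // w wr zw.
    have := aP w wr zw; rewrite /rdist /u -mulrBl normrM normfV (ger0_norm (ltW h0)).
    by rewrite ltr_pdivrMr.
  move=> z zr e e0; exists (e / (2 * eta)); first by rewrite divr_gt0// mulr_gt0.
  move=> w wr; rewrite /cdist1 /rdist ltr_pdivlMr; last exact: mulr_gt0.
  move=> zw.
  rewrite -mulrBr normrM (ger0_norm (ltW eta0)); apply: le_lt_trans zw.
  rewrite mulrA [leLHS]mulrC ler_pM2r// subr_sqr normrM.
  apply: ler_pM => //.
    rewrite ler_norml; have := cabs_triangle3 z w; have := cabs_triangle3 w z.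
    by rewrite (cabsBC w); clear; lra.
  rewrite ger0_norm ?addr_ge0 ?cabs_ge0//.
  by clear -zr wr r1; move: zr wr => /= ? ?; lra.
have [z1 z1r z1max] : exists2 z1, cabs z1 <= r & forall z, cabs z <= r -> v z <= v z1.
  apply: (cont_on_max cdist1_metrizes _ _ vc); last exact: cdist1_compact_disc.
  by exists 0; rewrite /= cabs0 ltW.
have {z1r} z1r : cabs z1 < r.
  rewrite lt_neqAle z1r andbT; apply/negP => /eqP z1E.
  have := z1max _ (ltW z0r); rewrite leNgt => /negP; apply.
  have := u_near _ (ltW z0r); rewrite ler_norml => /andP[h1 _].
  have := u_near _ z1r; rewrite ler_norml => /andP[_ h2].
  have := near z1; rewrite z1E lexx ltW// => /(_ isT) h3.
  have c0 : 0 <= eta * cabs z0 ^+ 2 by rewrite mulr_ge0 ?sqr_ge0// ltW.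
  have c1 : eta * r ^+ 2 <= eta by rewrite ger_pMr// expr_le1// ltW.
  by rewrite /v z1E; clear -h1 h2 h3 c0 c1 Mz0 eta0; lra.
pose rho := (1 - r) / 8.
have rho0 : 0 < rho by rewrite divr_gt0// subr_gt0.
have rect : diff_on_rect f (complex.Re z1 - rho) (complex.Im z1 - rho)
    (h + rho + rho) (rho + rho).
  move=> s t /andP[h1 h2] /andP[h3 h4]; apply: Af.2.
  apply: le_lt_trans (cabs_triangle3 z1 _) _.
  have : cabs (Complex s t - z1) <= (h + rho) + rho.
    apply: le_trans (cabs_le _) _; rewrite ReD ImD ReN ImN /=; apply: lerD.
      by rewrite ler_norml; clear -h1 h2 h0 rho0; apply/andP; split; lra.
    by rewrite ler_norml; clear -h3 h4; apply/andP; split; lra.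
  by rewrite /rho; clear -z1r hr r1; lra.
(* For this error [hmean_laplace] loses [2 * eta * h * k ^+ 2], less than the [4 * eta * h * k ^+ 2]
   gained from the quadratic term after multiplication by [h]. *)
have e0 : 0 < eta * h / 4 by rewrite divr_gt0// mulr_gt0.
have [r' r'0 lap] := hmean_laplace h0 rho0 e0 rect.
pose k := Num.min r' (r - cabs z1) / 2.
have k1 : 0 < Num.min r' (r - cabs z1) by rewrite lt_min r'0 subr_gt0.
have k0 : 0 < k by rewrite divr_gt0.
have kk : k < Num.min r' (r - cabs z1).
  by rewrite ltr_pdivrMr// ltr_pMr// ltr1n.
move: (kk); rewrite lt_min => /andP[kr' kz].
have inr w : cabs w = k -> cabs (z1 + w) <= r.
  by move=> wk; apply: le_trans (cabsD _ _) _; rewrite wk; clear -kz; lra.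
have ck : cabs k%:C%C = k by rewrite cabs_real gtr0_norm.
have ci : cabs (Complex 0 k) = k by rewrite cabs_imag gtr0_norm.
have := lap k; rewrite k0 kr' => /(_ isT); rewrite ler_norml => /andP[low _].
have m1 := z1max _ (inr _ ck).
have m2 := z1max (z1 - k%:C%C) (inr _ (etrans (cabsN _) ck)).
have m3 := z1max _ (inr _ ci).
have m4 := z1max (z1 - Complex 0 k) (inr _ (etrans (cabsN _) ci)).
move: m1 m2 m3 m4; rewrite /v !sqr_cabsE !(ReD, ImD, ReN, ImN) /= !(addr0, subr0).
rewrite /u => m1 m2 m3 m4.
have pos : 0 < eta * h * k ^+ 2 by rewrite !mulr_gt0// exprn_gt0.
have clr a b c : a / h + b <= c -> a + b * h <= c * h.
  by move=> abc; rewrite -(ler_pM2r (_ : 0 < h^-1)) ?invr_gt0// mulrDl !mulfK.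
move: m1 m2 m3 m4 => /clr m1 /clr m2 /clr m3 /clr m4.
rewrite mulrDl (mulfVK hn) in m1 m2 m3 m4.
by move: low pos m1 m2 m3 m4; clear -hn; set A := hmean _ _ _; lra.
Qed.

Theorem max_modulus_disc f (M : R) : disc_alg f ->
  (forall w, cabs w = 1 -> cabs (f w) <= M) ->
  forall z, cabs z <= 1 -> cabs (f z) <= M.
Proof.
move=> [fc fd] fM z z1; have [c [c1 <-]] := cabs_rotate (f z).
apply: (@max_Re_disc (fun w => c * f w)) => //.
- split.
    move=> x x1 e e0; have [a a0 aP] := fc _ x1 _ e0; exists a => // y y1 xy.
    by rewrite /cdist1 -mulrBr cabsM c1 mul1r; exact: aP.
  move=> x /fd[l fl]; exists (c * l) => e /fl[a a0 aP]; exists a => // y /aP.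
  by rewrite -mulrBr -mulrA -mulrBr cabsM c1 mul1r.
- move=> w /fM; apply: le_trans; apply: le_trans (ler_norm _) _.
  by apply: le_trans (Re_cabs _) _; rewrite cabsM c1 mul1r.
Qed.

End MaximumModulusDisc.

Section CderivDerivable.
Context {R : realType}.
Implicit Types (f g : R[i] -> R[i]) (z l : R[i]).

Lemma cderiv_unit f z l : cderiv f z l <->
  (fun h : R[i]^o => h^-1 *: ((f (h *: (1 : R[i]^o) + z) : R[i]^o) - f z))
    @ (0 : R[i]^o)^' --> (l : R[i]^o).
Proof.
have [_ _ _ nC] := @cdist1_metrizes R; split.
- move=> fl U /nC[e e0 eU]; have e20 : 0 < e / 2 by rewrite divr_gt0.
  have [r r0 rP] := fl _ e20; apply/nC; exists r => //.
  move=> v; rewrite /cdist1 sub0r cabsN => vr v0; apply: eU.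
  have cv : 0 < cabs v by exact: cabs_gt0.
  rewrite /cdist1 cabsBC /= -(ltr_pM2r cv) -cabsM mulrBl.
  rewrite /GRing.scale/= mulr1 mulrAC mulVf// mul1r [v + z]addrC.
  apply: le_lt_trans (rP _ vr) _; rewrite ltr_pM2r//.
  by rewrite ltr_pdivrMr// ltr_pMr// ltr1n.
- move=> fl e e0.
  have /fl /nC[r r0 rP] : nbhs (l : R[i]^o) [set w | cdist1 l w < e].
    by apply/nC; exists e.
  exists r => // v vr; have [->|v0] := eqVneq v 0.
    by rewrite addr0 subrr mulr0 subrr cabs0 mulr0.
  have := rP v; rewrite /cdist1 sub0r cabsN => /(_ vr v0) /=.
  have cv : 0 < cabs v by exact: cabs_gt0.
  rewrite cabsBC -(ltr_pM2r cv) -cabsM mulrBl.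
  by rewrite /GRing.scale/= mulr1 mulrAC mulVf// mul1r [v + z]addrC => /ltW.
Qed.

Lemma cderivP f z : (exists l, cderiv f z l) <->
  derivable (f : R[i]^o -> R[i]^o) (z : R[i]^o) 1.
Proof.
split; first by move=> [l /cderiv_unit fl]; apply/cvg_ex; exists l.
by move=> /cvg_ex[l fl]; exists l; apply/cderiv_unit.
Qed.

Definition cont_disc f := cont_on cdist1 cdist1 [set z : R[i] | cabs z <= 1] f.

Lemma cont_discP f : cont_disc f <->
  {within [set z : R[i]^o | cabs z <= 1], continuous (f : R[i]^o -> R[i]^o)}.
Proof.
exact: iff_sym (within_cont_on _ _ (@cdist1_metrizes R) (@cdist1_metrizes R)).
Qed.

Lemma disc_alg_cst c : disc_alg (fun=> c : R[i]).
Proof.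
split.
  by move=> z _ e e0; exists 1 => // w _ _; rewrite /cdist1 subrr cabs0.
by move=> z _; exists 0 => e e0; exists 1 => // v _; rewrite mul0r subrr subr0 cabs0 mulr_ge0 ?cabs_ge0// ltW.
Qed.

Lemma disc_algD f g : disc_alg f -> disc_alg g -> disc_alg (fun z => f z + g z).
Proof.
move=> [/cont_discP fc fd] [/cont_discP gc gd]; split.
  apply/cont_discP/subspace_continuousP => z z1.
  apply: cvgD; first by move/subspace_continuousP : fc; exact.
  by move/subspace_continuousP : gc; exact.
by move=> z z1; apply/cderivP/derivableD; apply/cderivP; [exact: fd|exact: gd].
Qed.

Lemma disc_algM f g : disc_alg f -> disc_alg g -> disc_alg (fun z => f z * g z).
Proof.
move=> [/cont_discP fc fd] [/cont_discP gc gd]; split.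
  apply/cont_discP/subspace_continuousP => z z1.
  apply: cvgM; first by move/subspace_continuousP : fc; exact.
  by move/subspace_continuousP : gc; exact.
by move=> z z1; apply/cderivP/derivableM; apply/cderivP; [exact: fd|exact: gd].
Qed.

Lemma disc_algB f g : disc_alg f -> disc_alg g -> disc_alg (fun z => f z - g z).
Proof.
move=> Af Ag; have := disc_algD Af (disc_algM (disc_alg_cst (-1)) Ag).
by congr disc_alg; apply/funext => z; rewrite mulN1r.
Qed.

End CderivDerivable.

Section Completeness.
Context {R : realType}.

Lemma real_complete (a : nat -> R) :
  (forall e : R, 0 < e -> exists N, forall i j, (N <= i)%N -> (N <= j)%N ->
    `|a i - a j| <= e) ->
  exists l, forall e : R, 0 < e -> exists N, forall i, (N <= i)%N -> `|a i - l| <= e.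
Proof.
move=> H; have /cauchy_cvgP ca : cauchy (a @ \oo).
  apply/cauchy_exP => e e0; have e20 : 0 < e / 2 by rewrite divr_gt0.
  have [N NP] := H _ e20; exists (a N); exists N => // i /= Ni.
  apply: le_lt_trans (NP _ _ (leqnn _) Ni) _.
  by rewrite ltr_pdivrMr// ltr_pMr// ltr1n.
exists (lim (a @ \oo)) => e e0.
have /cvgrPdist_le/(_ _ e0) [N _ NP] := ca.
by exists N => i Ni; rewrite distrC; exact: NP.
Qed.

Lemma complex_complete (a : nat -> R[i]) :
  (forall e : R, 0 < e -> exists N, forall i j, (N <= i)%N -> (N <= j)%N ->
    cabs (a i - a j) <= e) ->
  exists l, forall e : R, 0 < e -> exists N, forall i, (N <= i)%N -> cabs (a i - l) <= e.
Proof.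
move=> H.
have [x xP] : exists x, forall e : R, 0 < e -> exists N, forall i, (N <= i)%N ->
    `|complex.Re (a i) - x| <= e.
  apply: real_complete => e /H[N NP]; exists N => i j Ni Nj.
  by rewrite -ReN -ReD; apply: le_trans (Re_cabs _) (NP _ _ Ni Nj).
have [y yP] : exists x, forall e : R, 0 < e -> exists N, forall i, (N <= i)%N ->
    `|complex.Im (a i) - x| <= e.
  apply: real_complete => e /H[N NP]; exists N => i j Ni Nj.
  by rewrite -ImN -ImD; apply: le_trans (Im_cabs _) (NP _ _ Ni Nj).
exists (Complex x y) => e e0; have e20 : 0 < e / 2 by rewrite divr_gt0.
have [N NP] := xP _ e20; have [M MP] := yP _ e20.
exists (maxn N M) => i; rewrite geq_max => /andP[Ni Mi].
apply: le_trans (cabs_le _) _; rewrite [e]splitr ReD ImD ReN ImN /=.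
by apply: lerD; [exact: NP|exact: MP].
Qed.

End Completeness.

Section WeierstrassDisc.
Context {R : realType}.
Implicit Types (f g : R[i] -> R[i]) (z l : R[i]).

Lemma cvg_expn {T : Type} {F : set_system T} {FF : Filter F} (f : T -> R[i]^o)
  (l : R[i]^o) m : f @ F --> l -> (fun x => f x ^+ m : R[i]^o) @ F --> (l ^+ m : R[i]^o).
Proof.
move=> fl; elim: m => [|m IH]; first by rewrite expr0; exact: cvg_cst.
have -> : (fun x => f x ^+ m.+1 : R[i]^o) = (fun x => f x * f x ^+ m).
  by apply/funext => x; rewrite exprS.
by rewrite exprS; exact: (cvgM fl IH).
Qed.

Lemma derivable_expn (f : R[i]^o -> R[i]^o) (z : R[i]^o) m :
  derivable f z 1 -> derivable (fun w => f w ^+ m : R[i]^o) z 1.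
Proof.
move=> fl; elim: m => [|m IH].
  by under eq_fun do rewrite expr0; exact: derivable_cst.
have -> : (fun w => f w ^+ m.+1 : R[i]^o) = (fun w => f w * f w ^+ m).
  by apply/funext => x; rewrite exprS.
exact: (derivableM fl IH).
Qed.

(** That the quotient itself extends differentiably across [z0] would be a removable singularity
    theorem. The factor [z - z0] avoids it: the product vanishes at [z0], whatever value division by
    0 has, and its derivative there is merely the limit of the [m]-th power of the quotient. *)
Lemma disc_alg_quot_pow g z0 (m : nat) : cabs z0 < 1 -> disc_alg g ->
  disc_alg (fun z => (z - z0) * ((g z - g z0) / (z - z0)) ^+ m).
Proof.
move=> z01 [gc gd].
have dF z : cabs z < 1 ->
    exists l, cderiv (fun z => (z - z0) * ((g z - g z0) / (z - z0)) ^+ m) z l.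
  move=> z1; have [->|zz0] := eqVneq z z0.
    have [l /cderiv_unit gl] := gd _ z01; exists (l ^+ m); apply/cderiv_unit.
    have : (fun h : R[i]^o => (h^-1 *: ((g (h *: (1 : R[i]^o) + z0) : R[i]^o) - g z0)) ^+ m : R[i]^o)
        @ (0 : R[i]^o)^' --> (l ^+ m : R[i]^o).
      exact: cvg_expn.
    apply: cvg_trans; apply: near_eq_cvg; near=> h.
    have h0 : h != 0 by near: h; exact: nbhs_dnbhs_neq.
    rewrite subrr mul0r subr0 addrK /GRing.scale/= mulr1 mulrA mulVf// mul1r.
    by rewrite [h^-1 * _]mulrC.
  have r0 : 0 < cabs (z - z0) by rewrite cabs_gt0// subr_eq0.
  apply/cderivP; apply: derivableM; first by apply: derivableB.
  apply: derivable_expn; apply: derivableM.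
    by apply: derivableB => //; apply/cderivP/gd.
  by apply: derivableV; rewrite ?subr_eq0//; apply: derivableB.
split=> // z z1.
have [->|zz0] := eqVneq z z0.
  move=> e e0; have [l /cderiv_cont/(_ _ e0)[r r0 rP]] := dF _ z01.
  exists r => // w _; rewrite /cdist1 cabsBC => /rP.
  by rewrite [z0 + _]addrC subrK cabsBC.
move/cont_discP : gc => /subspace_continuousP/(_ _ z1) gc.
suff Fc : (fun z => (z - z0) * ((g z - g z0) / (z - z0)) ^+ m) @
    within [set z : R[i]^o | cabs z <= 1] (nbhs (z : R[i]^o)) -->
    ((z - z0) * ((g z - g z0) / (z - z0)) ^+ m : R[i]^o).
  have [_ _ _ nC] := @cdist1_metrizes R.
  move=> e e0; have /Fc : nbhs ((z - z0) * ((g z - g z0) / (z - z0)) ^+ m : R[i]^o)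
    [set w | cdist1 ((z - z0) * ((g z - g z0) / (z - z0)) ^+ m) w < e].
    by apply/nC; exists e.
  by move=> /nC[r r0 rP]; exists r => // w w1 zw; exact: rP.
have idc : (fun w : R[i]^o => w - z0) @
    within [set z : R[i]^o | cabs z <= 1] (nbhs (z : R[i]^o)) --> (z - z0 : R[i]^o).
  by apply: cvg_within_filter; apply: cvgB; [exact: cvg_id|exact: cvg_cst].
have zz : z - z0 != 0 by rewrite subr_eq0.
have qc : (fun w : R[i]^o => (g w - g z0) / (w - z0) : R[i]^o) @
    within [set z : R[i]^o | cabs z <= 1] (nbhs (z : R[i]^o)) -->
    ((g z - g z0) / (z - z0) : R[i]^o).
  exact: (cvgM (cvgB gc (cvg_cst (g z0 : R[i]^o))) (cvgV zz idc)).
exact: (cvgM idc (cvg_expn (m := m) qc)).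
Unshelve. all: by end_near. Qed.

Lemma bernoulli_ineq (t : R) m : 0 <= t -> 1 + m%:R * t <= (1 + t) ^+ m.
Proof.
move=> t0; elim: m => [|m IH]; first by rewrite mul0r addr0 expr0.
rewrite exprS -natr1; apply: (@le_trans _ _ ((1 + t) * (1 + m%:R * t))).
  have : 0 <= m%:R * t * t by rewrite !mulr_ge0.
  by lra.
by rewrite ler_pM2l// ltr_wpDr.
Qed.

(** The maximum principle for [z - z0] times the [m]-th power of the quotient [q] bounds
    [cabs (z - z0) * cabs q ^+ m] by twice the [m]-th power of a bound for [q] on the unit circle.
    As [m] grows the extra factor ceases to matter. On the circle the denominator of [q] is at least
    [1 - cabs z0]. *)
Lemma disc_alg_quot_bound g z0 (M : R) : disc_alg g -> cabs z0 < 1 ->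
  (forall w, cabs w = 1 -> cabs (g w) <= M) ->
  forall z, cabs z <= 1 ->
  cabs (g z - g z0) <= 2 * M / (1 - cabs z0) * cabs (z - z0).
Proof.
move=> Ag z01 gM z z1; have [->|zz0] := eqVneq z z0.
  by rewrite !subrr cabs0 mulr0.
have M0 : 0 <= M by apply: le_trans (gM 1 cabs1); exact: cabs_ge0.
have d0 : 0 < 1 - cabs z0 by rewrite subr_gt0.
have r0 : 0 < cabs (z - z0) by rewrite cabs_gt0// subr_eq0.
set B := 2 * M / _; have B0 : 0 <= B by rewrite divr_ge0 ?mulr_ge0// ltW.
rewrite -ler_pdivrMr// -cabsV -cabsM leNgt; apply/negP.
set q := (g z - g z0) / (z - z0) => Bq.
(* [B] may be 0, and the comparison of powers divides by the bound; hence a number strictly between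
   [B] and [cabs q]. *)
pose B1 := (cabs q + B) / 2.
have B10 : 0 < B1 by rewrite /B1; clear -Bq B0; lra.
have BB1 : B <= B1 by rewrite /B1; clear -Bq B0; lra.
have B1q : B1 < cabs q by rewrite /B1; clear -Bq B0; lra.
have pow m : cabs (z - z0) * cabs q ^+ m <= 2 * B1 ^+ m.
  rewrite -cabsX -cabsM.
  apply: (max_modulus_disc (disc_alg_quot_pow m z01 Ag)) => // w w1.
  rewrite cabsM cabsX; apply: ler_pM; rewrite ?cabs_ge0 ?exprn_ge0 ?cabs_ge0//.
    by apply: le_trans (cabsB _ _) _; rewrite w1; clear -z01; lra.
  apply: lerXn2r; rewrite ?nnegrE ?cabs_ge0 ?(ltW B10)//.
  apply: le_trans BB1; rewrite cabsM cabsV /B.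
  apply: ler_pM; rewrite ?invr_ge0 ?cabs_ge0//.
    apply: le_trans (cabsB _ _) _; rewrite mulr_natl mulr2n.
    by apply: lerD; [exact: gM|exact: (max_modulus_disc Ag gM (ltW z01))].
  rewrite lef_pV2 ?posrE//.
    by have := cabs_triangle3 z0 w; rewrite w1; clear; lra.
  rewrite cabs_gt0// subr_eq0; apply/negP => /eqP wz0.
  by move: z01; rewrite -wz0 w1 ltxx.
pose t := cabs q / B1 - 1.
have t0 : 0 < t by rewrite subr_gt0 ltr_pdivlMr// mul1r.
pose m := (Num.truncn (2 / (cabs (z - z0) * t))).+1.
have : 2 < cabs (z - z0) * (1 + t) ^+ m.
  have : 2 / (cabs (z - z0) * t) < m%:R by exact: truncnS_gt.
  rewrite ltr_pdivrMr ?mulr_gt0// => /lt_le_trans; apply.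
  rewrite mulrCA ler_pM2l//; apply: le_trans (bernoulli_ineq _ (ltW t0)).
  by rewrite lerDr.
rewrite [1 + t]addrC subrK expr_div_n mulrA ltr_pdivlMr ?exprn_gt0//.
by rewrite ltNge pow.
Qed.

Lemma cderiv_bound g z0 l (B r : R) : 0 < r -> cderiv g z0 l ->
  (forall v, cabs v < r -> cabs (g (z0 + v) - g z0) <= B * cabs v) -> cabs l <= B.
Proof.
move=> r0 gl gB; apply/ler_addgt0Pr => e e0.
have [a a0 aP] := gl _ e0.
pose k := Num.min a r / 2.
have m0 : 0 < Num.min a r by rewrite lt_min a0.
have k0 : 0 < k by rewrite divr_gt0.
have : k < Num.min a r by rewrite ltr_pdivrMr// ltr_pMr// ltr1n.
rewrite lt_min => /andP[ka kr].
have ck : cabs k%:C%C = k by rewrite cabs_real gtr0_norm.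
have := aP k%:C%C; have := gB k%:C%C; rewrite ck => /(_ kr) h1 /(_ ka) h2.
rewrite -(ler_pM2r k0) mulrDl -{1}ck -cabsM.
rewrite -(subKr (g (z0 + k%:C%C) - g z0) (l * _)).
by apply: le_trans (cabsB _ _) _; apply: lerD.
Qed.

(** Weierstrass' theorem. Applied to [F i - F j], the bound on difference quotients makes those of
    the sequence at [z0] Cauchy uniformly in [z], which allows the limit in the index and the
    derivative to be interchanged. *)
Theorem disc_alg_lim (F : nat -> R[i] -> R[i]) f :
  (forall k, disc_alg (F k)) ->
  (forall e : R, 0 < e -> exists N, forall k, (N <= k)%N ->
     forall z, cabs z <= 1 -> cabs (F k z - f z) <= e) ->
  disc_alg f.
Proof.
move=> AF Ff; split.
  move=> z z1 e e0; have e30 : 0 < e / 3 by rewrite divr_gt0.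
  have [N NP] := Ff _ e30; have [d d0 dP] := (AF N).1 _ z1 _ e30.
  exists d => // w w1 zw.
  have h1 := NP N (leqnn _) z z1; have h2 := NP N (leqnn _) w w1.
  have h3 := dP _ w1 zw.
  have -> : cdist1 (f z) (f w) = cabs (- (F N z - f z) + (F N z - F N w) + (F N w - f w)).
    by congr cabs; ring.
  apply: le_lt_trans (cabsD _ _) _; apply: le_lt_trans (lerD (cabsD _ _) (lexx _)) _.
  by rewrite cabsN; move: h1 h2 h3; rewrite /cdist1; clear; lra.
move=> z0 z01; have d0 : 0 < 1 - cabs z0 by rewrite subr_gt0.
have /choice[l lP] : forall k, exists l, cderiv (F k) z0 l by move=> k; exact: (AF k).2.
have quot e : 0 < e -> exists N, forall i j, (N <= i)%N -> (N <= j)%N ->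
    forall z, cabs z <= 1 ->
    cabs (F i z - F j z - (F i z0 - F j z0)) <= e * cabs (z - z0).
  move=> e0; have e40 : 0 < e * (1 - cabs z0) / 4 by rewrite divr_gt0// mulr_gt0.
  have [N NP] := Ff _ e40; exists N => i j Ni Nj z z1.
  have -> : e = 2 * (e * (1 - cabs z0) / 2) / (1 - cabs z0).
    by field; rewrite gt_eqF.
  apply: (disc_alg_quot_bound (disc_algB (AF i) (AF j))) => // w w1.
  have -> : F i w - F j w = (F i w - f w) - (F j w - f w) by ring.
  apply: le_trans (cabsB _ _) _.
  have w1' : cabs w <= 1 by rewrite w1.
  have := NP _ Ni _ w1'; have := NP _ Nj _ w1'; clear; lra.
have [L LP] : exists L, forall e : R, 0 < e -> exists N, forall i, (N <= i)%N -> cabs (l i - L) <= e.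
  apply: complex_complete => e e0; have [N NP] := quot _ e0.
  exists N => i j Ni Nj; apply: (cderiv_bound (g := fun z => F i z - F j z) d0).
    move=> e' e'0; have e'20 : 0 < e' / 2 by rewrite divr_gt0.
    have [a a0 aP] := lP i _ e'20; have [b b0 bP] := lP j _ e'20.
    exists (Num.min a b); first by rewrite lt_min a0.
    move=> v /=; rewrite lt_min => /andP[va vb].
    rewrite [X in cabs X](_ : _ =
      (F i (z0 + v) - F i z0 - l i * v) - (F j (z0 + v) - F j z0 - l j * v)); last by ring.
    apply: le_trans (cabsB _ _) _; rewrite [e']splitr mulrDl.
    by apply: lerD; [exact: aP|exact: bP].
  move=> v /= vd; have := NP _ _ Ni Nj (z0 + v); rewrite [z0 + v - _]addrC addKr; apply.
  by apply: le_trans (cabsD _ _) _; clear -vd; lra.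
exists L => e e0; have e30 : 0 < e / 3 by rewrite divr_gt0.
have [N1 N1P] := quot _ e30; have [N2 N2P] := LP _ e30.
pose N := maxn N1 N2.
have [a a0 aP] := lP N _ e30.
exists (Num.min a (1 - cabs z0)); first by rewrite lt_min a0.
move=> v; rewrite lt_min => /andP[va vd].
have v1 : cabs (z0 + v) <= 1 by apply: le_trans (cabsD _ _) _; clear -vd; lra.
(* The estimate [quot] passes to the limit in its first index; the slack [e'] pays for replacing
   [F j] by [f] at the two points. *)
have lim : cabs ((f (z0 + v) - F N (z0 + v)) - (f z0 - F N z0)) <= e / 3 * cabs v.
  apply/ler_addgt0Pr => e' e'0; have e'20 : 0 < e' / 2 by rewrite divr_gt0.
  have [N3 N3P] := Ff _ e'20; pose j := maxn N1 N3.
  have -> : f (z0 + v) - F N (z0 + v) - (f z0 - F N z0) =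
    (F j (z0 + v) - F N (z0 + v) - (F j z0 - F N z0))
     - (F j (z0 + v) - f (z0 + v)) + (F j z0 - f z0) by ring.
  apply: le_trans (cabsD _ _) _; apply: le_trans (lerD (cabsB _ _) (lexx _)) _.
  rewrite [e']splitr addrA; apply: lerD; last first.
    by apply: N3P; [rewrite leq_max leqnn orbT|exact: ltW].
  apply: lerD; last by apply: N3P => //; rewrite leq_max leqnn orbT.
  have := N1P j N _ _ (z0 + v) v1; rewrite [z0 + v - _]addrC addKr; apply.
    by rewrite leq_max leqnn.
  by rewrite leq_max leqnn.
have -> : f (z0 + v) - f z0 - L * v =
   ((f (z0 + v) - F N (z0 + v)) - (f z0 - F N z0)) + (F N (z0 + v) - F N z0 - l N * v)
   + (l N - L) * v by ring.
apply: le_trans (cabsD _ _) _; apply: le_trans (lerD (cabsD _ _) (lexx _)) _.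
have -> : e * cabs v = e / 3 * cabs v + e / 3 * cabs v + e / 3 * cabs v by field.
apply: lerD; first by apply: lerD => //; exact: aP.
rewrite cabsM; apply: ler_wpM2r; first exact: cabs_ge0.
by apply: N2P; rewrite leq_max leqnn orbT.
Qed.

End WeierstrassDisc.

(** * The polydisc algebra *)

Section PolydiscAlgebra.
Context {R : realType} {n : nat}.
Notation Cn := 'rV[R[i]^o]_n.
Local Notation torus := (@Defs.torus R n).
Local Notation cpolydisc := (@Defs.cpolydisc R n).
Local Notation opolydisc := (@Defs.opolydisc R n).
Implicit Types (g h : Cn -> R[i]) (z : Cn).

Lemma cabs_eq1 (x : R[i]) : (`|x| = 1) <-> cabs x = 1.
Proof.
split; first by rewrite cabsE => /(congr1 (@complex.Re R)).
by move=> x1; rewrite cabsE x1.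
Qed.

Lemma torusP z : torus z <-> forall j, cabs (z ord0 j) = 1.
Proof. by split => H j; apply/cabs_eq1. Qed.

Lemma cpolydiscP z : cpolydisc z <-> forall j, cabs (z ord0 j) <= 1.
Proof. by split => H j; have := H j; rewrite cabsE lecR. Qed.

Lemma opolydiscP z : opolydisc z <-> forall j, cabs (z ord0 j) < 1.
Proof. by split => H j; have := H j; rewrite cabsE ltcR. Qed.

Lemma torus_cpolydisc z : torus z -> cpolydisc z.
Proof. by move=> /torusP H; apply/cpolydiscP => j; rewrite H. Qed.

Lemma opolydisc_cpolydisc z : opolydisc z -> cpolydisc z.
Proof. by move=> /opolydiscP H; apply/cpolydiscP => j; exact: ltW. Qed.

Lemma cpolydisc_compact : compact cpolydisc.
Proof.
rewrite (_ : cpolydisc = [set v : Cn | forall i, [set x : R[i]^o | cabs x <= 1] (v ord0 i)]).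
  apply: (@rV_compact (R[i]^o) n (fun=> [set x : R[i]^o | cabs x <= 1])) => i.
  exact: cdist1_compact_disc.
by apply/seteqP; split => z /cpolydiscP.
Qed.

Lemma torus_compact : compact torus.
Proof.
rewrite (_ : torus = [set v : Cn | forall i, [set x : R[i]^o | cabs x = 1] (v ord0 i)]); last first.
  by apply/seteqP; split => z /torusP.
apply: (@rV_compact (R[i]^o) n (fun=> [set x : R[i]^o | cabs x = 1])) => i.
apply: (subclosed_compact _ (@cdist1_compact_disc R 1)); last first.
  by move=> x /= ->.
rewrite -(@setCK _ [set z | _]); apply: open_closedC.
have [_ _ _ nC] := @cdist1_metrizes R.
rewrite openE => z /= /eqP z1; apply/nC; exists `|cabs z - 1|.
  by rewrite normr_gt0 subr_eq0.
move=> w zw /= w1; move: zw; rewrite -w1 ltNge => /negP; apply.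
rewrite ler_norml; have := cabs_triangle3 z w; have := cabs_triangle3 w z.
by rewrite /cdist1 (cabsBC w); clear; lra.
Qed.

Lemma updE z j w k : upd z j w ord0 k = if k == j then w else z ord0 k.
Proof. by rewrite mxE. Qed.

Lemma upd_upd z j w w' : upd (upd z j w) j w' = upd z j w'.
Proof. by apply/rowP => k; rewrite !mxE; case: eqP. Qed.

Lemma upd_id z j : upd z j (z ord0 j) = z.
Proof. by apply/rowP => k; rewrite !mxE; case: eqP => // ->. Qed.

Lemma cdist_upd z j w w' : cdist (upd z j w) (upd z j w') = cabs (w - w').
Proof.
rewrite /cdist (bigD1 j)//= !updE eqxx big1 ?addr0// => k kj.
by rewrite !updE (negbTE kj) subrr cabs0.
Qed.

Lemma inAP g : inA g <->
  cont_on cdist cdist1 cpolydisc g /\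
  forall z, opolydisc z -> forall j, exists l,
    cderiv (fun w => g (upd z j w)) (z ord0 j) l.
Proof.
have H := within_cont_on cpolydisc (g : Cn -> R[i]^o) (@cdist_metrizes R n) (@cdist1_metrizes R).
split=> [[gc gd]|[gc gd]]; split; try exact/H.
  by move=> z oz j; apply/cderivP; exact: gd.
by move=> z oz j; apply/cderivP; exact: gd.
Qed.

Lemma inA_unif g : inA g -> forall e : R, 0 < e -> exists2 r : R, 0 < r &
  forall z w, cpolydisc z -> cpolydisc w -> cdist z w < r -> cabs (g z - g w) < e.
Proof.
move=> /inAP[gc _]; apply: (cont_on_unif (@cdist_metrizes R n) cdist1_sym cdist1_triangle _ gc).
exact: cpolydisc_compact.
Qed.

Lemma slice_open g z j : inA g -> opolydisc z -> disc_alg (fun w => g (upd z j w)).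
Proof.
move=> /inAP[gc gd] /opolydiscP oz.
have up (w : R[i]) : cabs w <= 1 -> cpolydisc (upd z j w).
  by move=> w1; apply/cpolydiscP => k; rewrite updE; case: eqP => // _; exact: ltW.
split.
  move=> w w1 e e0; have [r r0 rP] := gc _ (up _ w1) _ e0; exists r => // w' w'1 ww'.
  by apply: rP; [exact: up|rewrite cdist_upd].
move=> w w1.
have ow : opolydisc (upd z j w).
  by apply/opolydiscP => k; rewrite updE; case: eqP.
have [l] := gd _ ow j; rewrite updE eqxx => gl; exists l.
by congr cderiv: gl; apply/funext => w'; rewrite upd_upd.
Qed.

(** Holomorphy is given at points of the open polydisc only. A slice through a boundary point is a
    uniform limit of slices through the points [r k * z], to which Weierstrass' theorem applies. *)
Lemma slice_disc_alg g z j : inA g -> cpolydisc z ->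
  disc_alg (fun w => g (upd z j w)).
Proof.
move=> Ag /cpolydiscP cz.
pose r k : R := 1 - k.+2%:R^-1.
have r1 k : r k < 1 by rewrite ltrBlDr ltrDl invr_gt0.
have r0 k : 0 <= r k by rewrite subr_ge0 invf_le1// ler1n.
pose y k : Cn := \row_i ((r k)%:C%C * z ord0 i).
have oy k : opolydisc (y k).
  apply/opolydiscP => i; rewrite mxE cabsM cabs_real ger0_norm//.
  apply: le_lt_trans (r1 k); rewrite -[leRHS]mulr1.
  by apply: ler_wpM2l.
apply: (@disc_alg_lim _ (fun k w => g (upd (y k) j w))).
  by move=> k; exact: slice_open.
move=> e e0; have [d d0 dP] := inA_unif Ag e0.
exists (Num.truncn (n%:R / d)) => k kN w w1; apply/ltW/dP.
- by apply/cpolydiscP => i; rewrite updE; case: eqP => // _; apply/ltW; move/opolydiscP : (oy k).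
- by apply/cpolydiscP => i; rewrite updE; case: eqP.
apply: (@le_lt_trans _ _ (\sum_(i < n) (k.+2%:R^-1))).
  apply: ler_sum => i _; rewrite !updE; case: eqP => _.
    by rewrite subrr cabs0 invr_ge0.
  rewrite mxE -{2}[z ord0 i]mul1r -mulrBl cabsM.
  have -> : (r k)%:C%C - 1 = (- k.+2%:R^-1)%:C%C :> R[i].
    by rewrite /r rmorphB rmorph1 addrAC subrr add0r rmorphN.
  by rewrite cabs_real normrN ger0_norm ?invr_ge0// ler_piMr ?invr_ge0.
rewrite sumr_const card_ord -[_ *+ _]mulr_natl ltr_pdivrMr// mulrC -ltr_pdivrMr//.
apply: lt_trans (truncnS_gt _) _; rewrite ltr_nat.
by rewrite ltnS ltnS (leq_trans kN).
Qed.

(** One variable at a time: the induction on [k] allows the first [k] coordinates inside the disc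
    while the others stay unimodular, and [k = 0] is the torus. *)
Lemma max_modulus_polydisc g (M : R) : inA g ->
  (forall z, torus z -> cabs (g z) <= M) ->
  forall z, cpolydisc z -> cabs (g z) <= M.
Proof.
move=> Ag gM.
suff H k : forall z, cpolydisc z -> (forall j : 'I_n, (k <= j)%N -> cabs (z ord0 j) = 1) ->
    cabs (g z) <= M.
  by move=> z cz; apply: (H n) => // j; rewrite leqNgt ltn_ord.
elim: k => [|k IH] z cz zk.
  by apply: gM; apply/torusP => j; exact: zk.
have [kn|nk] := ltnP k n; last first.
  by apply: IH => // j kj; have := ltn_ord j; rewrite ltnNge (leq_trans nk).
pose j := Ordinal kn; rewrite -(upd_id z j).
apply: (max_modulus_disc (slice_disc_alg j Ag cz)); last by move/cpolydiscP : cz.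
move=> w w1; apply: IH.
  by apply/cpolydiscP => i; rewrite updE; case: eqP => [_|_]; [rewrite w1|move/cpolydiscP : cz].
move=> i ki; rewrite updE; case: eqP => // ij; apply: zk.
rewrite ltn_neqAle ki andbT; apply: contra_notN ij => /eqP kE.
by apply/val_inj.
Qed.

Lemma inA_lim (F : nat -> Cn -> R[i]) g : (forall k, inA (F k)) ->
  (forall e : R, 0 < e -> exists N, forall k, (N <= k)%N ->
     forall z, cpolydisc z -> cabs (F k z - g z) <= e) ->
  inA g.
Proof.
move=> AF Fg; apply/inAP; split.
  move=> z cz e e0; have e30 : 0 < e / 3 by rewrite divr_gt0.
  have [N NP] := Fg _ e30; have /inAP[FN _] := AF N; have [d d0 dP] := FN _ cz _ e30.
  exists d => // w cw zw.
  have h1 := NP N (leqnn _) z cz; have h2 := NP N (leqnn _) w cw.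
  have h3 := dP _ cw zw.
  rewrite /cdist1 [X in cabs X](_ : _ =
    - (F N z - g z) + (F N z - F N w) + (F N w - g w)); last by ring.
  apply: le_lt_trans (cabsD _ _) _; apply: le_lt_trans (lerD (cabsD _ _) (lexx _)) _.
  by rewrite cabsN; move: h1 h2 h3; rewrite /cdist1; clear; lra.
move=> z oz j; have cz := opolydisc_cpolydisc oz.
suff : disc_alg (fun w => g (upd z j w)).
  by move=> [_]; apply; move/opolydiscP : oz; exact.
apply: (@disc_alg_lim _ (fun k w => F k (upd z j w))).
  by move=> k; exact: slice_disc_alg.
move=> e /Fg[N NP]; exists N => k Nk w w1; apply: NP => //.
by apply/cpolydiscP => i; rewrite updE; case: eqP => // _; move/cpolydiscP : cz.
Qed.

Lemma inA_cst (c : R[i]) : inA ((fun=> c) : Cn -> R[i]).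
Proof.
apply/inAP; split; first by move=> z _ e e0; exists 1 => // w _ _; rewrite /cdist1 subrr cabs0.
move=> z _ j; exists 0 => e e0; exists 1 => // v _.
by rewrite mul0r subrr subr0 cabs0 mulr_ge0 ?cabs_ge0// ltW.
Qed.

Lemma inAD g h : inA g -> inA h -> inA (fun z => g z + h z).
Proof.
move=> [gc gd] [hc hd]; split.
  apply/subspace_continuousP => z z1.
  apply: cvgD; first by move/subspace_continuousP : gc; exact.
  by move/subspace_continuousP : hc; exact.
move=> z oz j; exact: (derivableD (gd _ oz j) (hd _ oz j)).
Qed.

Lemma inAM g h : inA g -> inA h -> inA (fun z => g z * h z).
Proof.
move=> [gc gd] [hc hd]; split.
  apply/subspace_continuousP => z z1.
  move/subspace_continuousP : gc => gc; move/subspace_continuousP : hc => hc.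
  exact: (cvgM (gc z z1) (hc z z1)).
move=> z oz j; exact: (derivableM (gd _ oz j) (hd _ oz j)).
Qed.

Lemma inA_coord j : inA ((fun z => z ord0 j) : Cn -> R[i]).
Proof.
apply/inAP; split.
  move=> z _ e e0; exists e => // w _; apply: le_lt_trans.
  exact: cdist_coord.
move=> z _ k; exists (j == k)%:R => e e0; exists 1 => // v _.
rewrite !updE; case: eqP => _.
  by rewrite [X in cabs X](_ : _ = 0) ?cabs0 ?mulr_ge0 ?cabs_ge0 ?ltW//= mul1r; ring.
by rewrite mul0r subrr subr0 cabs0 mulr_ge0 ?cabs_ge0// ltW.
Qed.

Lemma inA_ext g h : (forall z, g z = h z) -> inA g -> inA h.
Proof. by move=> gh; rewrite (_ : g = h)//; apply/funext. Qed.

Lemma inA_prod (I : Type) (s : seq I) (F : I -> Cn -> R[i]) :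
  (forall i, inA (F i)) -> inA (fun z => \prod_(i <- s) F i z).
Proof.
move=> AF; elim: s => [|a s IH].
  by apply: inA_ext (inA_cst 1) => z; rewrite big_nil.
by apply: inA_ext (inAM (AF a) IH) => z; rewrite big_cons.
Qed.

Lemma inAX g m : inA g -> inA (fun z => g z ^+ m).
Proof.
move=> Ag; elim: m => [|m IH]; first by apply: inA_ext (inA_cst 1) => z.
by apply: inA_ext (inAM Ag IH) => z; rewrite exprS.
Qed.

Lemma inA_bounded g : inA g -> exists2 M : R, 0 <= M &
  forall z, cpolydisc z -> cabs (g z) <= M.
Proof.
move=> /inAP[gc _].
have gC : cont_on cdist rdist cpolydisc (fun z => cabs (g z)).
  move=> z cz e e0; have [d d0 dP] := gc _ cz _ e0; exists d => // w cw zw.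
  apply: le_lt_trans (dP _ cw zw); rewrite ler_norml.
  have := cabs_triangle3 (g z) (g w); have := cabs_triangle3 (g w) (g z).
  by rewrite /cdist1 (cabsBC (g w)); clear; lra.
have D0 : cpolydisc !=set0.
  by exists 0; apply/cpolydiscP => j; rewrite mxE cabs0.
have [c cc cP] := cont_on_max (@cdist_metrizes R n) D0 cpolydisc_compact gC.
by exists (cabs (g c)) => //; exact: cabs_ge0.
Qed.

End PolydiscAlgebra.

(** * Integration of bounded functions against complex measures *)

Section BoundedIntegrals.
Context {R : realType} {d : measure_display} {T : measurableType d}.
Variables (D : set T) (mD : measurable D).
Implicit Types (phi psi : T -> R) (mu : {finite_measure set T -> \bar R}).

(** A class closed under sums and products whose members are integrable for every finite measure, so
    that the four parts of a complex measure are treated alike. *)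
Definition bmeas phi := measurable_fun D phi /\
  exists M : R, forall x, D x -> `|phi x| <= M.

Lemma bmeas_cst c : bmeas (fun=> c).
Proof. by split; [exact: measurable_cst|exists `|c|]. Qed.

Lemma bmeasD phi psi : bmeas phi -> bmeas psi -> bmeas (fun x => phi x + psi x).
Proof.
move=> [mphi [M MP]] [mpsi [N NP]]; split; first exact: measurable_funD.
exists (M + N) => x Dx; apply: le_trans (ler_normD _ _) _.
by apply: lerD; [exact: MP|exact: NP].
Qed.

Lemma bmeasM phi psi : bmeas phi -> bmeas psi -> bmeas (fun x => phi x * psi x).
Proof.
move=> [mphi [M MP]] [mpsi [N NP]]; split; first exact: measurable_funM.
exists (M * N) => x Dx; rewrite normrM.
by apply: ler_pM => //; [exact: MP|exact: NP].
Qed.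

Lemma bmeasN phi : bmeas phi -> bmeas (fun x => - phi x).
Proof.
move=> bphi; have := bmeasM (bmeas_cst (-1)) bphi.
by congr bmeas; apply/funext => x; rewrite mulN1r.
Qed.

Lemma bmeasB phi psi : bmeas phi -> bmeas psi -> bmeas (fun x => phi x - psi x).
Proof. by move=> bphi /bmeasN; exact: bmeasD. Qed.

Lemma bmeas_indic (E : set T) : measurable E -> bmeas (\1_E : T -> R).
Proof.
move=> mE; split; first exact: measurable_indic.
by exists 1 => x _; rewrite indicE; case: (_ \in _); rewrite ?normr1 ?normr0.
Qed.

Lemma finite_measure_ltoo mu E : measurable E -> (mu E < +oo)%E.
Proof.
move=> mE; apply: le_lt_trans (fin_num_fun_lty (fin_num_measure mu)).
by apply: le_measure; rewrite ?inE.
Qed.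

Lemma bmeas_integrable mu phi : bmeas phi -> mu.-integrable D (EFin \o phi).
Proof.
move=> [mphi [M MP]]; apply: measurable_bounded_integrable => //.
  exact: finite_measure_ltoo.
exists M; split; first exact: num_real.
by move=> r Mr x Dx /=; exact/(le_trans (MP _ Dx))/ltW.
Qed.

Lemma bintD mu phi psi : bmeas phi -> bmeas psi ->
  \int[mu]_(x in D) (phi x + psi x) = \int[mu]_(x in D) phi x + \int[mu]_(x in D) psi x.
Proof. by move=> ? ?; rewrite RintegralD//; exact: bmeas_integrable. Qed.

Lemma bintZ mu phi c : bmeas phi ->
  \int[mu]_(x in D) (c * phi x) = c * \int[mu]_(x in D) phi x.
Proof. by move=> ?; rewrite RintegralZl//; exact: bmeas_integrable. Qed.

Lemma bintB mu phi psi : bmeas phi -> bmeas psi ->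
  \int[mu]_(x in D) (phi x - psi x) = \int[mu]_(x in D) phi x - \int[mu]_(x in D) psi x.
Proof. by move=> ? ?; rewrite RintegralB//; exact: bmeas_integrable. Qed.

Lemma bint_le mu phi psi : bmeas phi -> bmeas psi ->
  (forall x, D x -> phi x <= psi x) ->
  \int[mu]_(x in D) phi x <= \int[mu]_(x in D) psi x.
Proof. by move=> ? ? ?; apply: le_Rintegral => //; exact: bmeas_integrable. Qed.

Lemma bint_norm_le mu phi psi : bmeas phi -> bmeas psi ->
  (forall x, D x -> `|phi x| <= psi x) ->
  `|\int[mu]_(x in D) phi x| <= \int[mu]_(x in D) psi x.
Proof.
move=> bphi bpsi H; rewrite ler_norml; apply/andP; split.
  rewrite -mulN1r -bintZ//; apply: bint_le => //.
    exact: bmeasM (bmeas_cst _) bpsi.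
  by move=> x /H; rewrite ler_norml mulN1r => /andP[].
by apply: bint_le => // x /H; rewrite ler_norml => /andP[].
Qed.

Lemma bint_dct mu (F : nat -> T -> R) phi (M : R) :
  (forall m, measurable_fun D (F m)) -> bmeas phi ->
  (forall m x, D x -> `|F m x| <= M) ->
  (forall x, D x -> (F^~ x) @ \oo --> phi x) ->
  (\int[mu]_(x in D) F m x)%R @[m --> \oo] --> \int[mu]_(x in D) phi x.
Proof.
move=> mF bphi FM Fphi.
have iM := bmeas_integrable mu (bmeas_cst M).
apply: fine_cvg; rewrite fineK; last first.
  exact: integrable_fin_num (bmeas_integrable mu bphi).
apply: (dominated_cvg mD _ _ _ iM) => //.
- by move=> m; apply/measurable_EFinP/mF.
- by move=> x Dx; apply: cvg_EFin; [exact: nearW|exact: Fphi].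
Qed.

End BoundedIntegrals.

Section ComplexIntegral.
Context {R : realType} {n : nat}.
Notation Cn := 'rV[R[i]^o]_n.
Local Notation torus := (@Defs.torus R n).
Local Notation BCn := (BCn R n).
Implicit Types (g h : Cn -> R[i]) (mu : cmeasure R n).

Lemma open_measurable_BCn (U : set Cn) : open U -> measurable (U : set BCn).
Proof. exact: sub_sigma_algebra. Qed.

Lemma closed_measurable_BCn (U : set Cn) : closed U -> measurable (U : set BCn).
Proof.
move=> cU; have := measurableC (open_measurable_BCn (closed_openC cU)).
by rewrite setCK.
Qed.

Lemma compact_measurable_BCn (K : set Cn) : compact K -> measurable (K : set BCn).
Proof.
by move=> cK; apply: closed_measurable_BCn; apply: compact_closed => //; exact: cdist_hausdorff.
Qed.

Lemma measurable_torus : measurable (torus : set BCn).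
Proof. exact: (compact_measurable_BCn (@torus_compact R n)). Qed.

Lemma cont_on_measurable (K : set Cn) (phi : Cn -> R) :
  cont_on cdist rdist K phi -> measurable_fun (K : set BCn) (phi : BCn -> R).
Proof.
move=> cphi mK; apply: (measurability _ (RGenOInfty.measurableE R)) => //.
move=> _ [_ [y ->] <-].
(* [V] contains the complement of [K], so that its interior meets [K] exactly in the relatively open
   superlevel set. *)
pose V : set Cn := [set x | K x -> y < phi x].
have -> : K `&` phi @^-1` `]y, +oo[ = K `&` V^°.
  apply/seteqP; split => x [Kx] /=.
    rewrite in_itv /= andbT => yx; split => //.
    have [_ _ _ nT] := @cdist_metrizes R n; apply/nT.
    have [r r0 rP] := cphi _ Kx (phi x - y) (ltac:(by rewrite subr_gt0)).
    exists r => // w xw Kw; have := rP _ Kw xw; rewrite /rdist ltr_norml => /andP[_].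
    by clear; lra.
  move=> /nbhs_singleton/(_ Kx) yx; split => //.
  by rewrite /= in_itv /= andbT.
apply: measurableI => //; apply: open_measurable_BCn; exact: open_interior.
Qed.

Definition cbm g := bmeas (torus : set BCn) (fun x => complex.Re (g x)) /\
  bmeas (torus : set BCn) (fun x => complex.Im (g x)).

Lemma cbmM g h : cbm g -> cbm h -> cbm (fun x => g x * h x).
Proof.
move=> [g1 g2] [h1 h2]; split.
  by under [X in bmeas _ X]eq_fun do rewrite ReM; apply: bmeasB; exact: bmeasM.
by under [X in bmeas _ X]eq_fun do rewrite ImM; apply: bmeasD; exact: bmeasM.
Qed.

Lemma cbm_real (phi : Cn -> R) : bmeas (torus : set BCn) (phi : BCn -> R) ->
  cbm (fun x => (phi x)%:C%C).
Proof. by move=> bphi; split => //=; exact: bmeas_cst. Qed.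

Lemma Re_cont_on (T : Type) (dT : T -> T -> R) (K : set T) (g : T -> R[i]) :
  cont_on dT cdist1 K g -> cont_on dT rdist K (fun x => complex.Re (g x)).
Proof.
move=> cg x Kx e /(cg _ Kx)[r r0 rP]; exists r => // y Ky /(rP _ Ky).
by apply: le_lt_trans; rewrite /rdist -ReN -ReD; exact: Re_cabs.
Qed.

Lemma Im_cont_on (T : Type) (dT : T -> T -> R) (K : set T) (g : T -> R[i]) :
  cont_on dT cdist1 K g -> cont_on dT rdist K (fun x => complex.Im (g x)).
Proof.
move=> cg x Kx e /(cg _ Kx)[r r0 rP]; exists r => // y Ky /(rP _ Ky).
by apply: le_lt_trans; rewrite /rdist -ImN -ImD; exact: Im_cabs.
Qed.

Lemma cbm_intro (E : set Cn) g (M : R) : measurable (E : set BCn) ->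
  cont_on cdist cdist1 E g -> E `<=` torus ->
  (forall x, E x -> cabs (g x) <= M) ->
  cbm (fun x => (\1_E x : R)%:C%C * g x).
Proof.
move=> mE cg ET gM.
have H (phi : Cn -> R) : cont_on cdist rdist E phi -> (forall x, E x -> `|phi x| <= M) ->
    bmeas (torus : set BCn) (fun x => \1_E x * phi x).
  move=> cphi phiM; split.
    have -> : (fun x => \1_E x * phi x) = (phi \_ E : BCn -> R).
      by apply/funext => x; rewrite patchE indicE; case: (x \in E); rewrite ?mul1r ?mul0r.
    apply/(measurable_restrict _ mE measurable_torus).
    by rewrite setIidr//; exact: cont_on_measurable.
  exists `|M| => x _; rewrite indicE; case: (boolP (x \in E)) => [/set_mem Ex|_].
    by rewrite mul1r; apply: le_trans (phiM _ Ex) _; exact: ler_norm.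
  by rewrite mul0r normr0.
split.
  under [X in bmeas _ X]eq_fun do rewrite ReM /= mul0r subr0.
  by apply: H; [exact: Re_cont_on|move=> x /gM; apply: le_trans; exact: Re_cabs].
under [X in bmeas _ X]eq_fun do rewrite ImM /= mul0r addr0.
by apply: H; [exact: Im_cont_on|move=> x /gM; apply: le_trans; exact: Im_cabs].
Qed.

Lemma cont_on_bounded (K : set Cn) g : compact K -> cont_on cdist cdist1 K g ->
  exists2 M : R, 0 <= M & forall x, K x -> cabs (g x) <= M.
Proof.
move=> cK gc; have gC : cont_on cdist rdist K (fun z => cabs (g z)).
  move=> z cz e e0; have [d d0 dP] := gc _ cz _ e0; exists d => // w cw zw.
  apply: le_lt_trans (dP _ cw zw); rewrite ler_norml.
  have := cabs_triangle3 (g z) (g w); have := cabs_triangle3 (g w) (g z).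
  by rewrite /cdist1 (cabsBC (g w)); clear; lra.
have [K0|/set0P K0] := eqVneq K set0.
  by exists 0 => // x; rewrite K0.
have [c cc cP] := cont_on_max (@cdist_metrizes R n) K0 cK gC.
by exists (cabs (g c)) => //; exact: cabs_ge0.
Qed.

Lemma cbm_cont g : cont_on cdist cdist1 torus g -> cbm g.
Proof.
move=> cg; have [M _ gM] := cont_on_bounded torus_compact cg.
split; split.
- exact: (cont_on_measurable (Re_cont_on cg)).
- by exists M => x /gM; apply: le_trans; exact: Re_cabs.
- exact: (cont_on_measurable (Im_cont_on cg)).
- by exists M => x /gM; apply: le_trans; exact: Im_cabs.
Qed.

Lemma cont_onS (T U : Type) (dT : T -> T -> R) (dU : U -> U -> R) (K L : set T) (f : T -> U) :
  L `<=` K -> cont_on dT dU K f -> cont_on dT dU L f.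
Proof.
move=> LK cf x Lx e /(cf _ (LK _ Lx))[r r0 rP]; exists r => // y Ly.
by apply: rP; exact: LK.
Qed.

Lemma inA_cbm g : inA g -> cbm g.
Proof.
by move=> /inAP[gc _]; apply: cbm_cont; apply: cont_onS gc => z; exact: torus_cpolydisc.
Qed.

Lemma cintD mu g h : cbm g -> cbm h ->
  cint mu (fun x => g x + h x) = cint mu g + cint mu h.
Proof.
move=> [g1 g2] [h1 h2]; rewrite /cint -big_split; apply: eq_bigr => k _ /=.
under [X in real_complex _ X]eq_Rintegral do rewrite ReD.
rewrite bintD//; last exact: measurable_torus.
under [in X in iC R * X]eq_Rintegral do rewrite ImD.
rewrite bintD//; last exact: measurable_torus.
by rewrite !rmorphD; ring.
Qed.

Lemma cintZ mu g (c : R[i]) : cbm g -> cint mu (fun x => c * g x) = c * cint mu g.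
Proof.
move=> [g1 g2]; rewrite /cint big_distrr; apply: eq_bigr => k _ /=.
have mT := measurable_torus.
under [X in real_complex _ X]eq_Rintegral do rewrite ReM.
rewrite bintB ?bintZ//; [|exact: bmeasM (bmeas_cst _ _) _..].
under [in X in iC R * X]eq_Rintegral do rewrite ImM.
rewrite bintD ?bintZ//; [|exact: bmeasM (bmeas_cst _ _) _..].
rewrite mulrCA; congr (_ * _).
set a := (\int[_]_(_ in _) _); set b := (\int[_]_(_ in _) _).
by apply: complex_ext; rewrite !(ReD, ImD, ReM, ImM) /=; ring.
Qed.

Lemma cint_ext mu g h : (forall z, torus z -> g z = h z) -> cint mu g = cint mu h.
Proof.
move=> gh; rewrite /cint; apply: eq_bigr => k _; congr (_ * (_%:C%C + _ * _%:C%C)).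
  by apply: eq_Rintegral => x /set_mem Tx; rewrite gh.
by apply: eq_Rintegral => x /set_mem Tx; rewrite gh.
Qed.

(** The factor 2 comes from estimating real and imaginary parts separately. The sum of the four
    parts stands in for the total variation of [mu]. *)
Lemma cint_bound mu g (psi : Cn -> R) : cbm g ->
  bmeas (torus : set BCn) (psi : BCn -> R) ->
  (forall x, torus x -> cabs (g x) <= psi x) ->
  cabs (cint mu g) <= 2 * \sum_(k < 4) \int[cm_part mu k]_(x in (torus : set BCn)) psi x.
Proof.
move=> [g1 g2] bpsi gpsi; have mT := measurable_torus.
apply: le_trans (cabs_sum _ _) _; rewrite mulr_sumr; apply: ler_sum => k _.
rewrite cabsM cabsX cabs_iC expr1n mul1r mulr_natl mulr2n.
apply: le_trans (cabsD _ _) _; apply: lerD.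
  rewrite cabs_real; apply: bint_norm_le => // x /gpsi; apply: le_trans.
  exact: Re_cabs.
rewrite cabsM cabs_iC mul1r cabs_real; apply: bint_norm_le => // x /gpsi; apply: le_trans.
exact: Im_cabs.
Qed.

End ComplexIntegral.

(** * Interpolation sets for A are null sets for the annihilator of A_0 *)

Section UniformLimits.
Context {R : realType} {T : Type} (dT : T -> T -> R).
Implicit Types (K : set T) (f g : T -> R[i]).

Lemma cont_on_lim K (F : nat -> T -> R[i]) f :
  (forall k, cont_on dT cdist1 K (F k)) ->
  (forall e : R, 0 < e -> exists N, forall k, (N <= k)%N ->
     forall z, K z -> cabs (F k z - f z) <= e) ->
  cont_on dT cdist1 K f.
Proof.
move=> cF Ff z z1 e e0; have e30 : 0 < e / 3 by rewrite divr_gt0.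
have [N NP] := Ff _ e30; have [d d0 dP] := cF N _ z1 _ e30.
exists d => // w w1 zw.
have h1 := NP N (leqnn _) z z1; have h2 := NP N (leqnn _) w w1.
have h3 := dP _ w1 zw.
have -> : cdist1 (f z) (f w) = cabs (- (F N z - f z) + (F N z - F N w) + (F N w - f w)).
  by congr cabs; ring.
apply: le_lt_trans (cabsD _ _) _; apply: le_lt_trans (lerD (cabsD _ _) (lexx _)) _.
by rewrite cabsN; move: h1 h2 h3; rewrite /cdist1; clear; lra.
Qed.

Lemma pow3_small (c e : R) : 0 < e -> exists k : nat, c / 3 ^+ k < e.
Proof.
move=> e0; exists (Num.truncn (c / e)).+1.
rewrite ltr_pdivrMr ?exprn_gt0// mulrC -ltr_pdivrMr//.
apply: lt_trans (truncnS_gt _) _.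
by rewrite -natrX ltr_nat ltn_expl.
Qed.

(** [3 / 2] is the sum of the powers of 1/3. The auxiliary [step] keeps the exact partial sums,
    which is what lets the induction on [m] close. *)
Lemma geometric_limit K (F : nat -> T -> R[i]) (c : R) : 0 <= c ->
  (forall k z, K z -> cabs (F k.+1 z - F k z) <= c / 3 ^+ k) ->
  exists f, forall k z, K z -> cabs (F k z - f z) <= c * (3 / 2) / 3 ^+ k.
Proof.
move=> c0 Fc.
have step k m z : K z -> cabs (F (k + m)%N z - F k z) <= c * (3 / 2) * (3 ^- k - 3 ^- (k + m)).
  move=> Kz; elim: m => [|m IH]; first by rewrite addn0 !subrr cabs0 mulr0.
  rewrite addnS -(subrK (F (k + m)%N z) (F _ z)) -addrA.
  apply: le_trans (cabsD _ _) _; apply: le_trans (lerD (Fc _ _ Kz) IH) _.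
  rewrite exprS le_eqVlt; apply/orP; left; apply/eqP.
  have := expf_neq0 k (_ : (3 : R) != 0); have := expf_neq0 (k + m) (_ : (3 : R) != 0).
  set p := 3 ^+ (k + m); set q := 3 ^+ k => pn qn.
  by field; rewrite pn ?qn.
have bd k m z : K z -> cabs (F (k + m)%N z - F k z) <= c * (3 / 2) / 3 ^+ k.
  move=> Kz; apply: le_trans (step _ _ _ Kz) _; apply: ler_wpM2l.
    by rewrite mulr_ge0.
  by rewrite gerBl invr_ge0 exprn_ge0.
have /choice[f fP] : forall z, exists l, K z ->
    forall e : R, 0 < e -> exists N, forall i, (N <= i)%N -> cabs (F i z - l) <= e.
  move=> z; case: (pselect (K z)) => [Kz|nKz]; last by exists 0.
  have [|l lP] := @complex_complete R (fun k => F k z); last by exists l.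
  move=> e e0; have e20 : 0 < e / 2 by rewrite divr_gt0.
  have [N NP] := pow3_small (c * (3/2)) e20; exists N => i j /subnKC <- /subnKC <-.
  rewrite -(subrK (F N z) (F (N + (i - N))%N z)) -addrA.
  apply: le_trans (cabsD _ _) _; rewrite (cabsBC (F N z)) [e]splitr.
  by apply: lerD; apply: le_trans (ltW NP); exact: bd.
exists f => k z Kz; apply/ler_addgt0Pr => e e0.
have [N NP] := fP _ Kz _ e0.
rewrite -(subrK (F (k + N)%N z) (F k z)) -addrA; apply: le_trans (cabsD _ _) _.
rewrite cabsBC; apply: lerD; first exact: bd.
by apply: NP; rewrite leq_addl.
Qed.

(* gliding hump, after Sokal's elementary proof of the uniform boundedness
   principle *)
Lemma uniform_boundedness K (L : nat -> (T -> R[i]) -> R[i]) (B : nat -> R) :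
  (forall m f g, cont_on dT cdist1 K f -> cont_on dT cdist1 K g ->
    L m (fun x => f x + g x) = L m f + L m g) ->
  (forall m c f, cont_on dT cdist1 K f -> L m (fun x => c * f x) = c * L m f) ->
  (forall m f (M : R), cont_on dT cdist1 K f -> 0 <= M ->
    (forall x, K x -> cabs (f x) <= M) -> cabs (L m f) <= B m * M) ->
  (forall f, cont_on dT cdist1 K f -> exists C : R, forall m, cabs (L m f) <= C) ->
  exists C : R, forall m f, cont_on dT cdist1 K f ->
    (forall x, K x -> cabs (f x) <= 1) -> cabs (L m f) <= C.
Proof.
move=> LD LZ LB Lpt.
pose V m := [set r | exists f, [/\ cont_on dT cdist1 K f,
   (forall x, K x -> cabs (f x) <= 1) & r = cabs (L m f)]].
have cc (c : R[i]) : cont_on dT cdist1 K (fun=> c).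
  by move=> x _ e e0; exists 1 => // y _ _; rewrite /cdist1 subrr cabs0.
have cZ c f : cont_on dT cdist1 K f -> cont_on dT cdist1 K (fun x => c * f x).
  move=> cf x Kx e e0; have c0 : 0 < cabs c + 1 by rewrite ltr_wpDl ?cabs_ge0.
  have [r r0 rP] := cf _ Kx _ (divr_gt0 e0 c0); exists r => // y Ky xy.
  rewrite /cdist1 -mulrBr cabsM.
  have := rP _ Ky xy; rewrite ltr_pdivlMr// mulrC => /(le_lt_trans _); apply.
  by rewrite ler_wpM2r ?cabs_ge0// lerDl.
have cD f g : cont_on dT cdist1 K f -> cont_on dT cdist1 K g ->
    cont_on dT cdist1 K (fun x => f x + g x).
  move=> cf cg x Kx e e0; have e20 : 0 < e / 2 by rewrite divr_gt0.
  have [a a0 aP] := cf _ Kx _ e20; have [b b0 bP] := cg _ Kx _ e20.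
  exists (Num.min a b); first by rewrite lt_min a0.
  move=> y Ky; rewrite lt_min => /andP[xa xb].
  rewrite /cdist1 opprD addrACA; apply: le_lt_trans (cabsD _ _) _.
  by rewrite [e]splitr ltrD//; [exact: aP|exact: bP].
have V0 m : V m 0.
  exists (fun=> 0); split=> //; first by move=> x _; rewrite cabs0.
  have -> : (fun=> 0) = (fun x : T => 0 * (0 : R[i])) by apply/funext => x; rewrite mul0r.
  by rewrite (LZ m 0 _ (cc 0)) mul0r cabs0.
have hV m : has_sup (V m).
  split; first by exists 0.
  by exists (B m * 1) => _ [f [cf f1 ->]]; exact: LB.
apply: contrapT => nC.
have big (C : R) : exists m, C < sup (V m).
  apply: contrapT => nm; apply: nC; exists C => m f cf f1.
  rewrite leNgt; apply/negP => Cf; apply: nm; exists m.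
  by apply: lt_le_trans Cf _; apply: ub_le_sup; [case: (hV m)|exists f].
have normV m f : cont_on dT cdist1 K f -> forall (M : R), 0 < M ->
    (forall x, K x -> cabs (f x) <= M) -> cabs (L m f) <= sup (V m) * M.
  move=> cf M M0 fM; rewrite -ler_pdivrMr//.
  apply: ub_le_sup; first by case: (hV m).
  exists (fun x => (M^-1)%:C%C * f x); split; first exact: cZ.
    move=> x Kx; rewrite cabsM cabs_real ger0_norm; last by rewrite invr_ge0 ltW.
    by rewrite [leLHS]mulrC ler_pdivrMr// mul1r; exact: fM.
  rewrite LZ// cabsM cabs_real ger0_norm; last by rewrite invr_ge0 ltW.
  by rewrite [RHS]mulrC.
(* The images of [f + c h] and [f - c h] differ by [2 c L h], so one of them has modulus at least
   [c] times that of [L h], whatever [L f] is. *)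
have near m (f : T -> R[i]) (c : R) : 0 < c -> 0 < sup (V m) -> cont_on dT cdist1 K f ->
    exists g, [/\ cont_on dT cdist1 K g, (forall x, K x -> cabs (g x - f x) <= c) &
      2 / 3 * c * sup (V m) <= cabs (L m g)].
  move=> c0 s0 cf.
  have : 2 / 3 * sup (V m) < sup (V m).
    by rewrite gtr_pMl// ltr_pdivrMr// mul1r ltr_nat.
  move=> /(sup_gt _)[]; first by exists 0.
  move=> _ [h [ch h1 ->]] hs.
  pose g1 x := f x + c%:C%C * h x; pose g2 x := f x + (- c%:C%C) * h x.
  have c1 : cont_on dT cdist1 K g1 by apply: cD => //; exact: cZ.
  have c2 : cont_on dT cdist1 K g2 by apply: cD => //; exact: cZ.
  have cn : cabs c%:C%C = c by rewrite cabs_real gtr0_norm.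
  have d1 x : K x -> cabs (g1 x - f x) <= c.
    by move=> /h1 hx; rewrite /g1 addrC addKr cabsM cn ler_piMr// ltW.
  have d2 x : K x -> cabs (g2 x - f x) <= c.
    by move=> /h1 hx; rewrite /g2 addrC addKr cabsM cabsN cn ler_piMr// ltW.
  have e12 : L m g1 - L m g2 = 2 * c%:C%C * L m h.
    by rewrite !LD ?LZ//; [ring|exact: cZ..].
  have hsum : 2 * (c * cabs (L m h)) <= cabs (L m g1) + cabs (L m g2).
    apply: le_trans (cabsB _ _); rewrite e12 !cabsM cn mulrA.
    have -> : cabs (2 : R[i]) = 2.
      by rewrite (_ : 2 = (2 : R)%:C%C) ?cabs_real ?ger0_norm// rmorph_nat.
    by [].
  have hs' : 2 / 3 * c * sup (V m) <= c * cabs (L m h).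
    by rewrite mulrAC mulrC ler_pM2l// ltW.
  have [h3|h3] := leP (2 / 3 * c * sup (V m)) (cabs (L m g1)).
    by exists g1.
  exists g2; split=> //; move: h3 hs' hsum; clear; lra.
pose C3 k : R := 3 ^- k.
have C30 k : 0 < C3 k by rewrite invr_gt0 exprn_gt0.
pose St := {s : nat * (nat * (T -> R[i])) | cont_on dT cdist1 K s.2.2}.
(* The stage [k.+1] function is within [3 ^- k / 2] of the limit, so the functional chosen there is
   at the limit at least [(2 / 3 - 1 / 2) * 3 ^- k] times its norm. The threshold
   [6 * 3 ^+ k * k.+1%:R] on the norm makes this exceed [k.+1]. *)
pose Tr (s s' : nat * (nat * (T -> R[i]))) :=
  [/\ s'.1 = s.1.+1, (forall x, K x -> cabs (s'.2.2 x - s.2.2 x) <= 1 / 3 ^+ s.1),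
      6 * 3 ^+ s.1 * (s.1.+1)%:R < sup (V s'.2.1) &
      2 / 3 / 3 ^+ s.1 * sup (V s'.2.1) <= cabs (L s'.2.1 s'.2.2)].
have step (s : St) : exists s' : St, Tr (sval s) (sval s').
  case: s => -[k [m f]] /= cf.
  have [m' m'P] := big (6 * 3 ^+ k * (k.+1)%:R).
  have s0 : 0 < sup (V m').
    by apply: le_lt_trans m'P; rewrite !mulr_ge0 ?exprn_ge0.
  have [g [cg gf gL]] := near m' f (C3 k) (C30 k) s0 cf.
  by exists (exist _ (k.+1, (m', g)) cg); split => //=; rewrite mul1r.
have [q [q0 qS]] := @dependent_choice St (fun s s' => Tr (sval s) (sval s'))
  (fun s => cid (step s)) (exist _ (0%N, (0%N, fun=> 0)) (cc 0)).
have qk k : (sval (q k)).1 = k.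
  elim: k => [|k IH]; first by rewrite q0.
  by have [-> _ _ _] := qS k; rewrite IH.
pose F k := (sval (q k)).2.2; pose mm k := (sval (q k)).2.1.
have FS k x : K x -> cabs (F k.+1 x - F k x) <= 1 / 3 ^+ k.
  by move=> Kx; have [_ /(_ _ Kx) + _ _] := qS k; rewrite qk.
have [f fP] := geometric_limit ler01 FS.
have cF k : cont_on dT cdist1 K (F k) by exact: (svalP (q k)).
have cf : cont_on dT cdist1 K f.
  apply: (cont_on_lim cF) => e e0; have [N NP] := pow3_small (1 * (3/2)) e0.
  exists N => k Nk z Kz; apply: le_trans (fP _ _ Kz) _; apply: le_trans (ltW NP).
  apply: ler_wpM2l; first by rewrite mul1r divr_ge0.
  by rewrite lef_pV2 ?posrE ?exprn_gt0// ler_eXn2l// ltr1n.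
have [C CP] := Lpt _ cf.
pose k := (Num.truncn C).+1.
have Ck : C < k%:R by exact: truncnS_gt.
have [_ _] := qS k; rewrite qk -/(F k.+1) -/(mm k.+1) => h1 h2.
have h3 := CP (mm k.+1).
have h4 : cabs (L (mm k.+1) (fun x => F k.+1 x + (-1) * f x)) <=
    sup (V (mm k.+1)) * (1 * (3 / 2) / 3 ^+ k.+1).
  apply: normV.
  - by apply: cD => //; exact: cZ.
  - by rewrite mul1r !divr_gt0 ?exprn_gt0.
  - by move=> x Kx; rewrite mulN1r; exact: fP.
rewrite LD ?LZ// in h4; last exact: cZ.
have h5 := cabs_triangle3 (L (mm k.+1) f) (L (mm k.+1) (F k.+1)).
rewrite mulN1r in h4.
set s := sup _ in h1 h2 h4; set p : R := 3 ^+ k in h1 h2 h4.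
have p0 : 0 < p by rewrite exprn_gt0.
have h6 : 2 / 3 * s <= (C + s * (3 / 2) / (3 * p)) * p.
  rewrite -ler_pdivrMr// mulrAC; apply: le_trans h2 _; apply: le_trans h5 _.
  apply: lerD => //; apply: le_trans h4 _.
  by rewrite exprS -/p mul1r mulrA.
have h7 : (C + s * (3 / 2) / (3 * p)) * p = C * p + s / 2.
  by field; rewrite gt_eqF.
rewrite h7 in h6.
have h8 : C * p <= (k.+1)%:R * p.
  by rewrite ler_pM2r// ltW// (lt_trans Ck)// ltr_nat.
have h9 : 0 < (k.+1)%:R * p by rewrite mulr_gt0.
by move: h1 h6 h8 h9; rewrite -mulrA [p * _]mulrC; set x := _ * p; set y := C * p; clear; lra.
Qed.

End UniformLimits.

(** * Trigonometric polynomials close to indicator functions *)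

Section TrigonometricBumps.
Context {R : realType} {n : nat}.
Notation Cn := 'rV[R[i]^o]_n.
Local Notation torus := (@Defs.torus R n).
Implicit Types (r g h : Cn -> R[i]) (rho : Cn -> R).

Definition coord_prod (z : Cn) : R[i] := \prod_(j < n) z ord0 j.

Lemma inA_coord_prod : inA coord_prod.
Proof. exact: inA_prod (fun j => inA_coord j). Qed.

Lemma cabs_coord_prod z : torus z -> cabs (coord_prod z) = 1.
Proof.
by move=> /torusP Tz; rewrite /coord_prod cabs_prod big1// => j _; exact: Tz.
Qed.

(* Up to the unimodular factor [coord_prod ^+ N], trigonometric polynomials are
   analytic on the torus. *)
Definition trig r := exists N h, inA h /\
  forall z, torus z -> h z = coord_prod z ^+ N * r z.

Lemma trig_inA g : inA g -> trig g.
Proof. by move=> Ag; exists 0%N, g; split=> // z _; rewrite expr0 mul1r. Qed.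

Lemma trigD r1 r2 : trig r1 -> trig r2 -> trig (fun z => r1 z + r2 z).
Proof.
move=> [N1 [h1 [A1 E1]]] [N2 [h2 [A2 E2]]].
exists (N1 + N2)%N, (fun z => coord_prod z ^+ N2 * h1 z + coord_prod z ^+ N1 * h2 z); split.
  exact: (inAD (inAM (inAX N2 inA_coord_prod) A1) (inAM (inAX N1 inA_coord_prod) A2)).
by move=> z Tz; rewrite E1// E2// exprD; ring.
Qed.

Lemma trigM r1 r2 : trig r1 -> trig r2 -> trig (fun z => r1 z * r2 z).
Proof.
move=> [N1 [h1 [A1 E1]]] [N2 [h2 [A2 E2]]].
exists (N1 + N2)%N, (fun z => h1 z * h2 z); split; first exact: (inAM A1 A2).
by move=> z Tz; rewrite E1// E2// exprD; ring.
Qed.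

(** On the torus conjugation is inversion, and the product of all coordinates times the inverse of
    one of them is the product of the others. *)
Lemma trig_conj j : trig (fun z => (z ord0 j)^*%C).
Proof.
exists 1%N, (fun z => \prod_(k < n) (if k == j then 1 else z ord0 k)); split.
  apply: (@inA_prod R n _ (index_enum 'I_n) (fun k (z : Cn) => if k == j then 1 else z ord0 k)) => k.
  by case: (k == j); [exact: inA_cst|exact: inA_coord].
move=> z /torusP Tz; rewrite expr1 /coord_prod (bigD1 j)//= eqxx mul1r.
rewrite [in RHS](bigD1 j)//= mulrAC -sqr_cabs Tz expr1n mul1r.
by apply: eq_bigr => k /negbTE ->.
Qed.

Definition trigR rho := trig (fun z => (rho z)%:C%C).

Lemma trigR_ext rho1 rho2 : (forall z, rho1 z = rho2 z) -> trigR rho1 -> trigR rho2.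
Proof. by move=> E; rewrite (_ : rho1 = rho2)//; apply/funext. Qed.

Lemma trigR_cst (c : R) : trigR (fun=> c).
Proof. exact/trig_inA/inA_cst. Qed.

Lemma trigRD rho1 rho2 : trigR rho1 -> trigR rho2 -> trigR (fun z => rho1 z + rho2 z).
Proof.
by move=> t1 t2; have := trigD t1 t2; rewrite /trigR; under eq_fun do rewrite -rmorphD.
Qed.

Lemma trigRM rho1 rho2 : trigR rho1 -> trigR rho2 -> trigR (fun z => rho1 z * rho2 z).
Proof.
by move=> t1 t2; have := trigM t1 t2; rewrite /trigR; under eq_fun do rewrite -rmorphM.
Qed.

Lemma trigRX rho m : trigR rho -> trigR (fun z => rho z ^+ m).
Proof.
move=> t; elim: m => [|m IH]; first exact: trigR_cst.
by apply: trigR_ext (trigRM t IH) => z; rewrite exprS.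
Qed.

Lemma trigR_compl rho : trigR rho -> trigR (fun z => 1 - rho z).
Proof.
move=> t; apply: trigR_ext (trigRD (trigR_cst 1) (trigRM (trigR_cst (-1)) t)) => z.
by rewrite mulN1r.
Qed.

Lemma trigR_sum (I : Type) (s : seq I) (F : I -> Cn -> R) :
  (forall i, trigR (F i)) -> trigR (fun z => \sum_(i <- s) F i z).
Proof.
move=> tF; elim: s => [|a s IH].
  by apply: trigR_ext (trigR_cst 0) => z; rewrite big_nil.
by apply: trigR_ext (trigRD (tF a) IH) => z; rewrite big_cons.
Qed.

Lemma trigR_prod (I : Type) (s : seq I) (F : I -> Cn -> R) :
  (forall i, trigR (F i)) -> trigR (fun z => \prod_(i <- s) F i z).
Proof.
move=> tF; elim: s => [|a s IH].
  by apply: trigR_ext (trigR_cst 1) => z; rewrite big_nil.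
by apply: trigR_ext (trigRM (tF a) IH) => z; rewrite big_cons.
Qed.

(** The squares make this a trigonometric polynomial in [z]; [sqdist_cdist] and [cdist_sqdist]
    compare it with the distance used for continuity. *)
Definition sqdist (x z : Cn) : R := \sum_(j < n) cabs (z ord0 j - x ord0 j) ^+ 2.

Lemma trigR_sqdist x : trigR (sqdist x).
Proof.
apply: (@trigR_sum _ (index_enum 'I_n) (fun j (z : Cn) => cabs (z ord0 j - x ord0 j) ^+ 2)) => j.
rewrite /trigR; under eq_fun do rewrite sqr_cabs rmorphB.
apply: trigM; apply: trigD.
- exact/trig_inA/inA_coord.
- exact: (trig_inA (inA_cst (- x ord0 j))).
- exact: trig_conj.
- exact: (trig_inA (inA_cst (- (x ord0 j)^*%C))).
Qed.

Lemma sqdist_ge0 x z : 0 <= sqdist x z.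
Proof. by apply: sumr_ge0 => j _; exact: sqr_ge0. Qed.

Lemma sqdist_torus x z : torus x -> torus z -> sqdist x z <= 4 * n%:R.
Proof.
move=> /torusP Tx /torusP Tz.
rewrite mulr_natr -[X in _ *+ X]card_ord -sumr_const; apply: ler_sum => j _.
rewrite (_ : 4 = 2 ^+ 2); last by ring.
apply: lerXn2r; rewrite ?nnegrE ?cabs_ge0//.
by apply: le_trans (cabsB _ _) _; rewrite Tx Tz.
Qed.

Lemma sqdist_cdist x z : sqdist x z <= cdist x z ^+ 2.
Proof.
rewrite [leRHS]expr2 [X in X * _]/cdist mulr_suml; apply: ler_sum => j _.
rewrite cabsBC expr2; apply: ler_wpM2l; first exact: cabs_ge0.
exact: cdist_coord.
Qed.

Lemma cdist_sqdist x z : cdist x z <= n%:R * Num.sqrt (sqdist x z).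
Proof.
rewrite mulr_natl -[X in _ *+ X]card_ord -sumr_const; apply: ler_sum => j _.
rewrite -(ger0_norm (cabs_ge0 _)) -sqrtr_sqr ler_wsqrtr//.
rewrite /sqdist (bigD1 j)//= cabsBC lerDl.
by apply: sumr_ge0 => k _; exact: sqr_ge0.
Qed.

Lemma bernoulli_lower (t : R) m : 0 <= t <= 1 -> 1 - m%:R * t <= (1 - t) ^+ m.
Proof.
move=> /andP[t0 t1]; elim: m => [|m IH]; first by rewrite mul0r subr0 expr0.
rewrite exprS -natr1; apply: (@le_trans _ _ ((1 - t) * (1 - m%:R * t))).
  have : 0 <= m%:R * t * t by rewrite !mulr_ge0.
  by lra.
by apply: ler_wpM2l => //; rewrite subr_ge0.
Qed.

(** The product of the [m]-th powers of [1 - t] and [1 + t] is at most 1, and the second power is at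
    least [m * t]. *)
Lemma bernoulli_upper (t : R) m : 0 <= t <= 1 -> (1 - t) ^+ m * (m%:R * t) <= 1.
Proof.
move=> /andP[t0 t1].
have h0 : 0 <= (1 - t) ^+ m by rewrite exprn_ge0// subr_ge0.
apply: (@le_trans _ _ ((1 - t) ^+ m * (1 + t) ^+ m)).
  apply: ler_wpM2l => //; apply: le_trans (bernoulli_ineq m t0).
  by rewrite lerDr.
rewrite -exprMn; apply: exprn_ile1.
  by rewrite mulr_ge0 ?subr_ge0// addr_ge0.
by have := sqr_ge0 t; clear; nra.
Qed.

(* [(1 - p^M)^(k^M)] tends to 1 where [k p <= 1/2] and to 0 where [k p >= 2] *)
Lemma step_near (p : R) k M : 0 <= p <= 1 -> k%:R * p <= 1 / 2 ->
  1 - 2 ^- M <= (1 - p ^+ M) ^+ (k ^ M).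
Proof.
move=> /andP[p0 p1] kp; have pM : 0 <= p ^+ M <= 1 by rewrite exprn_ge0// exprn_ile1.
apply: le_trans (bernoulli_lower _ pM); rewrite lerD2l lerN2 natrX -exprMn.
rewrite -exprVn; apply: lerXn2r; rewrite ?nnegrE ?mulr_ge0//.
by rewrite -[X in _ <= X]mul1r.
Qed.

Lemma step_far (p : R) k M : 0 <= p <= 1 -> 2 <= k%:R * p ->
  (1 - p ^+ M) ^+ (k ^ M) <= 2 ^- M.
Proof.
move=> /andP[p0 p1] kp; have pM : 0 <= p ^+ M <= 1 by rewrite exprn_ge0// exprn_ile1.
have := bernoulli_upper (k ^ M) pM; rewrite natrX -exprMn.
move=> h; rewrite -[leRHS]mul1r ler_pdivlMr ?exprn_gt0//; apply: le_trans h.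
apply: ler_wpM2l; first by rewrite exprn_ge0// subr_ge0; case/andP: pM.
by apply: lerXn2r; rewrite ?nnegrE// mulr_ge0.
Qed.

Lemma prod_compl_lower (I : Type) (s : seq I) (F : I -> R) :
  (forall i, 0 <= F i <= 1) -> 1 - \sum_(i <- s) F i <= \prod_(i <- s) (1 - F i) <= 1.
Proof.
move=> F01; elim: s => [|a s IH]; first by rewrite !big_nil subr0 lexx.
have P0 : 0 <= \prod_(i <- s) (1 - F i).
  elim: s {IH} => [|b s IH]; first by rewrite big_nil.
  by rewrite big_cons mulr_ge0// subr_ge0; case/andP: (F01 b).
move: IH P0; rewrite !big_cons; set p := \prod_(i <- s) _; set q := \sum_(i <- s) _.
by move=> /andP[h1 h2] h3; have /andP[h4 h5] := F01 a; apply/andP; split; nra.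
Qed.

Lemma sum_le_size (I : eqType) (s : seq I) (F : I -> R) (c : R) :
  (forall i, i \in s -> F i <= c) -> \sum_(i <- s) F i <= (size s)%:R * c.
Proof.
elim: s => [|a s IH] H; first by rewrite big_nil mul0r.
rewrite big_cons /= -natr1 mulrDl mul1r addrC; apply: lerD.
  by apply: IH => i si; apply: H; rewrite in_cons si orbT.
by apply: H; rewrite mem_head.
Qed.

Lemma prod_itv01 (I : eqType) (s : seq I) (F : I -> R) :
  (forall i, i \in s -> 0 <= F i <= 1) -> 0 <= \prod_(i <- s) F i <= 1.
Proof.
elim: s => [|a s IH] H; first by rewrite big_nil ler01 lexx.
rewrite big_cons; have /andP[h1 h2] := H a (mem_head _ _).
have /andP[h3 h4] : 0 <= \prod_(i <- s) F i <= 1.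
  by apply: IH => i si; apply: H; rewrite in_cons si orbT.
by rewrite mulr_ge0//= mulr_ile1.
Qed.

(** In the manner of Brosowski and Deutsch's proof of the Stone-Weierstrass theorem: for each centre
    [x] of a finite cover of [S], a power function [E x] is near 1 close to [x] and near 0 far from
    it. One minus the product of the [1 - E x] plays the role of a union. *)
Lemma trig_bump (S : set Cn) (eta e : R) : (0 < n)%N -> compact S -> S `<=` torus ->
  0 < eta -> 0 < e -> exists rho, [/\ trigR rho,
    (forall z, torus z -> 0 <= rho z <= 1),
    (forall z, S z -> 1 - e <= rho z) &
    (forall z, torus z -> (forall x, S x -> eta <= sqdist x z) -> rho z <= e)].
Proof.
move=> n0 cS ST eta0 e0.
have n40 : 0 < 4 * n%:R :> R by rewrite mulr_gt0// ltr0n.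
pose p x z := sqdist x z / (4 * n%:R).
have p01 x z : torus x -> torus z -> 0 <= p x z <= 1.
  move=> Tx Tz; rewrite divr_ge0 ?sqdist_ge0 ?(ltW n40)//=.
  by rewrite ler_pdivrMr// mul1r sqdist_torus.
pose a := eta / (4 * n%:R); have a0 : 0 < a by rewrite divr_gt0.
(* On the torus [sqdist] is at most [4 * n], hence the normalisation [p]. This [k] gives
   [k * p >= 2] where [sqdist] is at least [eta], and [c] below is the value of [sqdist] at which
   [k * p] is 1/2. *)
pose k := (Num.truncn (2 / a)).+1.
have k0 : 0 < k%:R :> R by rewrite ltr0n.
have ka : 2 <= k%:R * a.
  by rewrite -ler_pdivrMr//; apply/ltW/truncnS_gt.
pose c := 4 * n%:R / (2 * k%:R) : R.
have c0 : 0 < c by rewrite divr_gt0// mulr_gt0.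
have sc0 : 0 < Num.sqrt c by rewrite sqrtr_gt0.
have [_ _ d0 nT] := @cdist_metrizes R n.
have [D DS SD] : finite_subset_cover S (fun x : Cn => [set z | cdist x z < Num.sqrt c]°) S.
  move: cS; rewrite compact_cover; apply; first by move=> x _; exact: open_interior.
  move=> x Sx; exists x => //; apply/nT; exists (Num.sqrt c) => //.
pose s := finmap.enum_fset D.
have sS x : x \in s -> S x by move=> /DS /set_mem.
pose N := size s.
(* [N.+1] dominates both [N], for the errors of all centres added up far from [S], and 1, for the
   error of a single centre close to a point of [S]. *)
pose M := (Num.truncn (N.+1%:R / e)).+1.
have NM : N.+1%:R * 2 ^- M <= e.
  rewrite ler_pdivrMr ?exprn_gt0// mulrC -ler_pdivrMr//; apply/ltW.
  apply: lt_trans (truncnS_gt _) _; rewrite -/M -natrX ltr_nat.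
  exact: ltn_expl.
have M0 : 0 <= 2 ^- M :> R by rewrite invr_ge0 exprn_ge0.
have N1 : 2 ^- M <= N.+1%:R * 2 ^- M :> R by rewrite ler_peMl// ler1n.
have N2 : N%:R * 2 ^- M <= N.+1%:R * 2 ^- M :> R by rewrite ler_wpM2r// ler_nat.
pose E x z := (1 - p x z ^+ M) ^+ (k ^ M).
have E01 x z : torus x -> torus z -> 0 <= E x z <= 1.
  move=> Tx Tz; have /andP[h1 h2] := p01 _ _ Tx Tz.
  have h3 : 0 <= 1 - p x z ^+ M by rewrite subr_ge0 exprn_ile1.
  by rewrite exprn_ge0//= exprn_ile1// gerBl exprn_ge0.
exists (fun z => 1 - \prod_(x <- s) (1 - E x z)); split.
- apply: trigR_compl; apply: (@trigR_prod _ s (fun x z => 1 - E x z)) => x.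
  apply: trigR_compl; apply: trigRX; apply: trigR_compl; apply: trigRX.
  by apply: (trigRM (trigR_sqdist x)); exact: trigR_cst.
- move=> z Tz.
  suff : 0 <= \prod_(x <- s) (1 - E x z) <= 1.
    by move=> /andP[h1 h2]; rewrite subr_ge0 h2 gerBl.
  apply: prod_itv01 => x /sS/ST Tx; have /andP[h1 h2] := E01 _ _ Tx Tz.
  by rewrite subr_ge0 h2 gerBl.
- move=> z Sz; have Tz := ST _ Sz.
  have [x /= xs] := SD _ Sz; move=> /interior_subset /= xz.
  have Tx : torus x by exact/ST/sS.
  rewrite lerD2l lerN2; apply: le_trans (le_trans N1 NM).
  have near : 1 - 2 ^- M <= E x z.
    apply: step_near; first exact: p01.
    rewrite mulrA ler_pdivrMr// mulrC -ler_pdivlMr//.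
    apply: le_trans (sqdist_cdist _ _) _; apply/ltW.
    have : cdist x z ^+ 2 < Num.sqrt c ^+ 2.
      by apply: ltrXn2r; rewrite ?nnegrE ?cdist_ge0 ?ltW.
    rewrite sqr_sqrtr ?ltW// => /lt_le_trans; apply.
    by rewrite /c le_eqVlt; apply/orP; left; apply/eqP; field; rewrite gt_eqF.
  have rest : 0 <= \prod_(y <- rem x s) (1 - E y z) <= 1.
    apply: prod_itv01 => y /mem_rem/sS/ST Ty; have /andP[h1 h2] := E01 _ _ Ty Tz.
    by rewrite subr_ge0 h2 gerBl.
  rewrite (big_rem x)//=; apply: (@le_trans _ _ (1 - E x z)); last first.
    by move: near; clear; lra.
  apply: ler_piMr; first by rewrite subr_ge0; case/andP: (E01 _ _ Tx Tz).
  by case/andP: rest.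
- move=> z Tz far; apply: le_trans NM; apply: le_trans N2.
  (* [prod_compl_lower] wants values in [0, 1] at every index, whereas [E] is controlled at points
     of the torus; hence the extension by 0 off the centres. *)
  pose G x := if x \in s then E x z else 0.
  have G01 x : 0 <= G x <= 1.
    by rewrite /G; case: ifP => [/sS/ST Tx|_]; [exact: E01|rewrite lexx ler01].
  have := prod_compl_lower s G01.
  have -> : \prod_(i <- s) (1 - G i) = \prod_(i <- s) (1 - E i z).
    by rewrite big_seq [RHS]big_seq; apply: eq_bigr => x xs; rewrite /G xs.
  have : \sum_(x <- s) G x <= N%:R * 2 ^- M.
    apply: sum_le_size => x xs.
    rewrite /G xs; apply: step_far; first by apply: p01 => //; exact/ST/sS.
    apply: le_trans ka _; rewrite ler_pM2l// ler_pM2r ?invr_gt0//.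
    exact/far/sS.
  by clear; move=> h1 /andP[h2 _]; lra.
Qed.

End TrigonometricBumps.

(** * Distance to a set, and measures tested on continuous functions *)

Section DistanceToSet.
Context {R : realType} {n : nat}.
Notation Cn := 'rV[R[i]^o]_n.
Implicit Types (K U : set Cn) (z w : Cn).

Definition dist_set K z : R := inf [set cdist z x | x in K].

Lemma has_lbound_dist K z : has_lbound [set cdist z x | x in K].
Proof. by exists 0 => _ [x _ <-]; exact: cdist_ge0. Qed.

Lemma dist_set_ge0 K z : K !=set0 -> 0 <= dist_set K z.
Proof.
move=> [x Kx]; apply: lb_le_inf; first by exists (cdist z x), x.
by move=> _ [y _ <-]; exact: cdist_ge0.
Qed.

Lemma dist_set_le K z x : K x -> dist_set K z <= cdist z x.
Proof. by move=> Kx; apply: ge_inf; [exact: has_lbound_dist|exists x]. Qed.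

Lemma dist_set_lip K z w : K !=set0 -> dist_set K z <= dist_set K w + cdist z w.
Proof.
move=> [x Kx]; rewrite -lerBlDr; apply: lb_le_inf; first by exists (cdist w x), x.
move=> _ [y Ky <-]; rewrite lerBlDr addrC; apply: le_trans (dist_set_le z Ky) _.
by have [_ tT _ _] := @cdist_metrizes R n; exact: tT.
Qed.

Lemma dist_set0 K z : K z -> dist_set K z = 0.
Proof.
move=> Kz; apply/eqP; rewrite eq_le dist_set_ge0 ?andbT; last by exists z.
have [_ _ d0 _] := @cdist_metrizes R n.
by rewrite -(d0 z); exact: dist_set_le.
Qed.

Lemma dist_set_gt0 K z : K !=set0 -> closed K -> ~ K z -> 0 < dist_set K z.
Proof.
move=> K0 cK nKz; have /closed_openC : closed K by [].
rewrite openE => /(_ z nKz); have [_ _ _ nT] := @cdist_metrizes R n.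
move=> /nT[r r0 rP]; apply: lt_le_trans r0 _; apply: lb_le_inf.
  by case: K0 => x Kx; exists (cdist z x), x.
move=> _ [x Kx <-]; rewrite leNgt; apply/negP => /rP; exact.
Qed.

(** For closed nonempty [K] these continuous functions increase with [m] to the indicator of the
    complement of [K]. *)
Definition ramp K (m : nat) z : R := Num.min 1 (m%:R * dist_set K z).

Lemma ramp01 K m z : K !=set0 -> 0 <= ramp K m z <= 1.
Proof.
move=> K0; rewrite /ramp ge_min lexx andbT le_min ler01 mulr_ge0//.
exact: dist_set_ge0.
Qed.

Lemma ramp_in K m z : K z -> ramp K m z = 0.
Proof. by move=> Kz; rewrite /ramp dist_set0// mulr0 min_r. Qed.

Lemma ramp_out K z : K !=set0 -> closed K -> ~ K z ->
  (fun m => ramp K m z) @ \oo --> (1 : R).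
Proof.
move=> K0 cK nKz; have d0 := dist_set_gt0 K0 cK nKz.
apply: cvg_near_cst; exists (Num.truncn (1 / dist_set K z)).+1 => // m /= Nm.
rewrite /ramp min_l// -ler_pdivrMr//; apply/ltW.
by apply: lt_le_trans (truncnS_gt _) _; rewrite ler_nat.
Qed.

Lemma ramp_cont K m (L : set Cn) : K !=set0 -> cont_on cdist rdist L (ramp K m).
Proof.
move=> K0 z _ e e0; have m0 : 0 < m%:R + 1 :> R by rewrite ltr_wpDl.
exists (e / (m%:R + 1)); first by rewrite divr_gt0.
move=> w _; rewrite ltr_pdivlMr// => zw.
have [sT _ _ _] := @cdist_metrizes R n.
have h1 := dist_set_lip z w K0; have h2 := dist_set_lip w z K0; rewrite sT in h2.
have m1 : 0 <= m%:R :> R by [].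
have g1 : m%:R * dist_set K z <= m%:R * dist_set K w + m%:R * cdist z w.
  by rewrite -mulrDr ler_wpM2l.
have g2 : m%:R * dist_set K w <= m%:R * dist_set K z + m%:R * cdist z w.
  by rewrite -mulrDr ler_wpM2l.
have g3 : m%:R * cdist z w < e.
  by apply: le_lt_trans zw; rewrite mulrC ler_wpM2l ?cdist_ge0// lerDl.
rewrite /rdist /ramp ltr_norml; move: g1 g2 g3.
set a := m%:R * dist_set K z; set b := m%:R * dist_set K w; set c := m%:R * cdist z w.
have c0 : 0 <= c by rewrite mulr_ge0 ?cdist_ge0.
move: c0 e0; clear => *; rewrite !minEle.
by case: (leP 1 a) => ?; case: (leP 1 b) => ?; apply/andP; split; lra.
Qed.

End DistanceToSet.

Section MeasuresOnCompact.
Context {R : realType} {n : nat}.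
Notation Cn := 'rV[R[i]^o]_n.
Local Notation torus := (@Defs.torus R n).
Local Notation BCn := (BCn R n).

Lemma bint_indic (nu : {finite_measure set BCn -> \bar R}) (E : set BCn) :
  measurable E -> E `<=` torus ->
  \int[nu]_(x in (torus : set BCn)) (\1_E x) = fine (nu E).
Proof.
move=> mE ET; rewrite /Rintegral integral_indic//; last exact: measurable_torus.
by rewrite setIidl.
Qed.

(** Open sets are a generating class stable under intersection, and the indicator of an open set is
    the limit of the ramps of its complement. Dominated convergence therefore carries the equality
    from continuous functions to open sets. *)
Lemma measure_eq_on (nu nu' : {finite_measure set BCn -> \bar R}) (S : set Cn) :
  compact S -> S `<=` torus ->
  (forall phi : Cn -> R, cont_on cdist rdist setT phi ->
     \int[nu]_(x in (torus : set BCn)) (\1_S x * phi x) =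
     \int[nu']_(x in (torus : set BCn)) (\1_S x * phi x)) ->
  forall E : set BCn, measurable E -> E `<=` S -> nu E = nu' E.
Proof.
move=> cS ST H.
have mS : measurable (S : set BCn) by exact: compact_measurable_BCn.
have mT := @measurable_torus R n.
have openE_ (U : set Cn) : open U -> nu (U `&` S) = nu' (U `&` S).
  move=> oU; have mU := open_measurable_BCn oU.
  have mUS : measurable ((U `&` S) : set BCn) by exact: measurableI.
  have UST : U `&` S `<=` torus by move=> x [_ /ST].
  suff fE : fine (nu (U `&` S)) = fine (nu' (U `&` S)).
    by rewrite -[LHS]fineK ?fin_num_measure// -[RHS]fineK ?fin_num_measure// fE.
  rewrite -!bint_indic//.
  (* The ramps measure the distance to the complement of [U], so that the whole space is treated
     apart, with the constant 1 as test function. *)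
  have [U0|/set0P U0] := eqVneq (~` U) set0.
    have -> : (\1_(U `&` S) : BCn -> R) = (fun x => \1_S x * 1).
      by apply/funext => x; rewrite -(setCK U) U0 setC0 setTI mulr1.
    by apply: H => z _ e e0; exists 1 => // w _ _; rewrite /rdist subrr normr0.
  have cU : closed (~` U) by exact: open_closedC.
  have lim (m' : {finite_measure set BCn -> \bar R}) :
    (\int[m']_(x in (torus : set BCn)) (\1_S x * ramp (~` U) m x))%R @[m --> \oo]
      --> \int[m']_(x in (torus : set BCn)) (\1_(U `&` S) x).
    apply: (@bint_dct _ _ _ _ mT _ (fun m x => \1_S x * ramp (~` U) m x) _ 1).
    - move=> m; apply: measurable_funM; first exact: measurable_indic.
      exact: (cont_on_measurable (ramp_cont m U0)).
    - exact: bmeas_indic.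
    - move=> m x _; have /andP[h1 h2] := ramp01 m x U0.
      rewrite indicE; case: (_ \in _); rewrite ?mul0r ?normr0// mul1r ger0_norm//.
    - move=> x _; rewrite !indicE in_setI.
      have [xS|xS] := boolP (x \in S); last first.
        by under eq_fun do rewrite mul0r; rewrite andbF; exact: cvg_cst.
      rewrite andbT; under eq_fun do rewrite mul1r.
      have [xU|xU] := boolP (x \in U).
        by apply: ramp_out => //; move/set_mem : xU => Ux nUx; exact: nUx.
      have nU : (~` U) x by move=> /mem_set; rewrite (negbTE xU).
      by under eq_fun do rewrite ramp_in//; exact: cvg_cst.
  have := lim nu; under eq_fun do rewrite (H _ (ramp_cont _ U0)).
  by move=> /(cvg_unique _ (lim nu')) ->.
move=> E mE ES.
have : mrestr nu mS E = mrestr nu' mS E.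
  apply: (@measure_unique _ _ BCn (@open Cn) (fun=> setT)) => //.
  - exact: openI.
  - by move=> _; exact: openT.
  - by apply/seteqP; split => // x _; exists 0%N.
  - by move=> _; exact: (finite_measure_ltoo nu (measurableI _ _ measurableT mS)).
by rewrite /mrestr setIidl.
Qed.

End MeasuresOnCompact.

Section TotalVariation.
Context {R : realType} {n : nat}.
Notation Cn := 'rV[R[i]^o]_n.
Local Notation BCn := (BCn R n).
Implicit Types (mu : cmeasure R n) (S : set BCn).

(** A Borel subset of [S] and its relative complement form a partition, so vanishing variation kills
    each value. Partitions do not occur again after this lemma. *)
Lemma ctotvar_eq0 mu S : measurable S ->
  ctotvar mu S = 0%E <-> forall E, measurable E -> E `<=` S -> cmval mu E = 0.
Proof.
move=> mS; split.
- move=> tv0 E mE ES.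
  have part : borel_partition S [:: E; S `\` E].
    split; first by move=> F; rewrite !inE => /orP[] /eqP -> //; exact: measurableD.
    split; last by rewrite !big_cons big_nil setU0 setDUK.
    move=> i [|[|j]] /andP[ij j2] //; case: i ij => // _ /=.
    by rewrite setDE setICA setICr setI0.
  have : ((\sum_(F <- [:: E; S `\` E]) cabs (cmval mu F))%:E <= ctotvar mu S)%E.
    by apply: ereal_sup_ubound; exists [:: E; S `\` E].
  rewrite tv0 lee_fin !big_cons big_nil addr0 => le0.
  apply: cabs_eq0; apply/eqP; rewrite eq_le cabs_ge0 andbT.
  by apply: le_trans le0; rewrite lerDl cabs_ge0.
- move=> H; apply/eqP; rewrite eq_le; apply/andP; split.
    apply: ge_ereal_sup => _ [s [ms [_ sS]] <-].
    rewrite lee_fin big_seq big1// => E sE.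
    have -> : cmval mu E = 0; last exact: cabs0.
    apply: H; first exact: ms.
    by rewrite -sS => x Ex; rewrite (big_rem E)//=; left.
  apply: ereal_sup_ubound; exists [:: S].
    split; first by move=> F; rewrite inE => /eqP ->.
    split; first by move=> i [|j] /andP[].
    by rewrite big_cons big_nil setU0.
  by rewrite big_cons big_nil addr0 (H S)//; congr (_%:E); exact: cabs0.
Qed.

Lemma cmvalE mu (E : set BCn) : cmval mu E =
  Complex (fine (cm_part mu 0 E) - fine (cm_part mu 2%:R E))
          (fine (cm_part mu 1 E) - fine (cm_part mu 3%:R E)).
Proof.
rewrite /cmval sum_ord4.
rewrite /= !exprS expr0 /iC.
by apply: complex_ext; rewrite !(ReD, ImD, ReM, ImM) /=; ring.
Qed.

Lemma cintE mu g : cint mu g =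
  \sum_(k < 4) iC R ^+ k *
    Complex (\int[cm_part mu k]_(x in (torus (n := n) : set BCn)) complex.Re (g x))
            (\int[cm_part mu k]_(x in (torus (n := n) : set BCn)) complex.Im (g x)).
Proof.
rewrite /cint; apply: eq_bigr => k _; congr (_ * _).
by apply: complex_ext; rewrite !(ReD, ImD, ReM, ImM) /iC /=; ring.
Qed.

End TotalVariation.

Section InterpolationNull.
Context {R : realType} {n : nat}.
Notation Cn := 'rV[R[i]^o]_n.
Local Notation torus := (@Defs.torus R n).
Local Notation BCn := (BCn R n).
Implicit Types (mu : cmeasure R n) (f g v : Cn -> R[i]).

Definition on_set (S : set Cn) g : Cn -> R[i] := fun x => (\1_S x : R)%:C%C * g x.

Lemma cint_real mu (phi : Cn -> R) :
  let J k := \int[cm_part mu k]_(x in (torus : set BCn)) phi x in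
  cint mu (fun x => (phi x)%:C%C) = Complex (J 0 - J 2%:R) (J 1 - J 3%:R).
Proof.
move=> J; rewrite cintE.
have E k : \int[cm_part mu k]_(x in (torus : set BCn)) complex.Im (phi x)%:C%C = 0.
  by rewrite /= Rintegral_cst ?mul0r//; exact: measurable_torus.
under eq_bigr => k _ do rewrite E.
rewrite sum_ord4.
rewrite -/(J 0) -/(J 1) -/(J 2%:R) -/(J 3%:R) /= !exprS expr0 /iC.
by apply: complex_ext; rewrite !(ReD, ImD, ReM, ImM) /=; ring.
Qed.

(** Real test functions suffice: for them the real part of the integral compares the parts 0 and 2
    of [mu], and the imaginary part compares the parts 1 and 3. [measure_eq_on] applies to each
    pair. *)
Lemma cint_on_set0 mu (S : set Cn) : compact S -> S `<=` torus ->
  (forall v, cont_on cdist cdist1 S v -> cint mu (on_set S v) = 0) ->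
  forall E : set BCn, measurable E -> E `<=` S -> cmval mu E = 0.
Proof.
move=> cS ST H E mE ES.
pose J (phi : Cn -> R) k := \int[cm_part mu k]_(x in (torus : set BCn)) (\1_S x * phi x).
have HJ phi : cont_on cdist rdist setT phi ->
    J phi 0 = J phi 2%:R /\ J phi 1 = J phi 3%:R.
  move=> cphi; have : cint mu (on_set S (fun x => (phi x)%:C%C)) = 0.
    apply: H => x _ e e0; have [r r0 rP] := cphi x I e e0; exists r => // y _ xy.
    by rewrite /cdist1 -rmorphB /= cabs_real; exact: rP.
  rewrite /on_set; under eq_fun do rewrite -rmorphM.
  rewrite cint_real -/(J phi 0) -/(J phi 1) -/(J phi 2%:R) -/(J phi 3%:R).
  by move=> [/eqP + /eqP]; rewrite !subr_eq0 => /eqP -> /eqP ->.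
rewrite cmvalE (measure_eq_on cS ST (fun phi cphi => (HJ phi cphi).1))//.
by rewrite (measure_eq_on cS ST (fun phi cphi => (HJ phi cphi).2))// !subrr.
Qed.

Lemma cabs_on_set (S : set Cn) g x :
  cabs (on_set S g x) = \1_S x * cabs (g x).
Proof.
by rewrite /on_set cabsM cabs_real ger0_norm// indicE; case: (_ \in _).
Qed.

Lemma indic01 (S : set Cn) x : 0 <= (\1_S x : R) <= 1.
Proof. by rewrite indicE; case: (_ \in _); rewrite /= ?lexx ?ler01. Qed.

Lemma on_set_split (S : set Cn) g x : g x = on_set S g x + on_set (~` S) g x.
Proof.
rewrite /on_set -mulrDl -rmorphD /= !indicE in_setC.
by case: (_ \in _); rewrite /= ?addr0 ?add0r mul1r.
Qed.

Lemma on_setS (S : set Cn) f g : (forall x, S x -> f x = g x) -> on_set S f = on_set S g.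
Proof.
move=> fg; apply/funext => x; rewrite /on_set indicE.
by have [/set_mem/fg ->|_] := boolP (x \in S); rewrite // !mul0r.
Qed.

Lemma cont_onM (S : set Cn) f g : compact S -> cont_on cdist cdist1 S f ->
  cont_on cdist cdist1 S g -> cont_on cdist cdist1 S (fun x => f x * g x).
Proof.
move=> cS cf cg.
have [A A0 fA] := cont_on_bounded cS cf; have [B B0 gB] := cont_on_bounded cS cg.
move=> x Sx e e0.
have e1 : 0 < e / (A + B + 1) by rewrite divr_gt0// ltr_wpDl// addr_ge0.
have [a a0 aP] := cf _ Sx _ e1; have [b b0 bP] := cg _ Sx _ e1.
exists (Num.min a b); first by rewrite lt_min a0.
move=> y Sy; rewrite lt_min => /andP[xa xb].
rewrite /cdist1 (_ : _ - _ = f x * (g x - g y) + (f x - f y) * g y); last by ring.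
apply: le_lt_trans (cabsD _ _) _; rewrite !cabsM.
apply: (@le_lt_trans _ _ (A * (e / (A + B + 1)) + e / (A + B + 1) * B)).
  apply: lerD; apply: ler_pM; rewrite ?cabs_ge0// ?fA ?gB//.
    exact/ltW/bP.
  exact/ltW/aP.
rewrite mulrC -mulrDr mulrAC ltr_pdivrMr ?ltr_wpDl ?addr_ge0//.
by rewrite ltr_pM2l// ltrDl.
Qed.

Lemma cont_on_conj (S : set Cn) f : cont_on cdist cdist1 S f ->
  cont_on cdist cdist1 S (fun x => (f x)^*%C).
Proof.
move=> cf x Sx e /(cf _ Sx)[r r0 rP]; exists r => // y Sy /(rP _ Sy).
by rewrite /cdist1 -rmorphB cabs_conj.
Qed.

Lemma cont_onX (S : set Cn) f m : compact S -> cont_on cdist cdist1 S f ->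
  cont_on cdist cdist1 S (fun x => f x ^+ m).
Proof.
move=> cS cf; elim: m => [|m IH].
  by move=> x _ e e0; exists 1 => // y _ _; rewrite /cdist1 !expr0 subrr cabs0.
have -> : (fun x => f x ^+ m.+1) = (fun x => f x * f x ^+ m).
  by apply/funext => x; rewrite exprS.
exact: cont_onM.
Qed.

Lemma inA_cont_on (S : set Cn) g : S `<=` torus -> inA g -> cont_on cdist cdist1 S g.
Proof.
by move=> ST /inAP[gc _]; apply: cont_onS gc => z /ST; exact: torus_cpolydisc.
Qed.

Lemma interpolation_setP (X : (Cn -> R[i]) -> Prop) (S : set Cn) :
  interpolation_set X S <-> forall f, cont_on cdist cdist1 S f ->
    exists g, X g /\ forall z, S z -> g z = f z.
Proof.
have H f := within_cont_on S (f : Cn -> R[i]^o) (@cdist_metrizes R n) (@cdist1_metrizes R).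
by split=> h f cf; apply: h; exact/H.
Qed.

Lemma cbm_on_set (S : set Cn) g : measurable (S : set BCn) -> cbm g -> cbm (on_set S g).
Proof. by move=> mS; apply: cbmM; apply: cbm_real; exact: bmeas_indic. Qed.

Lemma cbm_on_set_cont (S : set Cn) f : compact S -> S `<=` torus ->
  cont_on cdist cdist1 S f -> cbm (on_set S f).
Proof.
move=> cS ST cf; have [M _ fM] := cont_on_bounded cS cf.
by apply: (cbm_intro (M := M)) => //; exact: compact_measurable_BCn.
Qed.

Lemma conj_coord_prod z m : torus z ->
  ((coord_prod z)^*%C) ^+ m * coord_prod z ^+ m = 1.
Proof.
move=> Tz; rewrite -exprMn mulrC -sqr_cabs cabs_coord_prod// expr1n.
by rewrite expr1n.
Qed.

Lemma trigR_cont (rho : Cn -> R) : trigR rho -> cont_on cdist rdist torus rho.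
Proof.
move=> [N [h [Ah hE]]].
have cT := @torus_compact R n.
have ch : cont_on cdist cdist1 torus (fun z => ((coord_prod z)^*%C) ^+ N * h z).
  have cP := inA_cont_on (@subset_refl _ torus) (@inA_coord_prod R n).
  exact: (cont_onM cT (cont_onX N cT (cont_on_conj cP))
            (inA_cont_on (@subset_refl _ torus) Ah)).
move=> x Tx e e0; have [r r0 rP] := Re_cont_on ch Tx e0; exists r => // y Ty xy.
have := rP y Ty xy; rewrite /rdist !hE// !mulrA !conj_coord_prod// !mul1r.
by [].
Qed.

Lemma closed_far (S : set Cn) x : closed S -> ~ S x ->
  exists2 eta : R, 0 < eta & forall y, S y -> eta <= sqdist y x.
Proof.
move=> cS nSx; have /closed_openC : closed S by [].
rewrite openE => /(_ x nSx); have [sT _ _ nT] := @cdist_metrizes R n.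
move=> /nT[r r0 rP]; pose eta := (r / n.+1%:R) ^+ 2.
have eta0 : 0 < eta by rewrite exprn_gt0// divr_gt0.
exists eta => // y Sy; rewrite leNgt; apply/negP => lt.
apply: (rP y) => //; rewrite sT; apply: le_lt_trans (cdist_sqdist _ _) _.
have : Num.sqrt (sqdist y x) < r / n.+1%:R.
  by rewrite -[ltRHS]ger0_norm ?divr_ge0 ?ltW// -sqrtr_sqr ltr_sqrt.
move=> lt'; apply: (@le_lt_trans _ _ (n.+1%:R * Num.sqrt (sqdist y x))).
  by rewrite ler_wpM2r ?sqrtr_ge0// ler_nat.
by rewrite mulrC -ltr_pdivlMr.
Qed.

Theorem interpolation_null (S : set Cn) : (0 < n)%N -> compact S -> S `<=` torus ->
  interpolation_set (@inA R n) S -> null_for_perp (@inA0 R n) S.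
Proof.
move=> n0 cS ST /interpolation_setP IS mu muA0.
have mS : measurable (S : set BCn) by exact: compact_measurable_BCn.
have mT := @measurable_torus R n.
apply/(ctotvar_eq0 mu mS); apply: (cint_on_set0 cS ST).
have e0 (m : nat) : 0 < m.+1%:R^-1 :> R by rewrite invr_gt0.
have /choice[rho rhoP] : forall m : nat, exists rho, [/\ trigR rho,
    (forall z, torus z -> 0 <= rho z <= 1),
    (forall z, S z -> 1 - m.+1%:R^-1 <= rho z) &
    (forall z, torus z -> (forall x, S x -> m.+1%:R^-1 <= sqdist x z) ->
      rho z <= m.+1%:R^-1)].
  by move=> m; exact: trig_bump.
have rho01 m z : torus z -> 0 <= rho m z <= 1 by case: (rhoP m) => _ H _ _; exact: H.
have rhoS m z : S z -> 1 - m.+1%:R^-1 <= rho m z by case: (rhoP m) => _ _ H _; exact: H.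
have /choice[N /choice[h hP]] : forall m, exists N h, inA h /\
    forall z, torus z -> h z = coord_prod z ^+ N * (rho m z)%:C%C.
  by move=> m; case: (rhoP m) => [[N [h H]] _ _ _]; exists N, h.
(* The power of [coord_prod] in [h m] makes [rho m] analytic; the one factor more puts [u * W m] in
   [A_0] for every [u] in A. *)
pose W m z := coord_prod z * h m z.
have AW m : inA (W m) by exact: (inAM (@inA_coord_prod R n) (hP m).1).
have WE m z : torus z -> W m z = coord_prod z ^+ (N m).+1 * (rho m z)%:C%C.
  by move=> Tz; rewrite /W (hP m).2// exprS mulrA.
have Wrho m z : torus z -> cabs (W m z) = rho m z.
  move=> Tz; rewrite WE// cabsM cabsX cabs_coord_prod// expr1n mul1r cabs_real.
  by rewrite ger0_norm//; case/andP: (rho01 m _ Tz).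
pose total := 2 * \sum_(k < 4) \int[cm_part mu k]_(x in (torus : set BCn)) (1 : R).
have total0 : 0 <= total.
  by rewrite mulr_ge0// sumr_ge0// => k _; exact: Rintegral_ge0.
have brho m : bmeas (torus : set BCn) (rho m : BCn -> R).
  split; first by apply: cont_on_measurable; apply: trigR_cont; case: (rhoP m).
  by exists 1 => x /(rho01 m) /andP[h1 h2]; rewrite ger0_norm.
have bcS : bmeas (torus : set BCn) (\1_(~` S) : BCn -> R).
  by apply: bmeas_indic; exact: measurableC.
pose delta m := 2 * \sum_(k < 4)
  \int[cm_part mu k]_(x in (torus : set BCn)) (\1_(~` S) x * rho m x).
have delta0 m : 0 <= delta m.
  rewrite mulr_ge0// sumr_ge0// => k _; apply: Rintegral_ge0 => x Tx.
  by rewrite mulr_ge0//; case/andP: (rho01 m _ Tx).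
have delta_cvg : delta @ \oo --> (0 : R).
  have part k : (\int[cm_part mu k]_(x in (torus : set BCn)) (\1_(~` S) x * rho m x))%R
      @[m --> \oo] --> (0 : R).
    rewrite (_ : 0 = \int[cm_part mu k]_(x in (torus : set BCn)) (0 : R)); last first.
      by rewrite Rintegral_cst// mul0r.
    apply: (@bint_dct _ _ _ _ mT _ (fun m x => \1_(~` S) x * rho m x) _ 1).
    - by move=> m; case: (bmeasM bcS (brho m)).
    - exact: bmeas_cst.
    - move=> m x Tx; have /andP[h1 h2] := rho01 m _ Tx.
      by have /andP[h3 h4] := indic01 (~` S) x; rewrite ger0_norm ?mulr_ge0// mulr_ile1.
    - move=> x Tx; have [Sx|nSx] := pselect (S x).
        rewrite (_ : (fun m => _) = (fun=> 0)); first exact: cvg_cst.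
        by apply/funext => m; rewrite indicE memNset ?mul0r//; exact.
      have [eta eta0 etaP] := closed_far (compact_closed (@cdist_hausdorff R n) cS) nSx.
      apply/cvgrPdist_le => e e0'.
      exists (Num.truncn (1 / Num.min e eta)).+1 => // m /= mN.
      have me : m.+1%:R^-1 <= Num.min e eta.
        have me0 : 0 < Num.min e eta by rewrite lt_min e0'.
        rewrite -[leRHS]invrK lef_pV2 ?posrE ?invr_gt0// -[leLHS]mul1r.
        apply/ltW/(lt_le_trans (truncnS_gt _)); rewrite ler_nat.
        exact: leq_trans mN _.
      move: me; rewrite le_min => /andP[me1 me2].
      rewrite sub0r normrN indicE mem_set// mul1r.
      have /andP[h1 _] := rho01 m _ Tx; rewrite ger0_norm//.
      apply: le_trans me1; case: (rhoP m) => _ _ _ H; apply: H => // y Sy.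
      exact: le_trans me2 (etaP _ Sy).
  rewrite /delta; under eq_fun do rewrite !big_ord_recl big_ord0 addr0.
  rewrite (_ : 0 = 2 * (0 + (0 + (0 + 0))) :> R); last by rewrite !addr0 mulr0.
  exact: (cvgM (cvg_cst (2 : R)) (cvgD (part _) (cvgD (part _) (cvgD (part _) (part _))))).
have key m u : inA u -> cint mu (on_set S (fun z => u z * W m z)) =
    - cint mu (on_set (~` S) (fun z => u z * W m z)).
  move=> Au; apply/eqP; rewrite -addr_eq0 -cintD.
  - have -> : (fun x => on_set S (fun z => u z * W m z) x + on_set (~` S) (fun z => u z * W m z) x)
        = (fun z => u z * W m z).
      by apply/funext => x; rewrite -on_set_split.
    apply/eqP/muA0; exists (fun z => u z * h m z); split.
      exact: (inAM Au (hP m).1).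
    by move=> z _; rewrite /W mulrCA.
  - by apply: cbm_on_set => //; exact: (inA_cbm (inAM Au (AW m))).
  - by apply: cbm_on_set; [exact: measurableC|exact: (inA_cbm (inAM Au (AW m)))].
have cfW m f : cont_on cdist cdist1 S f -> cont_on cdist cdist1 S (fun z => f z * W m z).
  by move=> cf; exact: (cont_onM cS cf (inA_cont_on ST (AW m))).
(* [delta m] may be 0. The added [m.+1%:R^-1] makes the sum positive and still tends to 0. *)
pose c m : R := (delta m + m.+1%:R^-1)^-1.
have c0 m : 0 < c m by rewrite invr_gt0 ltr_wpDl.
pose L m f := (c m)%:C%C * cint mu (on_set S (fun z => f z * W m z)).
have [C CP] : exists C : R, forall m f, cont_on cdist cdist1 S f ->
    (forall x, S x -> cabs (f x) <= 1) -> cabs (L m f) <= C.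
  apply: (@uniform_boundedness _ _ cdist S L (fun m => c m * total)).
  - move=> m f g cf cg; rewrite /L -mulrDr -cintD; first congr (_ * cint mu _).
    + by apply/funext => x; rewrite /on_set; ring.
    + exact: cbm_on_set_cont (cfW _ _ cf).
    + exact: cbm_on_set_cont (cfW _ _ cg).
  - move=> m a f cf; rewrite /L [RHS]mulrCA -(@cintZ R n mu _ a); first congr (_ * cint mu _).
    + by apply/funext => x; rewrite /on_set; ring.
    + exact: cbm_on_set_cont (cfW _ _ cf).
  - move=> m f M cf M0 fM; rewrite /L cabsM cabs_real ger0_norm ?(ltW (c0 m))//.
    rewrite -mulrA ler_pM2l//.
    apply: (@le_trans _ _ (2 * \sum_(k < 4) \int[cm_part mu k]_(x in (torus : set BCn)) (M * 1))).
      apply: cint_bound; first exact: cbm_on_set_cont (cfW _ _ cf).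
        exact: bmeas_cst.
      move=> x Tx; rewrite cabs_on_set mulr1 indicE.
      have [/set_mem Sx|_] := boolP (x \in S); last by rewrite mul0r.
      rewrite mul1r cabsM Wrho// -[leRHS]mulr1.
      have /andP[h1 h2] := rho01 m _ Tx.
      by apply: ler_pM => //; [exact: cabs_ge0|exact: fM].
    rewrite /total -mulrA mulr_suml; apply/ler_wpM2l => //; apply: ler_sum => k _.
    rewrite (bintZ mT); last exact: bmeas_cst.
    by rewrite mulrC.
  (* Here interpolation is used: [f] and its interpolant [u] have the same integral against [W m]
     over [S], and [key] moves it to the complement, where the integrand is at most [M * rho m]. The
     bound [M] of [u] does not depend on [m]. *)
  - move=> f cf; have [u [Au uf]] := IS _ cf; have [M M0 uM] := inA_bounded Au.
    exists M => m; rewrite /L cabsM cabs_real ger0_norm ?(ltW (c0 m))//.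
    have -> : on_set S (fun z => f z * W m z) = on_set S (fun z => u z * W m z).
      by apply: on_setS => x Sx; rewrite uf.
    rewrite key// cabsN mulrC ler_pdivrMr ?ltr_wpDl//.
    apply: (@le_trans _ _ (2 * \sum_(k < 4) \int[cm_part mu k]_(x in (torus : set BCn))
        (M * (\1_(~` S) x * rho m x)))).
      apply: cint_bound.
      + by apply: cbm_on_set; [exact: measurableC|exact: (inA_cbm (inAM Au (AW m)))].
      + by apply: bmeasM; [exact: bmeas_cst|exact: bmeasM].
      move=> x Tx; rewrite cabs_on_set cabsM Wrho// mulrCA.
      have /andP[h1 h2] := rho01 m _ Tx; have /andP[h3 h4] := indic01 (~` S) x.
      rewrite ler_wpM2r ?mulr_ge0 ?uM//.
      exact: torus_cpolydisc.
    under eq_bigr => k _.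
      rewrite (bintZ mT); last exact: (bmeasM bcS (brho m)).
      over.
    rewrite -mulr_sumr mulrCA ler_wpM2l// lerDl; exact: ltW.
move=> v cv; apply: cabs_eq0; apply/eqP; rewrite eq_le cabs_ge0 andbT.
have [M0 M00 vM0] := cont_on_bounded cS cv.
pose M := M0 + 1; have M1 : 0 < M by rewrite ltr_wpDl.
have vM x : S x -> cabs (v x) <= M.
  by move=> /vM0 /le_trans; apply; rewrite lerDl.
(* [v] is split into [v * rho m] and [v * (1 - rho m)]. The first is [M] times [f * W m], for a
   function [f] of size at most 1 that undoes the unimodular power in [W m]; the second is at most
   [M / m.+1] on [S]. *)
have bound m : cabs (cint mu (on_set S v)) <=
    M * C * (delta m + m.+1%:R^-1) + M * total * m.+1%:R^-1.
  pose w z := (rho m z)%:C%C.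
  have cw : cont_on cdist cdist1 S w.
    move=> x Sx e e0'; have crho : cont_on cdist rdist torus (rho m).
      by apply: trigR_cont; case: (rhoP m).
    have [r r0 rP] := crho _ (ST _ Sx) _ e0'; exists r => // y Sy xy.
    by rewrite /cdist1 /w -rmorphB /= cabs_real; apply: rP => //; exact: ST.
  have cvw := cont_onM cS cv cw.
  have cvw' : cont_on cdist cdist1 S (fun z => v z * (1 - w z)).
    move=> x Sx e e0'; have [a a0 aP] := cv _ Sx _ (divr_gt0 e0' (ltr0n _ 2)).
    have [b b0 bP] := cvw _ Sx _ (divr_gt0 e0' (ltr0n _ 2)).
    exists (Num.min a b); first by rewrite lt_min a0.
    move=> y Sy; rewrite lt_min => /andP[xa xb].
    rewrite /cdist1 (_ : _ - _ = (v x - v y) - (v x * w x - v y * w y)); last by ring.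
    apply: le_lt_trans (cabsB _ _) _; rewrite [e]splitr ltrD//; [exact: aP|exact: bP].
  have -> : cint mu (on_set S v) =
     cint mu (on_set S (fun z => v z * w z)) + cint mu (on_set S (fun z => v z * (1 - w z))).
    rewrite -cintD; first congr (cint mu _).
    - by apply/funext => x; rewrite /on_set; ring.
    - exact: cbm_on_set_cont cvw.
    - exact: cbm_on_set_cont cvw'.
  apply: le_trans (cabsD _ _) _; apply: lerD.
    pose f z := (M^-1)%:C%C * (((coord_prod z)^*%C) ^+ (N m).+1 * v z).
    have cf : cont_on cdist cdist1 S f.
      have cP := inA_cont_on ST (@inA_coord_prod R n).
      have cc : cont_on cdist cdist1 S (fun=> (M^-1)%:C%C : R[i]).
        exact: inA_cont_on ST (@inA_cst R n _).
      exact: (cont_onM cS cc (cont_onM cS (cont_onX _ cS (cont_on_conj cP)) cv)).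
    have Mn : cabs (M^-1)%:C%C = M^-1 by rewrite cabs_real ger0_norm// invr_ge0 ltW.
    have f1 x : S x -> cabs (f x) <= 1.
      move=> Sx; rewrite /f !cabsM Mn cabsX cabs_conj cabs_coord_prod; last exact: ST.
      by rewrite expr1n mul1r mulrC ler_pdivrMr// mul1r vM.
    have := CP m f cf f1; rewrite /L.
    have -> : on_set S (fun z => f z * W m z) = on_set S (fun z => (M^-1)%:C%C * (v z * w z)).
      apply: on_setS => x Sx; have Tx := ST _ Sx; rewrite WE// /f /w.
      have := conj_coord_prod (N m).+1 Tx.
      set a := _ ^+ _; set b := _ ^+ _ => ab1.
      by rewrite -[RHS]mul1r -ab1; ring.
    have -> : on_set S (fun z => (M^-1)%:C%C * (v z * w z)) =
        (fun z => (M^-1)%:C%C * on_set S (fun z => v z * w z) z).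
      by apply/funext => x; rewrite /on_set; ring.
    rewrite cintZ; last exact: cbm_on_set_cont cvw.
    rewrite !cabsM Mn cabs_real ger0_norm ?(ltW (c0 m))// /c.
    set X := cabs (cint mu _); set D := delta m + _ => H.
    have D0 : 0 < D by rewrite ltr_wpDl.
    have -> : X = M * D * (D^-1 * (M^-1 * X)) by field; rewrite !gt_eqF.
    by rewrite [leRHS]mulrAC; apply: ler_wpM2l => //; rewrite mulr_ge0 // ltW.
  apply: (@le_trans _ _ (2 * \sum_(k < 4) \int[cm_part mu k]_(x in (torus : set BCn))
      (M * m.+1%:R^-1 * 1))).
    apply: cint_bound; first exact: cbm_on_set_cont cvw'.
      by apply: bmeas_cst.
    move=> x Tx; rewrite cabs_on_set mulr1 indicE.
    have [/set_mem Sx|_] := boolP (x \in S); last by rewrite mul0r mulr_ge0// ltW.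
    rewrite mul1r cabsM; apply: ler_pM; rewrite ?cabs_ge0 ?vM//.
    rewrite /w -[1]/((1 : R)%:C%C) -rmorphB /= cabs_real.
    have /andP[h1 h2] := rho01 m _ Tx; have := rhoS m _ Sx.
    by rewrite ger0_norm ?subr_ge0// lerBlDr addrC -lerBlDr.
  under eq_bigr => k _.
    rewrite (bintZ mT); last exact: bmeas_cst.
    over.
  by rewrite -mulr_sumr /total le_eqVlt; apply/orP; left; apply/eqP; ring.
apply/ler_addgt0Pr => e e0'; rewrite add0r.
have lim : (fun m => M * C * (delta m + m.+1%:R^-1) + M * total * m.+1%:R^-1)
    @ \oo --> (M * C * (0 + 0) + M * total * 0 : R).
  have inv0 := @cvg_harmonic R.
  exact: (cvgD (cvgM (cvg_cst (M * C)) (cvgD delta_cvg inv0)) (cvgM (cvg_cst (M * total)) inv0)).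
rewrite addr0 !mulr0 addr0 in lim.
have /cvgrPdist_le/(_ _ e0')[k _ /(_ k (leqnn _))] := lim.
rewrite sub0r normrN => /(le_trans (ler_norm _)); apply: le_trans.
exact: bound.
Qed.

End InterpolationNull.

(** * Hahn-Banach and Riesz representation *)

Section HahnBanach.
Context {R : realType} {V : lmodType R}.
Variables (B : V -> Prop) (p : V -> R).
Hypothesis (B_lin : forall t u v, B u -> B v -> B (t *: u + v)).
Hypothesis (p_sub : forall u v, B u -> B v -> p (u + v) <= p u + p v).
Hypothesis (p_hom : forall t u, 0 < t -> B u -> p (t *: u) = t * p u).

(* A partial linear functional is represented by its graph; domination by [p]
   makes the graph single-valued. *)
Definition dominated_graph (G : set (V * R)) :=
  (forall t u v, G u -> G v -> G (t *: u.1 + v.1, t * u.2 + v.2)) /\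
  (forall u, G u -> B u.1 /\ u.2 <= p u.1).

Lemma dominating_at0 : B 0 -> p 0 = 0.
Proof.
move=> B0; have := p_hom (ltr0n R 2 : 0 < 2) B0; rewrite scaler0.
by move=> h; lra.
Qed.

Lemma dominated_graph_inj (G : set (V * R)) v r s : dominated_graph G ->
  G (v, r) -> G (v, s) -> r = s.
Proof.
move=> dG Gr Gs; have [Gl Gp] := dG.
have le_ a b : G (v, a) -> G (v, b) -> a <= b.
  move=> Ga Gb; have := Gl (-1) _ _ Gb Ga => /=.
  rewrite scaleN1r addNr mulN1r => /Gp[/= B0].
  by rewrite dominating_at0// addrC subr_le0.
by apply/eqP; rewrite eq_le !le_.
Qed.

(** By subadditivity each [u.2 - p (u.1 - v0)] is at most each [p (v.1 + v0) - v.2]. Any number in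
    between is an admissible value at [v0]; the supremum of the former is taken. *)
Lemma dominated_graph_extend (G : set (V * R)) v0 : dominated_graph G -> G (0, 0) ->
  B v0 -> exists H, [/\ dominated_graph H, G `<=` H & exists r, H (v0, r)].
Proof.
move=> dG G0 Bv0; have [Gl Gp] := dG.
have Bm u : B u -> B (u - v0).
  by move=> Bu; rewrite addrC -scaleN1r; exact: B_lin.
have Ba u : B u -> B (u + v0).
  by move=> Bu; rewrite -[u]scale1r; exact: B_lin.
have cross u v : G u -> G v -> u.2 - p (u.1 - v0) <= p (v.1 + v0) - v.2.
  move=> Gu Gv; rewrite lerBlDr addrAC lerBrDr.
  have := Gl 1 _ _ Gu Gv => /Gp /= [_]; rewrite scale1r mul1r.
  have -> : u.1 + v.1 = (v.1 + v0) + (u.1 - v0).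
    by rewrite addrACA subrr addr0 addrC.
  move=> /le_trans; apply; apply: p_sub; first by apply: Ba; case: (Gp _ Gv).
  by apply: Bm; case: (Gp _ Gu).
pose A := [set a | exists2 u, G u & a = u.2 - p (u.1 - v0)].
have A0 : A !=set0 by exists (0 - p (0 - v0)), (0, 0).
have Aub u : G u -> ubound A (p (u.1 + v0) - u.2).
  by move=> Gu _ [v Gv ->]; exact: cross.
pose r0 := sup A.
have r0_ge u : G u -> u.2 - p (u.1 - v0) <= r0.
  move=> Gu; apply: ub_le_sup; last by exists u.
  by exists (p (0 + v0) - 0); exact: (Aub (0, 0)).
have r0_le u : G u -> r0 <= p (u.1 + v0) - u.2.
  by move=> Gu; apply: ge_sup => //; exact: Aub.
have GZ t u : G u -> G (t *: u.1, t * u.2).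
  by move=> Gu; have := Gl t _ _ Gu G0; rewrite /= !addr0.
pose H := [set u | exists2 v, G v & exists t, u = (v.1 + t *: v0, v.2 + t * r0)].
exists H; split.
- split.
    move=> t _ _ [u Gu [a ->]] [v Gv [b ->]] /=.
    exists (t *: u.1 + v.1, t * u.2 + v.2); first exact: Gl.
    exists (t * a + b) => /=; congr (_, _).
      by rewrite scalerDr scalerA scalerDl addrACA.
    by ring.
  move=> _ [u Gu [t ->]] /=; have [Bu up] := Gp _ Gu; split.
    by rewrite addrC; exact: B_lin.
  have [t0|t0|->] := ltgtP t 0; last by rewrite mul0r scale0r !addr0.
  - have s0 : 0 < - t by rewrite oppr_gt0.
    have := r0_ge _ (GZ ((- t)^-1) _ Gu) => /=.
    have -> : u.1 + t *: v0 = - t *: ((- t)^-1 *: u.1 - v0).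
      by rewrite scalerBr scalerA divff ?gt_eqF// scale1r scaleNr opprK.
    rewrite p_hom//; last first.
      by apply: Bm; have [] := Gp _ (GZ ((- t)^-1) _ Gu).
    set q := p _ => h.
    have : - t * ((- t)^-1 * u.2 - q) <= - t * r0 by rewrite ler_pM2l.
    rewrite mulrBr mulrA divff ?gt_eqF// mul1r; lra.
  - have := r0_le _ (GZ (t^-1) _ Gu) => /=.
    have -> : u.1 + t *: v0 = t *: (t^-1 *: u.1 + v0).
      by rewrite scalerDr scalerA divff ?gt_eqF// scale1r.
    rewrite p_hom//; last first.
      by apply: Ba; have [] := Gp _ (GZ (t^-1) _ Gu).
    set q := p _ => h.
    have : t * r0 <= t * (q - t^-1 * u.2) by rewrite ler_pM2l.
    rewrite mulrBr mulrA divff ?gt_eqF// mul1r; lra.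
- move=> u Gu; exists u => //; exists 0.
  by rewrite scale0r mul0r !addr0; case: u Gu.
- exists r0, (0, 0) => //; exists 1 => /=.
  by rewrite scale1r mul1r !add0r.
Qed.

Theorem hahn_banach (G0 : set (V * R)) : dominated_graph G0 -> G0 (0, 0) ->
  exists f : V -> R,
    [/\ forall t u v, B u -> B v -> f (t *: u + v) = t * f u + f v,
        forall v, B v -> f v <= p v &
        forall u, G0 u -> f u.1 = u.2].
Proof.
move=> dG0 G00.
have [A [dA Amax]] : exists A, dominated_graph (A `|` G0) /\
    forall A', A `<` A' -> ~ dominated_graph (A' `|` G0).
  (* Zorn's lemma is applied to the sets whose union with [G0] is dominated, rather than to those
     containing [G0], because the union of the empty chain is [set0]. *)
  apply: (@Zorn_bigcup _ (fun A => dominated_graph (A `|` G0))) => F FP Ftot.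
  have inX u v : (\bigcup_(X in F) X `|` G0) u -> (\bigcup_(X in F) X `|` G0) v ->
      exists Y, [/\ Y = G0 \/ exists2 X, F X & Y = X `|` G0, Y u & Y v].
    move=> [[X FX Xu]|Gu] [[Y FY Yv]|Gv].
    - have [XY|YX] := Ftot _ _ FX FY.
        exists (Y `|` G0); split; [by right; exists Y|left; exact: XY|by left].
      exists (X `|` G0); split; [by right; exists X|by left|left; exact: YX].
    - by exists (X `|` G0); split; [right; exists X|left|right].
    - by exists (Y `|` G0); split; [right; exists Y|right|left].
    - by exists G0; split => //; left.
  split.
    move=> t u v hu hv; have [Y [YE Yu Yv]] := inX u v hu hv.
    case: YE => [YE|[X FX YE]]; rewrite YE in Yu Yv.
      by right; case: dG0 => h _; exact: h.
    have [h _] := FP _ FX; case: (h t u v Yu Yv) => [Xw|Gw]; last by right.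
    by left; exists X.
  move=> u hu; have [Y [YE Yu _]] := inX u u hu hu.
  case: YE => [YE|[X FX YE]]; rewrite YE in Yu.
    by case: dG0 => _ h; exact: h.
  by have [_ h] := FP _ FX; exact: h.
set G := A `|` G0 in dA.
have G_0 : G (0, 0) by right.
have total v : B v -> exists r, G (v, r).
  move=> Bv; have [H [dH GH [r Hr]]] := dominated_graph_extend dA G_0 Bv.
  exists r; apply: contrapT => nG.
  apply: (Amax H); last first.
    by rewrite (_ : H `|` G0 = H)//; apply/setUidPl => u Gu; apply: GH; right.
  split; first by move=> u Au; apply: GH; left.
  by move=> AH; exact: (nG (or_introl (AH _ Hr))).
have /choice[f fP] : forall v, exists r, B v -> G (v, r).
  by move=> v; have [/total[r Gr]|nB] := pselect (B v); [exists r|exists 0].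
exists f; split.
- move=> t u v Bu Bv; apply: (dominated_graph_inj dA) (fP _ _) _; first exact: B_lin.
  by have [h _] := dA; have := h t _ _ (fP _ Bu) (fP _ Bv).
- by move=> v Bv; have [_ h] := dA; have [] := h _ (fP _ Bv).
- move=> u Gu; have [_ h] := dG0; have [Bu _] := h _ Gu.
  apply: (dominated_graph_inj dA) (fP _ Bu) _; right.
  by case: u Gu {Bu}.
Qed.

End HahnBanach.

(** * Positive functionals and the coding of a compact set by an interval *)

Section PositiveFunctional.
Context {R : realType} {T : Type}.
Variable K : set T.
Implicit Types (f g : T -> R) (E A : set T).

Definition bounded_on f := exists M : R, forall x, K x -> `|f x| <= M.

(** Taking all bounded functions gives indicators a value, so that [mass] is finitely additive on
    all subsets. *)
Definition positive_functional (Lam : (T -> R) -> R) :=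
  [/\ forall f g, bounded_on f -> bounded_on g ->
        Lam (fun x => f x + g x) = Lam f + Lam g,
      forall c f, bounded_on f -> Lam (fun x => c * f x) = c * Lam f &
      forall f, bounded_on f -> (forall x, K x -> 0 <= f x) -> 0 <= Lam f].

Lemma bounded_onD f g : bounded_on f -> bounded_on g -> bounded_on (fun x => f x + g x).
Proof.
move=> [M fM] [N gN]; exists (M + N) => x Kx.
by apply: le_trans (ler_normD _ _) _; apply: lerD; [exact: fM|exact: gN].
Qed.

Lemma bounded_onM f g : bounded_on f -> bounded_on g -> bounded_on (fun x => f x * g x).
Proof.
move=> [M fM] [N gN]; exists (M * N) => x Kx.
by rewrite normrM; apply: ler_pM => //; [exact: fM|exact: gN].
Qed.

Lemma bounded_on_cst c : bounded_on (fun=> c).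
Proof. by exists `|c|. Qed.

Lemma bounded_on_indic E : bounded_on (\1_E : T -> R).
Proof.
by exists 1 => x _; rewrite indicE; case: (_ \in _); rewrite ?normr1 ?normr0.
Qed.

Variables (Lam : (T -> R) -> R) (pLam : positive_functional Lam).
Hypothesis K0 : K !=set0.

Lemma functional_le f g : bounded_on f -> bounded_on g ->
  (forall x, K x -> f x <= g x) -> Lam f <= Lam g.
Proof.
move=> bf bg fg; have [LD LZ Lp] := pLam.
have bN : bounded_on (fun x => -1 * f x) by exact: (bounded_onM (bounded_on_cst _) bf).
have := Lp _ (bounded_onD bg bN); rewrite LD// LZ// mulN1r subr_ge0; apply.
by move=> x /fg; rewrite mulN1r subr_ge0.
Qed.

Lemma functional_ext f g : bounded_on f -> bounded_on g ->
  (forall x, K x -> f x = g x) -> Lam f = Lam g.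
Proof.
move=> bf bg fg; apply/eqP; rewrite eq_le !functional_le// => x /fg -> //.
Qed.

Definition mass E := Lam (\1_E : T -> R).

Lemma mass_ge0 E : 0 <= mass E.
Proof.
have [_ _ Lp] := pLam; apply: Lp; first exact: bounded_on_indic.
by move=> x _; rewrite indicE.
Qed.

Lemma indic_split E A x : (\1_E x : R) = \1_(E `&` A) x + \1_(E `\` A) x.
Proof.
rewrite !indicE in_setI in_setD.
by case: (x \in E); case: (x \in A); rewrite /= ?addr0 ?add0r.
Qed.

Lemma mass_split E A : mass E = mass (E `&` A) + mass (E `\` A).
Proof.
have [LD _ _] := pLam; rewrite /mass -LD; try exact: bounded_on_indic.
by congr Lam; apply/funext => x; exact: indic_split.
Qed.

Lemma mass_gt0 E : 0 < mass E -> exists x, E x /\ K x.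
Proof.
move=> m0; apply: contrapT => nE; have [_ LZ _] := pLam.
suff : mass E <= 0 by rewrite leNgt m0.
have -> : 0 = Lam (fun x => 0 * 0) by rewrite LZ ?mul0r//; exact: bounded_on_cst.
apply: functional_le; [exact: bounded_on_indic|exact: bounded_on_cst|].
move=> x Kx; rewrite indicE memNset ?mulr0// => Ex.
by apply: nE; exists x.
Qed.

Variable U : nat -> set T.

(* [[a, a + mass E[] is cut successively into subintervals whose lengths are the
   masses of the cells of [E] generated by [U j], [U j.+1], ...; [run k j a E t]
   is the cell attached to [t] after [k] cuts. *)
Fixpoint run (k j : nat) (a : R) (E : set T) (t : R) : set T :=
  if k is k'.+1 then
    let c := a + mass (E `&` U j) in
    if t < c then run k' j.+1 a (E `&` U j) t else run k' j.+1 c (E `\` U j) t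
  else E.

Lemma run_sub k j a E t : run k j a E t `<=` E.
Proof.
elim: k j a E => [|k IH] j a E //=.
by case: ifP => _ x /IH[].
Qed.

Lemma run_nested k j a E t : run k.+1 j a E t `<=` run k j a E t.
Proof.
elim: k j a E => [|k IH] j a E; first exact: run_sub.
by rewrite /= -/(run k.+1); case: ifP => _; exact: IH.
Qed.

Lemma run_le k k' j a E t : (k <= k')%N -> run k' j a E t `<=` run k j a E t.
Proof.
move/subnK <-; elim: (k' - k)%N => [|i IH] //.
by rewrite addSn => x /run_nested /IH.
Qed.

Lemma run_nonempty k j a E t : a <= t < a + mass E ->
  exists x, run k j a E t x /\ K x.
Proof.
elim: k j a E => [|k IH] j a E.
  move=> /andP[h1 h2]; apply: mass_gt0.
  by move: h1 h2; clear; lra.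
rewrite (mass_split E (U j)) addrA => /andP[at_ ta] /=.
by case: ltP => tc; apply: IH; rewrite ?at_ ?tc.
Qed.

Lemma run_agree k j a E t x y i : run k j a E t x -> run k j a E t y ->
  (i < k)%N -> U (j + i) x <-> U (j + i) y.
Proof.
elim: k j a E i => // k IH j a E [|i] /=; rewrite ?addn0 => + + ik.
  by case: ifP => _ /run_sub[_ h1] /run_sub[_ h2].
by rewrite -addSnnS; case: ifP => _ h1 h2; apply: (IH _ _ _ _ h1 h2).
Qed.

(** As a function of [t] a run takes finitely many values, constant on intervals; hence an arbitrary
    [P]. *)
Lemma measurable_run k j a E (P : set T -> Prop) :
  @measurable _ (measurableTypeR R) [set t | P (run k j a E t)].
Proof.
elim: k j a E => [|k IH] j a E /=.
  have [h|h] := pselect (P E).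
    by rewrite (_ : [set _ | _] = setT)//; apply/seteqP; split.
  by rewrite (_ : [set _ | _] = set0)//; apply/seteqP; split.
set c := a + _.
rewrite (_ : [set _ | _] =
  (`]-oo, c[%classic `&` [set t | P (run k j.+1 a (E `&` U j) t)]) `|`
  (`[c, +oo[%classic `&` [set t | P (run k j.+1 c (E `\` U j) t)])).
  by apply: measurableU; apply: measurableI => //.
apply/seteqP; split => t /=; rewrite !in_itv /= andbT.
  by case: ltP => tc h; [left|right].
by case: ltP => tc [[? h]|[? h]].
Qed.

Variables (la : {finite_measure set (measurableTypeR R) -> \bar R}) (M : R).
Hypothesis laE : forall a b, 0 <= a -> a <= b -> b <= M -> la `[a, b[%classic = (b - a)%:E.

Let ind (a b : R) : R -> R := \1_(`[a, b[%classic).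

Let mI (a b : R) : measurable (`[a, b[%classic : set (measurableTypeR R)). Proof. by []. Qed.

Lemma itv_indic_split a c b t : a <= c -> c <= b -> ind a b t = ind a c t + ind c b t.
Proof.
move=> ac cb; rewrite /ind !indicE !mem_setE !in_itv /=.
case: (ltP t c) => tc.
  by rewrite (lt_le_trans tc cb) /= addr0.
by rewrite (le_trans ac tc) andbF add0r.
Qed.

Lemma run_integral k j a E (g : R -> R) (h : T -> R) (e : R) :
  0 <= a -> a + mass E <= M -> bmeas (setT : set (measurableTypeR R)) g -> bounded_on h ->
  (forall t x, a <= t < a + mass E -> run k j a E t x -> K x -> `|g t - h x| <= e) ->
  `|\int[la]_(t in setT) (ind a (a + mass E) t * g t) - Lam (fun x => \1_E x * h x)|
    <= e * mass E.
Proof.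
move=> a0 aM bg bh; have [LD LZ Lp] := pLam.
elim: k j a E a0 aM => [|k IH] j a E a0 aM H; last first.
  set A := E `&` U j; set B := E `\` U j; set c := a + mass A.
  have mE : mass E = mass A + mass B by exact: mass_split.
  have bE : a + mass E = c + mass B by rewrite mE addrA.
  have ac : a <= c by rewrite lerDl mass_ge0.
  have cb : c <= c + mass B by rewrite lerDl mass_ge0.
  have h1 : `|\int[la]_(t in setT) (ind a c t * g t) - Lam (fun x => \1_A x * h x)| <= e * mass A.
    apply: (IH j.+1) => //; first by apply: le_trans aM; rewrite bE.
    move=> t x /andP[ta tc] rx Kx; apply: H => //; last by rewrite /= tc.
    by rewrite ta bE (lt_le_trans tc).
  have h2 : `|\int[la]_(t in setT) (ind c (c + mass B) t * g t) - Lam (fun x => \1_B x * h x)| <= e * mass B.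
    apply: (IH j.+1) => //; [exact: le_trans ac|by rewrite -bE|].
    move=> t x /andP[tc tb] rx Kx; apply: H => //; last by rewrite /= ltNge tc.
    by rewrite (le_trans ac tc) bE.
  rewrite bE mE mulrDr; set I := \int[la]_(t in _) _; set L := Lam _.
  have -> : I = \int[la]_(t in setT) (ind a c t * g t) + \int[la]_(t in setT) (ind c (c + mass B) t * g t).
    rewrite -bintD//; try by apply: bmeasM => //; exact: bmeas_indic.
    by apply: eq_Rintegral => t _; rewrite (itv_indic_split _ ac cb) mulrDl.
  have -> : L = Lam (fun x => \1_A x * h x) + Lam (fun x => \1_B x * h x).
    rewrite -LD; try by apply: bounded_onM => //; exact: bounded_on_indic.
    by congr Lam; apply/funext => x; rewrite (indic_split E (U j)) mulrDl.
  apply: le_trans (lerD h1 h2); apply: le_trans (ler_normD _ _).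
  by rewrite le_eqVlt; apply/orP; left; apply/eqP; congr `|_|; ring.
set I := \int[la]_(t in _) _; set L := Lam _.
have bI : bmeas (setT : set (measurableTypeR R)) (ind a (a + mass E)) by exact: bmeas_indic.
have II : \int[la]_(t in setT) ind a (a + mass E) t = mass E.
  rewrite /Rintegral integral_indic// setIT.
  rewrite [X in fine X](_ : _ = (a + mass E - a)%:E); last by apply: laE => //; rewrite lerDl mass_ge0.
  by rewrite /= addrC addKr.
have bEi : bounded_on (\1_E : T -> R) by exact: bounded_on_indic.
have bcI c : bmeas (setT : set (measurableTypeR R)) (fun t => c * ind a (a + mass E) t) by exact: (bmeasM (bmeas_cst _ _) bI).
have bcE c : bounded_on (fun x => c * (\1_E x : R)) by exact: (bounded_onM (bounded_on_cst _) bEi).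
have bLE : bounded_on (fun x => \1_E x * h x) by exact: bounded_onM.
have key x : E x -> K x -> `|I - h x * mass E| <= e * mass E.
  move=> Ex Kx; rewrite ler_distl -mulrBl -mulrDl; apply/andP; split; rewrite -{1}II -bintZ//;
    apply: bint_le => //; try exact: (bmeasM bI bg).
    move=> t _; rewrite /ind indicE mem_setE in_itv /=.
    case: (boolP (_ && _)) => ht; rewrite ?mulr0 ?mul0r// mulr1 mul1r.
    by have := H t x ht Ex Kx; rewrite ler_distl => /andP[].
  move=> t _; rewrite /ind indicE mem_setE in_itv /=.
  case: (boolP (_ && _)) => ht; rewrite ?mulr0 ?mul0r// mulr1 mul1r.
  by have := H t x ht Ex Kx; rewrite ler_distl => /andP[].
have [N hN] := bh.
have [m0|m0] := leP (mass E) 0.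
  have mE0 : mass E = 0 by apply/eqP; rewrite eq_le m0 mass_ge0.
  have L0 : L = 0.
    have l1 : L <= N * mass E.
      rewrite /mass -LZ//; apply: functional_le => // x Kx.
      rewrite indicE; case: (_ \in _); rewrite ?mul0r ?mulr0// mul1r mulr1.
      by have := hN x Kx; rewrite ler_norml => /andP[].
    have l2 : - N * mass E <= L.
      rewrite /mass -LZ//; apply: functional_le => // x Kx.
      rewrite indicE; case: (_ \in _); rewrite ?mul0r ?mulr0// mul1r mulr1.
      by have := hN x Kx; rewrite ler_norml => /andP[].
    by apply/eqP; rewrite eq_le; move: l1 l2; rewrite mE0 !mulr0 => -> ->.
  have I0 : I = 0.
    rewrite /I mE0 addr0 (_ : (fun t => _) = (fun t => 0 * g t)).
      by rewrite bintZ ?mul0r//.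
    by apply/funext => t; rewrite /ind set_itvco0// indic0.
  by rewrite I0 L0 mE0 mulr0 subrr normr0.
(* The mean of [g] over the interval is a constant within [e] of [h] on the whole cell, which
   positivity of [Lam] turns into the estimate. Mass 0, where there is no mean, was settled just
   above. *)
have q x : E x -> K x -> `|I / mass E - h x| <= e.
  move=> Ex Kx; rewrite -(ler_pM2r m0); apply: le_trans (key x Ex Kx).
  rewrite -{2}(gtr0_norm m0) -normrM mulrBl divfK ?gt_eqF//.
have -> : I = I / mass E * mass E by rewrite divfK ?gt_eqF.
rewrite ler_distlC; set r := I / mass E.
rewrite -mulrBl -mulrDl; apply/andP; split; rewrite /mass -LZ//;
  apply: functional_le => // x Kx; rewrite indicE; case: (boolP (x \in E)) => Ex;
  rewrite ?mul0r ?mulr0// mul1r mulr1;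
  by have := q x (set_mem Ex) Kx; rewrite ler_distlC => /andP[].
Qed.

End PositiveFunctional.

Section SplittingSets.
Context {R : realType} {n : nat}.
Notation Cn := 'rV[R[i]^o]_n.
Variables (K : set Cn) (cK : compact K).

Lemma totally_bounded (r : R) : 0 < r ->
  exists s : seq Cn, forall x, K x -> exists2 y, y \in s & cdist y x < r.
Proof.
move=> r0; have [sT tT d0 nT] := @cdist_metrizes R n.
have := cK; rewrite compact_cover => /(_ Cn setT (fun y => [set x | cdist y x < r])).
case=> [y _||D _ KD].
- rewrite openE => x /= yx; apply/nT; exists (r - cdist y x); first by rewrite subr_gt0.
  by move=> z xz /=; apply: le_lt_trans (tT _ x _) _; rewrite addrC -ltrBrDr.
- by move=> x _; exists x => //=; rewrite d0.
- exists (finmap.enum_fset D) => x /KD[y yD yx]; by exists y.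
Qed.

(** For each [m], finitely many balls of radius [m.+1%:R^-1] cover [K]; [pickle] lists them all in
    one sequence. Once [k] exceeds the codes of the balls of level [m], two points agreeing on the
    first [k] sets share a ball of that level. *)
Lemma splitting_sets : exists U : nat -> set Cn, forall e : R, 0 < e ->
  exists k, forall x y, K x -> K y -> (forall i, (i < k)%N -> U i x <-> U i y) ->
    cdist x y < e.
Proof.
have [sT tT d0 nT] := @cdist_metrizes R n.
have /choice[s sP] : forall m : nat, exists s : seq Cn, forall x, K x ->
    exists2 y, y \in s & cdist y x < m.+1%:R^-1.
  by move=> m; apply: totally_bounded; rewrite invr_gt0.
exists (fun i => if unpickle i is Some (m, l) then
  [set x | cdist (nth 0 (s m) l) x < m.+1%:R^-1] else set0).
move=> e e0; have e20 : 0 < e / 2 by rewrite divr_gt0.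
have [m me] : exists m : nat, m.+1%:R^-1 < e / 2.
  exists (Num.truncn (e / 2)^-1); rewrite invf_plt ?posrE//.
  exact: truncnS_gt.
exists (\max_(l < size (s m)) pickle (m, l : nat)).+1 => x y Kx Ky xy.
have [z zs zx] := sP m x Kx.
have ls : (index z (s m) < size (s m))%N by rewrite index_mem.
have := xy (pickle (m, index z (s m))).
rewrite pickleK nth_index// ltnS.
move=> /(_ (leq_bigmax (Ordinal ls)))[/(_ zx) zy _].
apply: le_lt_trans (tT _ z _) _; rewrite sT [e]splitr.
by apply: ltrD; [exact: lt_trans zx me|exact: lt_trans zy me].
Qed.

End SplittingSets.

Section ImageMeasure.
Context d d' (T1 : measurableType d) (T2 : measurableType d') (R : realType).
Variables (mu : {finite_measure set T1 -> \bar R}) (f : T1 -> T2).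

Definition image_measure (mf : measurable_fun setT f) (A : set T2) : \bar R := mu (f @^-1` A).

Hypothesis mf : measurable_fun setT f.
Local Notation nu := (image_measure mf).

Let mpre A : measurable A -> measurable (f @^-1` A).
Proof. by move=> mA; rewrite -[X in measurable X]setTI; exact: mf. Qed.

Let nu0 : nu set0 = 0%E.
Proof. by rewrite /image_measure preimage_set0 measure0. Qed.

Let nu_ge0 A : (0 <= nu A)%E.
Proof. exact: measure_ge0. Qed.

Let nu_sigma_additive : semi_sigma_additive nu.
Proof.
move=> F mF tF mUF; rewrite /image_measure preimage_bigcup.
apply: measure_semi_sigma_additive.
- by move=> n; exact: mpre.
- apply/trivIsetP => /= i j _ _ ij; rewrite -preimage_setI.
  by move/trivIsetP : tF => /(_ _ _ _ _ ij) ->//; rewrite preimage_set0.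
- by rewrite -preimage_bigcup; exact: mpre.
Qed.

HB.instance Definition _ := isMeasure.Build _ _ _ nu nu0 nu_ge0 nu_sigma_additive.

Let nu_fin : fin_num_fun nu.
Proof. by move=> A mA; apply: fin_num_measure; exact: mpre. Qed.

HB.instance Definition _ := Measure_isFinite.Build _ _ _ nu nu_fin.

Definition finite_image_measure : {finite_measure set T2 -> \bar R} := nu.

Lemma Rintegral_image (phi : T2 -> R) : bmeas setT phi ->
  \int[finite_image_measure]_(x in setT) phi x = \int[mu]_(t in setT) phi (f t).
Proof.
move=> [mphi [M MP]]; congr fine.
have mphi' : measurable_fun setT (EFin \o phi) by exact/measurable_EFinP.
apply: etrans (integral_pushforward mf mphi' _ measurableT) _ => //.
rewrite preimage_setT; apply: (@bmeas_integrable _ _ _ setT _ mu (phi \o f)) => //.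
split; first exact: measurableT_comp.
by exists M => x _; exact: MP.
Qed.

End ImageMeasure.

Section Riesz.
Context {R : realType} {n : nat}.
Notation Cn := 'rV[R[i]^o]_n.
Local Notation BCn := (BCn R n).
Variables (K : set Cn) (cK : compact K) (K0 : K !=set0).
Variables (Lam : (Cn -> R) -> R) (pLam : positive_functional K Lam).

Lemma interval_measure (M : R) : exists2 la : {finite_measure set (measurableTypeR R) -> \bar R},
  la (~` `[0, M[%classic) = 0%E &
  forall a b, 0 <= a -> a <= b -> b <= M -> la `[a, b[%classic = (b - a)%:E.
Proof.
have mI : @measurable _ (measurableTypeR R) (`[0, M[%classic) by [].
have moo : (@lebesgue_measure R (`[0%R, M[%classic : set R) < +oo)%E.
  by rewrite lebesgue_measure_itv; case: ifP => _; rewrite ?ltry.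
exists (mfrestr mI moo); first by rewrite /= /mfrestr /mrestr setICl measure0.
move=> a b a0 ab bM.
rewrite /= /mfrestr /mrestr setIidl; last first.
  move=> t /=; rewrite !in_itv /= => /andP[h1 h2].
  by rewrite (le_trans a0 h1) (lt_le_trans h2 bM).
rewrite lebesgue_measure_itv /= lte_fin; case: ifP => // /negbT.
by rewrite -leNgt => ba; rewrite (le_anti (introT andP (conj ab ba))) subrr.
Qed.

Lemma bounded_on_cont (phi : Cn -> R) : cont_on cdist rdist K phi -> bounded_on K phi.
Proof.
move=> cphi; have [M _ MP] := @cont_on_bounded R n K (fun x => (phi x)%:C%C) cK
  ltac:(by move=> x Kx e /(cphi _ Kx)[r r0 rP]; exists r => // y Ky /(rP _ Ky);
    rewrite /cdist1 -rmorphB cabs_real).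
by exists M => x /MP; rewrite cabs_real.
Qed.

(** With [M] the total mass, [nu] is the image of Lebesgue measure on the interval from 0 to [M]
    under the map [Phi] sending [t] to the point on which its nested cells close. Countable
    additivity is thus inherited from Lebesgue measure. *)
Theorem riesz : exists nu : {finite_measure set BCn -> \bar R},
  nu (~` K) = 0%E /\
  forall phi : Cn -> R, cont_on cdist rdist K phi ->
    \int[nu]_(x in (K : set BCn)) phi x = Lam phi.
Proof.
have [sT tT d0 nT] := @cdist_metrizes R n.
have [U UP] := splitting_sets cK.
set M := mass Lam K; have [la la0 laE] := interval_measure M.
pose rn k t := run Lam U k 0 0 K t.
have M0 : 0 <= M by exact: (mass_ge0 pLam).
have rnK k t x : rn k t x -> K x by move=> h; exact: (run_sub h).
have rn_ne k t : 0 <= t < M -> exists x, rn k t x.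
  move=> tM; have [x [rx _]] := @run_nonempty _ _ _ _ pLam U k 0%N 0 K t ltac:(by rewrite add0r).
  by exists x.
have rn_small (e : R) : 0 < e -> exists k, forall t x y, rn k t x -> rn k t y -> cdist x y < e.
  move=> /UP[k kP]; exists k => t x y rx ry; apply: kP (rnK _ _ _ rx) (rnK _ _ _ ry) _ => i ik.
  exact: (run_agree rx ry ik).
have [x0 Kx0] := K0.
(* Points chosen in the successive cells of [t] have a cluster point in [K], and whole cells
   approach it since their diameters tend to 0. Outside the interval, where [la] has no mass, [x0]
   is a default value. *)
have /choice[Phi PhiP] : forall t, exists x, [/\ K x, ~~ (0 <= t < M) -> x = x0 & 0 <= t < M ->
    forall e : R, 0 < e -> exists k, forall y, rn k t y -> cdist x y < e].
  move=> t; have [tM|tM] := boolP (0 <= t < M); last by exists x0; split.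
  have /choice[y yP] : forall k, exists x, rn k t x by move=> k; exact: rn_ne.
  have yK : (y @ \oo) K by exists 0%N => // k _; exact: rnK (yP k).
  have [x [Kx cx]] : (K `&` cluster (y @ \oo)) !=set0 by apply: cK yK.
  exists x; split=> // _ e e0.
  have e20 : 0 < e / 2 by rewrite divr_gt0.
  have [k kP] := rn_small _ e20; exists k => z rz.
  have [_ [[i ki <-] xi]] := cx [set y i | i in [set i | (k <= i)%N]] [set z | cdist x z < e / 2]
    ltac:(by exists k => // i ki; exists i) ltac:(by apply/nT; exists (e / 2)).
  rewrite [e]splitr; apply: le_lt_trans (tT _ (y i) _) _; apply: ltrD => //.
  by apply: kP rz; exact: (run_le ki (yP i)).
have KPhi t : K (Phi t) by case: (PhiP t).
have mrn k (P : set Cn -> Prop) : @measurable _ (measurableTypeR R) [set t | P (rn k t)] by exact: measurable_run.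
have mPhi : measurable_fun setT (Phi : measurableTypeR R -> BCn).
  refine (@measurability _ _ (measurableTypeR R) BCn setT Phi (@open Cn) erefl _) => _ [V oV <-]; rewrite setTI.
  (* For [t] in the interval, [Phi t] lies in the open set [V] exactly when some cell of [t] has its
     neighbourhood of radius [m.+1%:R^-1] inside [V]. Each such condition is measurable by
     [measurable_run]. *)
  pose good k m t := forall y, rn k t y -> forall z, cdist y z < m.+1%:R^-1 -> V z.
  pose I : set R := `[0, M[%classic.
  have mI : @measurable _ (measurableTypeR R) I by exact: measurable_itv.
  have -> : Phi @^-1` V = (~` I `&` [set _ | V x0]) `|`
      (I `&` \bigcup_k \bigcup_m [set t | good k m t]).
    apply/seteqP; split => t /=.
      have [tI|tI] := boolP (0 <= t < M) => Vt; last first.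
        left; split; first by rewrite /I /= in_itv /=; exact/negP.
        by have [_ /(_ tI) <- _] := PhiP t.
      right; split; first by rewrite /I /= in_itv.
      have /nT[r r0 rP] : nbhs (Phi t) V by exact: open_nbhs_nbhs.
      have r20 : 0 < r / 2 by rewrite divr_gt0.
      have [_ _ /(_ tI _ r20)[k kP]] := PhiP t.
      exists k => //; exists (Num.truncn (r / 2)^-1) => // y ry z yz.
      apply: rP; apply: le_lt_trans (tT _ y _) _; rewrite [r]splitr.
      apply: ltrD; first exact: kP.
      apply: lt_trans yz _; rewrite invf_plt ?posrE//; exact: truncnS_gt.
    case=> [[tI Vx0]|[tI [k _ [m _ gt]]]].
      have tM : ~~ (0 <= t < M) by apply/negP; move: tI; rewrite /I /= in_itv.
      by have [_ /(_ tM) -> _] := PhiP t.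
    have tM : 0 <= t < M by move: tI; rewrite /I /= in_itv.
    have [_ _ /(_ tM m.+1%:R^-1)[|k' k'P]] := PhiP t; first by rewrite invr_gt0.
    have [y ry] := rn_ne (maxn k k') t tM.
    apply: (gt y); first exact: (run_le (leq_maxl k k') ry).
    rewrite sT; apply: k'P; exact: (run_le (leq_maxr k k') ry).
  apply: measurableU; apply: measurableI => //.
  - exact: measurableC.
  - have [h|h] := pselect (V x0).
      by rewrite (_ : [set _ | _] = setT)//; apply/seteqP; split.
    by rewrite (_ : [set _ | _] = set0)//; apply/seteqP; split.
  - apply: bigcupT_measurable => k; apply: bigcupT_measurable => m.
    exact: (mrn k (fun A => forall y, A y -> forall z, cdist y z < m.+1%:R^-1 -> V z)).
pose nu := finite_image_measure la mPhi.
have mK : measurable (K : set BCn) by exact: compact_measurable_BCn.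
exists nu; split.
  rewrite /nu /finite_image_measure /= /image_measure.
  rewrite [X in la X](_ : _ = set0) ?measure0//.
  by apply/seteqP; split => // t /= h; exact: (h (KPhi t)).
move=> phi cphi; have [N hN] := bounded_on_cont cphi.
have b0 (f : Cn -> R) : cont_on cdist rdist K f -> bmeas (setT : set BCn) (f \_ K).
  move=> cf; have [B hB] := bounded_on_cont cf; split.
    apply/(measurable_restrictT _ mK); exact: cont_on_measurable.
  exists `|B| => x _; rewrite patchE; case: ifPn => [/set_mem Kx|_]; last by rewrite normr0.
  by apply: le_trans (hB _ Kx) _; exact: ler_norm.
have bphi := b0 _ cphi.
have bg : bmeas (setT : set (measurableTypeR R)) (phi \o Phi).
  have [mp [N' pN]] := bphi; split.
    have -> : phi \o Phi = (phi \_ K) \o Phi.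
      by apply/funext => t /=; rewrite patchE mem_set.
    exact: (measurableT_comp mp mPhi).
  by exists N => t _; exact: hN.
have -> : \int[nu]_(x in (K : set BCn)) phi x =
    \int[la]_(t in setT) (\1_(`[0, M[%classic) t * phi (Phi t)).
  rewrite [LHS]Rintegral_mkcond (Rintegral_image la mPhi bphi).
  transitivity (\int[la]_(t in setT) phi (Phi t)).
    by apply: eq_Rintegral => t _; rewrite patchE mem_set.
  have mI : @measurable _ (measurableTypeR R) (`[0, M[%classic) by exact: measurable_itv.
  have mC := measurableC mI.
  have bI : bmeas (setT : set (measurableTypeR R)) (\1_(`[0, M[%classic) : R -> R) by exact: bmeas_indic.
  have bC : bmeas (setT : set (measurableTypeR R)) (\1_(~` `[0, M[%classic) : R -> R) by exact: bmeas_indic.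
  have -> : \int[la]_(t in setT) phi (Phi t) =
      \int[la]_(t in setT) (\1_(`[0, M[%classic) t * phi (Phi t)) +
      \int[la]_(t in setT) (\1_(~` `[0, M[%classic) t * phi (Phi t)).
    rewrite -bintD//; [|exact: bmeasM bI bg|exact: bmeasM bC bg].
    apply: eq_Rintegral => t _; rewrite !indicE in_setC.
    by case: (_ \in _); rewrite !(mul0r, mul1r, addr0, add0r).
  rewrite [X in _ + X](_ : _ = 0) ?addr0//; apply/eqP; rewrite -normr_le0.
  have Z : \int[la]_(t in setT) (`|N| * \1_(~` `[0, M[%classic) t) = 0.
    by rewrite bintZ// /Rintegral integral_indic// setIT [X in fine X](_ : _ = 0%E) ?mulr0.
  rewrite -[leRHS]Z; apply: (@bint_norm_le _ _ _ setT measurableT la _ _ (bmeasM bC bg) (bmeasM (bmeas_cst _ _) bC)).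
  move=> t _; rewrite normrM mulrC indicE; case: (_ \in _); rewrite ?normr0 ?mulr0// normr1 !mulr1.
  by apply: le_trans (hN _ (KPhi t)) _; exact: ler_norm.
have bphiK : bounded_on K phi by exists N.
have -> : Lam phi = Lam (fun x => \1_K x * phi x).
  apply: (functional_ext pLam) => //; first by apply: bounded_onM => //; exact: bounded_on_indic.
  by move=> x Kx; rewrite indicE mem_set// mul1r.
apply/eqP; rewrite -subr_eq0 -normr_eq0; apply/negPn/negP => D0.
set I := \int[la]_(t in _) _ in D0 *; set L := Lam _ in D0 *.
have D0' : 0 < `|I - L| by rewrite lt_neqAle eq_sym D0 normr_ge0.
have M1 : 0 < M + 1 by rewrite ltr_wpDl.
(* With this [e], the bound [e * M] of [run_integral] is smaller than the difference that it
   bounds. *)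
have e0 : 0 < `|I - L| / (M + 1) by rewrite divr_gt0.
set e := _ / _ in e0.
have [r r0 rP] := cont_on_unif (@cdist_metrizes R n) (@rdist_sym R) (@rdist_triangle R) cK cphi e0.
have r20 : 0 < r / 2 by rewrite divr_gt0.
have [k kP] := rn_small _ r20.
have : `|I - L| <= e * M.
  have := @run_integral _ _ _ _ pLam U la M laE k 0%N 0 K (phi \o Phi) phi e (lexx _).
  rewrite !add0r => /(_ (lexx _) bg bphiK); apply => t x tM rx Kx.
  apply/ltW/rP => //; have [_ _ /(_ tM _ r20)[k' k'P]] := PhiP t.
  have [y ry] := rn_ne (maxn k k') t tM.
  apply: le_lt_trans (tT _ y _) _; rewrite [r]splitr; apply: ltrD.
    by apply: k'P; exact: (run_le (leq_maxr k k') ry).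
  by apply: kP rx; exact: (run_le (leq_maxl k k') ry).
rewrite /e mulrAC ler_pdivlMr// ler_pM2l//.
by rewrite gerDl ler10.
Qed.

End Riesz.

(** * Null sets for the annihilator of A are interpolation sets for A *)

Section Extension.
Context {R : realType} {n : nat}.
Notation Cn := 'rV[R[i]^o]_n.
Implicit Types (A B K : set Cn).

Lemma dist_set_cont K : K !=set0 -> continuous (dist_set K : Cn -> R^o).
Proof.
move=> K0; have [sT tT d0 nT] := @cdist_metrizes R n.
have [_ _ _ nR] := @rdist_metrizes R.
move=> x V /nR[e e0 eV]; apply/nT; exists e => // y xy; apply: eV.
apply: le_lt_trans xy; rewrite /rdist ler_norml; apply/andP; split.
  by rewrite lerNl opprB lerBlDl sT; exact: dist_set_lip.
by rewrite lerBlDl; exact: dist_set_lip.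
Qed.

(** Two disjoint closed sets are separated by the points nearer to the one and those nearer to the
    other. This is what Tietze's theorem asks for. *)
Lemma normal_Cn : normal_space Cn.
Proof.
apply/(@normal_openP R) => A B cA cB AB.
have [A0|/set0P A0] := eqVneq A set0.
  exists set0, setT; rewrite A0; split => //; first [exact: open0|exact: openT|by rewrite set0I].
have [B0|/set0P B0] := eqVneq B set0.
  exists setT, set0; rewrite B0; split => //; first [exact: open0|exact: openT|by rewrite setI0].
have od (K L : set Cn) : K !=set0 -> L !=set0 ->
    open [set x | dist_set K x < dist_set L x].
  move=> K0 L0.
  rewrite (_ : [set x | _] = (fun x => dist_set L x - dist_set K x) @^-1` [set r : R^o | 0 < r]).
    apply: open_comp; last exact: open_gt.
    by move=> x _; apply: (@continuousB R R^o) ; exact: dist_set_cont.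
  by apply/seteqP; split => x /=; rewrite subr_gt0.
have sub (K L : set Cn) : closed L -> K !=set0 -> L !=set0 -> K `&` L = set0 ->
    K `<=` [set x | dist_set K x < dist_set L x].
  move=> cL K0 L0 KL x Kx /=; rewrite dist_set0//; apply: dist_set_gt0 => // Lx.
  by have : (K `&` L) x by []; rewrite KL.
exists [set x | dist_set A x < dist_set B x], [set x | dist_set B x < dist_set A x].
split; [exact: od|exact: od|exact: sub|by apply: sub => //; rewrite setIC|].
by apply/seteqP; split => // x /= [h1 h2]; have := lt_trans h1 h2; rewrite ltxx.
Qed.

Lemma cont_onT (phi : Cn -> R) : continuous (phi : Cn -> R^o) -> cont_on cdist rdist setT phi.
Proof.
move=> cphi; apply/(within_cont_on _ _ (@cdist_metrizes R n) (@rdist_metrizes R)).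
by apply: continuous_subspaceT => x; exact: cphi.
Qed.

Lemma tietze_real (S : set Cn) (phi : Cn -> R) : closed S ->
  cont_on cdist rdist S phi -> (forall x, S x -> `|phi x| <= 1) ->
  exists F, [/\ forall x, S x -> F x = phi x, cont_on cdist rdist setT F & forall x, `|F x| <= 1].
Proof.
move=> cS /(within_cont_on _ _ (@cdist_metrizes R n) (@rdist_metrizes R)) cphi phi1.
have [F [FE cF F1]] := continuous_bounded_extension normal_Cn cS ltr01 cphi phi1.
exists F; split => //; last exact: cont_onT.
by move=> x Sx; rewrite FE// mem_set.
Qed.

End Extension.

Section SeparatingMeasure.
Context {R : realType} {n : nat}.
Notation Cn := 'rV[R[i]^o]_n.
Local Notation torus := (@Defs.torus R n).
Local Notation BCn := (BCn R n).
Implicit Types (u g : Cn -> R[i]) (phi : Cn -> R).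

(** By [Re_cint], the real part of an integral is the sum over [k] of the integrals of [rot k]
    against the positive parts. Upper bounds on all four rotations bound the real and imaginary
    parts in absolute value. *)
Definition rot (k : 'I_4) (z : R[i]) : R := complex.Re (iC R ^+ k * z).

Lemma rot_linear k (r : R) z z' : rot k (r%:C%C * z + z') = r * rot k z + rot k z'.
Proof. by rewrite /rot !(ReD, ImD, ReM, ImM) /=; ring. Qed.

Lemma rot_le k z : `|rot k z| <= cabs z.
Proof.
by apply: le_trans (Re_cabs _) _; rewrite cabsM cabsX cabs_iC expr1n mul1r.
Qed.

Lemma rot0 z : rot 0 z = complex.Re z.
Proof. by rewrite /rot expr0 mul1r. Qed.

Lemma rot1 z : rot 1 z = - complex.Im z.
Proof. by rewrite /rot expr1 /iC ReM /=; ring. Qed.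

Lemma rot2 z : rot 2%:R z = - complex.Re z.
Proof. by rewrite /rot /= !exprS expr0 /iC !(ReM, ImM) /=; ring. Qed.

Lemma rot3 z : rot 3%:R z = complex.Im z.
Proof. by rewrite /rot /= !exprS expr0 /iC !(ReM, ImM) /=; ring. Qed.

Lemma torus_nonempty : torus !=set0.
Proof. by exists (const_mx 1); apply/torusP => j; rewrite mxE cabs1. Qed.

Lemma rot_cont_on k u : cont_on cdist cdist1 torus u ->
  cont_on cdist rdist torus (fun x => rot k (u x)).
Proof.
move=> cu x Tx e /(cu _ Tx)[r r0 rP]; exists r => // y Ty /(rP _ Ty).
apply: le_lt_trans; apply: le_trans (rot_le k _).
by rewrite /rdist /rot mulrBr ReD ReN.
Qed.

Lemma Re_cint mu u : cont_on cdist cdist1 torus u ->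
  complex.Re (cint mu u) =
  \sum_(k < 4) \int[cm_part mu k]_(x in (torus : set BCn)) rot k (u x).
Proof.
move=> /cbm_cont[bR bI]; have mT := @measurable_torus R n.
have Re_sum (F : 'I_4 -> R[i]) : complex.Re (\sum_k F k) = \sum_k complex.Re (F k).
  by elim/big_rec2: _ => // k x y _ <-; rewrite ReD.
rewrite cintE Re_sum; apply: eq_bigr => k _; rewrite ReM /=.
under [RHS]eq_Rintegral do rewrite /rot ReM.
by rewrite bintB ?bintZ//; exact: bmeasM (bmeas_cst _ _) _.
Qed.

(* The four rotations of [u] are stacked into one real function, so that the
   functional dominated by the one-sided sup below is positive on each copy of
   the torus and is represented by four positive measures. *)
Let V := (Cn * 'I_4)%type -> R^o.

Let hat u : V := fun x => rot x.2 (u x.1).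

Let layer k phi : V := fun x => if x.2 == k then phi x.1 else 0.

Let hat_linear (r : R) u g : r *: hat u + hat g = hat (fun z => r%:C%C * u z + g z).
Proof. by apply/funext => x; rewrite /hat rot_linear. Qed.

Let hat_layers u : hat u = 1 *: layer 0 (rot 0 \o u) + (1 *: layer 1 (rot 1 \o u) +
  (1 *: layer 2%:R (rot 2%:R \o u) + layer 3%:R (rot 3%:R \o u))).
Proof.
apply/funext => -[x k]; rewrite !scale1r /hat /layer /=.
case: k => -[|[|[|[|//]]]] kP; rewrite /GRing.add /= ?add0r ?addr0;
  congr (rot _ (u x)); exact/val_inj.
Qed.

Lemma cont_on_complexD (S : set Cn) u g : cont_on cdist cdist1 S u ->
  cont_on cdist cdist1 S g -> cont_on cdist cdist1 S (fun x => u x + g x).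
Proof.
move=> cu cg x Sx e e0; have e20 : 0 < e / 2 by rewrite divr_gt0.
have [a a0 aP] := cu _ Sx _ e20; have [b b0 bP] := cg _ Sx _ e20.
exists (Num.min a b); first by rewrite lt_min a0.
move=> y Sy; rewrite lt_min => /andP[xa xb].
rewrite /cdist1 opprD addrACA; apply: le_lt_trans (cabsD _ _) _.
by rewrite [e]splitr ltrD//; [exact: aP|exact: bP].
Qed.

Let D : set (Cn * 'I_4) := [set x | torus x.1].

Variables (w : Cn -> R) (W : R).
Hypothesis w_itv : forall x, torus x -> 0 < w x <= W.

Let p (v : V) : R := sup [set w x.1 * v x | x in D].

Let D0 : exists x, D x.
Proof. by have [x Tx] := torus_nonempty; exists (x, 0). Qed.

Let p_ge (v : V) x : bounded_on D v -> D x -> w x.1 * v x <= p v.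
Proof.
move=> [M vM] Dx; apply: sup_upper_bound; last by exists x.
split; first by exists (w x.1 * v x), x.
exists (W * M) => _ [y Dy <-]; have /andP[w0 wW] := w_itv Dy.
apply: le_trans (ler_norm _) _; rewrite normrM (gtr0_norm w0).
by apply: ler_pM; rewrite ?(ltW w0)//; exact: vM.
Qed.

Let p_le (v : V) c : (forall x, D x -> w x.1 * v x <= c) -> p v <= c.
Proof.
move=> vc; apply: ge_sup; last by move=> _ [x Dx <-]; exact: vc.
by have [x Dx] := D0; exists (w x.1 * v x), x.
Qed.

Let B_lin (t : R) (u v : V) : bounded_on D u -> bounded_on D v -> bounded_on D (t *: u + v).
Proof.
move=> bu bv; exact: (bounded_onD (bounded_onM (bounded_on_cst D t) bu) bv).
Qed.

Let p_sub (u v : V) : bounded_on D u -> bounded_on D v -> p (u + v) <= p u + p v.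
Proof.
move=> bu bv; apply: p_le => x Dx; rewrite mulrDr.
by apply: lerD; exact: p_ge.
Qed.

Let p_hom (t : R) (u : V) : 0 < t -> bounded_on D u -> p (t *: u) = t * p u.
Proof.
move=> t0 bu; have btu : bounded_on D (t *: u).
  exact: (bounded_onM (bounded_on_cst D t) bu).
apply/eqP; rewrite eq_le; apply/andP; split.
  by apply: p_le => x Dx; rewrite mulrCA ler_pM2l//; exact: p_ge.
rewrite mulrC -ler_pdivlMr//; apply: p_le => x Dx; rewrite ler_pdivlMr//.
by have := p_ge btu Dx; rewrite mulrCA mulrC.
Qed.

Let hat_bounded u : cont_on cdist cdist1 torus u -> bounded_on D (hat u).
Proof.
move=> /(cont_on_bounded (@torus_compact R n))[M _ uM].
by exists M => x /uM; apply: le_trans; exact: rot_le.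
Qed.

(** The layers 0 and 2 are opposite, so one of them is nonnegative at any given point. *)
Let p_hat_ge0 u : cont_on cdist cdist1 torus u -> 0 <= p (hat u).
Proof.
move=> /hat_bounded bu; have [x Tx] := torus_nonempty.
have /andP[w0 _] := w_itv Tx.
have h0 := p_ge bu (Tx : D (x, 0)); have h2 := p_ge bu (Tx : D (x, 2%:R)).
move: h0 h2; rewrite /hat /= rot0 rot2 mulrN; set a := w x * _ => h0 h2.
by apply: le_trans (normr_ge0 a) _; rewrite ler_norml h0 lerNl h2.
Qed.

Let layer_bounded k phi : bounded_on torus phi -> bounded_on D (layer k phi).
Proof.
move=> [M pM]; exists `|M| => x Dx; rewrite /layer; case: ifP => _; last by rewrite normr0.
by apply: le_trans (pM _ Dx) _; exact: ler_norm.
Qed.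

Variable F : Cn -> R[i].
Hypothesis cF : cont_on cdist cdist1 torus F.

(** Hahn-Banach is applied to the functional sending [t F + g] to [t], which the hypothesis makes
    dominated by the weighted supremum [p]. As [p] is at most 0 on nonpositive functions, the
    extension is positive on each layer, and Riesz supplies the four parts. *)
Theorem separating_measure :
  (forall g c, inA g -> c < 1 ->
     ~ forall x k, torus x -> w x * rot k (F x - g x) <= c) ->
  exists mu : cmeasure R n,
    [/\ annihilates (@inA R n) mu, complex.Re (cint mu F) = 1 &
      forall u c, cont_on cdist cdist1 torus u ->
        (forall x k, torus x -> w x * rot k (u x) <= c) -> complex.Re (cint mu u) <= c].
Proof.
move=> far; have cT := @torus_compact R n.
have cA g : inA g -> cont_on cdist cdist1 torus g by exact: inA_cont_on.
have cAF g (t : R) : inA g -> cont_on cdist cdist1 torus (fun z => t%:C%C * F z + g z).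
  move=> Ag; have ct := cA _ (@inA_cst R n t%:C%C).
  exact: (cont_on_complexD (cont_onM cT ct cF) (cA _ Ag)).
pose G0 : set (V * R) := [set v | exists g, inA g /\
   v.1 = hat (fun z => v.2%:C%C * F z + g z)].
have dG0 : dominated_graph (bounded_on D) p G0.
  split.
    move=> t [_ a] [_ b] [g [Ag /= ->]] [h [Ah /= ->]]; exists (fun z => t%:C%C * g z + h z).
    split; first exact: (inAD (inAM (@inA_cst R n _) Ag) Ah).
    rewrite /= hat_linear; congr hat; apply/funext => z.
    by rewrite !rmorphD !rmorphM /=; ring.
  move=> [_ t] [g [Ag /= ->]]; have cg := cAF g t Ag.
  split; first exact: hat_bounded.
  (* For [t <= 0] the value is below [p], which is nonnegative on these functions. For [t > 0],
     division by [t] leads to [F] minus an element of A, where [far] applies. *)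
  have [t0|t0] := leP t 0; first exact: le_trans t0 (p_hat_ge0 cg).
  rewrite leNgt; apply/negP => pt.
  have Ag' : inA (fun z => (- t^-1)%:C%C * g z) by exact: (inAM (@inA_cst R n _) Ag).
  apply: (far _ (t^-1 * p (hat (fun z => t%:C%C * F z + g z))) Ag').
    by rewrite mulrC ltr_pdivrMr// mul1r.
  move=> x k Tx; rewrite ler_pdivlMl//.
  apply: le_trans (p_ge (hat_bounded cg) (Tx : D (x, k))).
  rewrite mulrCA /hat /= le_eqVlt; apply/orP; left; apply/eqP; congr (_ * _).
  rewrite -[LHS]addr0 (_ : 0 = rot k 0); last by rewrite /rot mulr0.
  rewrite -rot_linear addr0; congr rot.
  have tt : t%:C%C * (- t^-1)%:C%C = -1 by rewrite -rmorphM mulrN divff ?gt_eqF// rmorphN1.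
  by rewrite mulrBr mulrA tt mulN1r opprK.
have [|f [fL fp fG]] := hahn_banach B_lin p_sub p_hom dG0.
  exists (fun=> 0); split; first exact: inA_cst.
  by apply/funext => x; rewrite /hat /= mul0r addr0 /rot mulr0.
have f_add (v1 v2 : V) : bounded_on D v1 -> bounded_on D v2 -> f (1 *: v1 + v2) = f v1 + f v2.
  by move=> b1 b2; rewrite fL// mul1r.
have f_pos k : positive_functional torus (fun phi => f (layer k phi)).
  have lay_lin (t : R) phi psi : layer k (fun x => t * phi x + psi x) = t *: layer k phi + layer k psi.
    apply/funext => x; rewrite [RHS](_ : _ = t * layer k phi x + layer k psi x)//.
    by rewrite /layer; case: ifP => _ //; rewrite mulr0 addr0.
  have b0 : bounded_on D (0 : V) by exists 0 => x _; rewrite normr0.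
  have f0 : f 0 = 0 by have := f_add _ _ b0 b0; rewrite scaler0 addr0 => /eqP; rewrite -subr_eq subrr eq_sym => /eqP.
  split.
  - move=> phi psi bp bs; rewrite -f_add; [|exact: layer_bounded..].
    by rewrite -lay_lin; congr (f (layer _ _)); apply/funext => x; rewrite mul1r.
  - move=> c phi bp; rewrite -[RHS]addr0 -f0 -fL//; last exact: layer_bounded.
    by rewrite addr0; congr f; apply/funext => x;
      rewrite [RHS](_ : _ = c * layer k phi x)// /layer; case: ifP => _ //; rewrite mulr0.
  - move=> phi bp phi0; rewrite -oppr_le0.
    have bl := layer_bounded k bp.
    have -> : - f (layer k phi) = f ((-1) *: layer k phi) .
      by have := fL (-1) _ _ bl b0; rewrite addr0 f0 addr0 mulN1r.
    apply: le_trans (fp _ _) _; first by rewrite -[_ *: _]addr0; exact: B_lin.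
    apply: p_le => x Dx; rewrite [X in _ * X](_ : _ = -1 * layer k phi x)// mulN1r mulrN oppr_le0.
    have /andP[w0 _] := w_itv Dx; rewrite mulr_ge0 ?(ltW w0)// /layer.
    by case: ifP => // _; exact: phi0.
have /choice[nu nuP] : forall k : 'I_4, exists nu : {finite_measure set BCn -> \bar R},
    nu (~` torus) = 0%E /\ forall phi : Cn -> R, cont_on cdist rdist torus phi ->
    \int[nu]_(x in (torus : set BCn)) phi x = f (layer k phi).
  by move=> k; exact: (riesz cT torus_nonempty (f_pos k)).
pose mu := CMeasure (fun k => (nuP k).1).
have muE u : cont_on cdist cdist1 torus u -> complex.Re (cint mu u) = f (hat u).
  move=> cu; rewrite Re_cint// sum_ord4.
  have bl k : bounded_on D (layer k (rot k \o u)).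
    by apply: layer_bounded; exact: (bounded_on_cont cT (rot_cont_on k cu)).
  have B1 (v1 v2 : V) : bounded_on D v1 -> bounded_on D v2 -> bounded_on D (1 *: v1 + v2).
    exact: B_lin.
  have B2 := B1 _ _ (bl 2%:R) (bl 3%:R); have B3 := B1 _ _ (bl 1) B2.
  rewrite hat_layers !f_add//.
  by congr (_ + (_ + (_ + _))); apply: (nuP _).2; exact: rot_cont_on.
exists mu; split.
- move=> g Ag.
  (* [f] governs real parts only; the imaginary part of the integral of [g] is read off the real
     part of that of [i g]. *)
  have ReZ h : inA h -> complex.Re (cint mu h) = 0.
    move=> Ah; rewrite muE; last exact: cA.
    rewrite -[RHS](fG (hat h, 0))//; exists h; split => //=.
    by congr hat; apply/funext => z; rewrite mul0r add0r.
  apply: complex_ext; first exact: ReZ.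
  have := ReZ _ (inAM (@inA_cst R n (iC R)) Ag).
  rewrite cintZ; last exact: inA_cbm.
  rewrite ReM /= mul0r mul1r sub0r => /eqP; rewrite oppr_eq0 => /eqP; exact.
- rewrite muE// -[RHS](fG (hat F, 1))//; exists (fun=> 0); split; first exact: inA_cst.
  by congr hat; apply/funext => z /=; rewrite mul1r addr0.
- move=> u c cu uc; rewrite muE//; apply: le_trans (fp _ (hat_bounded cu)) _.
  by apply: p_le => x Dx; exact: uc.
Qed.

End SeparatingMeasure.

Section NullInterpolation.
Context {R : realType} {n : nat}.
Notation Cn := 'rV[R[i]^o]_n.
Local Notation torus := (@Defs.torus R n).
Local Notation BCn := (BCn R n).
Implicit Types (f g : Cn -> R[i]) (mu : cmeasure R n).

Lemma bint_indic_eq (nu nu' : {finite_measure set BCn -> \bar R}) (S : set BCn) (phi : BCn -> R) :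
  measurable S -> S `<=` torus ->
  (forall E, measurable E -> E `<=` S -> nu E = nu' E) ->
  \int[nu]_(x in (torus : set BCn)) (\1_S x * phi x) =
  \int[nu']_(x in (torus : set BCn)) (\1_S x * phi x).
Proof.
move=> mS ST nuE.
have H (m' : {finite_measure set BCn -> \bar R}) :
    \int[m']_(x in (torus : set BCn)) (\1_S x * phi x) = fine (\int[m']_(x in S) (phi x)%:E)%E.
  rewrite /Rintegral -(setIidr ST) integral_mkcondr; congr fine; apply: eq_integral => x _.
  by rewrite patchE indicE setIidr//; case: (x \in S); rewrite ?mul1r ?mul0r.
by rewrite !H; congr fine; apply: eq_measure_integral => E mE ES; exact: nuE.
Qed.

(** Vanishing values force the parts 0 and 2, as well as the parts 1 and 3, to coincide on Borel
    subsets of [S]; the weights 1, i, -1, -i then cancel in any integral over [S]. *)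
Lemma cint_on_null mu (S : set Cn) g : measurable (S : set BCn) -> S `<=` torus ->
  (forall E : set BCn, measurable E -> E `<=` S -> cmval mu E = 0) ->
  cint mu (on_set S g) = 0.
Proof.
move=> mS ST mu0.
have E02 (E : set BCn) : measurable E -> E `<=` S -> cm_part mu 0 E = cm_part mu 2%:R E.
  move=> mE ES; have /= := congr1 (@complex.Re R) (etrans (esym (cmvalE mu E)) (mu0 _ mE ES)).
  move=> /eqP; rewrite subr_eq0 => /eqP h; have := congr1 EFin h.
  by rewrite !fineK// fin_num_measure.
have E13 (E : set BCn) : measurable E -> E `<=` S -> cm_part mu 1 E = cm_part mu 3%:R E.
  move=> mE ES; have /= := congr1 (@complex.Im R) (etrans (esym (cmvalE mu E)) (mu0 _ mE ES)).
  move=> /eqP; rewrite subr_eq0 => /eqP h; have := congr1 EFin h.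
  by rewrite !fineK// fin_num_measure.
rewrite cintE.
under eq_bigr => k _.
  under eq_Rintegral do rewrite /on_set ReM /= mul0r subr0.
  under [X in Complex _ X]eq_Rintegral do rewrite /on_set ImM /= mul0r addr0.
  over.
rewrite sum_ord4.
rewrite !(bint_indic_eq _ mS ST E02) !(bint_indic_eq _ mS ST E13).
rewrite /= !exprS expr0 /iC.
by apply: complex_ext; rewrite !(ReD, ImD, ReM, ImM) /=; ring.
Qed.

Lemma rot_le1 k (z : R[i]) : `|complex.Re z| <= 1 -> `|complex.Im z| <= 1 -> rot k z <= 1.
Proof.
rewrite !ler_norml => /andP[h1 h2] /andP[h3 h4].
case: k => -[|[|[|[|//]]]] kP.
- by rewrite (_ : Ordinal kP = 0) ?rot0//; exact/val_inj.
- by rewrite (_ : Ordinal kP = 1) ?rot1 1?lerNl//; exact/val_inj.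
- by rewrite (_ : Ordinal kP = 2%:R) ?rot2 1?lerNl//; exact/val_inj.
- by rewrite (_ : Ordinal kP = 3%:R) ?rot3//; exact/val_inj.
Qed.

End NullInterpolation.

Section NullApproximation.
Context {R : realType} {n : nat}.
Notation Cn := 'rV[R[i]^o]_n.
Local Notation torus := (@Defs.torus R n).
Local Notation BCn := (BCn R n).
Implicit Types (f g : Cn -> R[i]) (mu : cmeasure R n).

Lemma tietze_complex (S : set Cn) f : closed S -> cont_on cdist cdist1 S f ->
  (forall x, S x -> `|complex.Re (f x)| <= 1 /\ `|complex.Im (f x)| <= 1) ->
  exists F, [/\ forall x, S x -> F x = f x, cont_on cdist cdist1 setT F &
    forall x, `|complex.Re (F x)| <= 1 /\ `|complex.Im (F x)| <= 1].
Proof.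
move=> cS cf f1.
have [A [AE cA A1]] := tietze_real cS (Re_cont_on cf) (fun x Sx => (f1 x Sx).1).
have [B [BE cB B1]] := tietze_real cS (Im_cont_on cf) (fun x Sx => (f1 x Sx).2).
exists (fun x => Complex (A x) (B x)); split; last by move=> x; split; [exact: A1|exact: B1].
  by move=> x Sx; rewrite AE// BE//; case: (f x).
move=> x _ e e0; have e20 : 0 < e / 2 by rewrite divr_gt0.
have [a a0 aP] := cA x I _ e20; have [b b0 bP] := cB x I _ e20.
exists (Num.min a b); first by rewrite lt_min a0.
move=> y _; rewrite lt_min => /andP[xa xb]; apply: le_lt_trans (cabs_le _) _.
by rewrite [e]splitr /=; apply: ltrD; [exact: aP|exact: bP].
Qed.

(** The inner 2 bounds the modulus of a function with real and imaginary parts in [-1, 1]; the outer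
    2 is that of [cint_bound]. *)
Lemma ramp_cvg mu (S : set Cn) : S !=set0 -> closed S ->
  (fun m => 2 * \sum_(k < 4) \int[cm_part mu k]_(x in (torus : set BCn))
     (2 * (\1_(~` S) x * (1 - ramp S m x))))%R @ \oo --> (0 : R).
Proof.
move=> S0 cS; have mT := @measurable_torus R n.
have mC : measurable (~` S : set BCn) by apply: measurableC; exact: closed_measurable_BCn.
have r01 m x := ramp01 m x S0.
have part k : (\int[cm_part mu k]_(x in (torus : set BCn))
    (2 * (\1_(~` S) x * (1 - ramp S m x))))%R @[m --> \oo] --> (0 : R).
  rewrite (_ : 0 = \int[cm_part mu k]_(x in (torus : set BCn)) (0 : R)); last first.
    by rewrite Rintegral_cst// mul0r.
  apply: (@bint_dct _ _ _ _ mT _ (fun m x => 2 * (\1_(~` S) x * (1 - ramp S m x))) _ 2).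
  - move=> m; apply: measurable_funM; first exact: measurable_cst.
    apply: measurable_funM; first exact: measurable_indic.
    apply: measurable_funB; first exact: measurable_cst.
    exact: (cont_on_measurable (ramp_cont m S0)).
  - exact: bmeas_cst.
  - move=> m x _; have /andP[h1 h2] := r01 m x; have /andP[h3 h4] := indic01 (~` S) x.
    have h5 : 0 <= 1 - ramp S m x <= 1 by rewrite subr_ge0 h2 lerBlDr lerDl h1.
    case/andP: h5 => h5 h6.
    rewrite ger0_norm; last by rewrite mulr_ge0// mulr_ge0.
    by rewrite -[leRHS]mulr1 ler_pM2l// mulr_ile1.
  - move=> x _; have [Sx|nSx] := pselect (S x).
      rewrite (_ : (fun m => _) = (fun=> 0)); first exact: cvg_cst.
      by apply/funext => m; rewrite indicE memNset ?mul0r ?mulr0//; exact.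
    rewrite (_ : (fun m => _) = (fun m => 2 * (1 - ramp S m x))); last first.
      by apply/funext => m; rewrite indicE mem_set// mul1r.
    have := cvgM (cvg_cst (2 : R)) (cvgB (cvg_cst (1 : R)) (ramp_out S0 cS nSx)).
    by rewrite subrr mulr0; exact.
under eq_fun do rewrite !big_ord_recl big_ord0 addr0.
rewrite (_ : 0 = 2 * (0 + (0 + (0 + 0))) :> R); last by rewrite !addr0 mulr0.
exact: (cvgM (cvg_cst (2 : R)) (cvgD (part _) (cvgD (part _) (cvgD (part _) (part _))))).
Qed.

Lemma null_approx (S : set Cn) f (e : R) : compact S -> S `<=` torus -> S !=set0 ->
  null_for_perp (@inA R n) S -> 0 < e <= 2 -> cont_on cdist cdist1 S f ->
  (forall x, S x -> `|complex.Re (f x)| <= 1 /\ `|complex.Im (f x)| <= 1) ->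
  exists g, [/\ inA g, forall x, S x -> cabs (f x - g x) <= 2 * e &
    forall x, torus x -> cabs (g x) <= 6].
Proof.
move=> cS ST S0 nS /andP[e0 e2] cf f1.
have clS : closed S by apply: compact_closed => //; exact: cdist_hausdorff.
have mS : measurable (S : set BCn) by exact: compact_measurable_BCn.
have mT := @measurable_torus R n.
have [F [FE cF F1]] := tietze_complex clS cf f1.
have cFT := cont_onS (@subsetT _ torus) cF.
apply: contrapT => nog.
(* A bound by 1 on all weighted rotations of [F - g] puts its real and imaginary parts within [e] on
   [S] and within 2 elsewhere; hence [2 * e] on [S] and [6 = 2 * (1 + 2)] for [g] on the torus. As
   [e <= 2], the larger weight is [e^-1]. *)
pose w x := if x \in S then e^-1 else 2^-1.
have w_itv x : torus x -> 0 < w x <= e^-1.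
  move=> _; rewrite /w; case: ifP => _; first by rewrite invr_gt0 e0 lexx.
  by rewrite invr_gt0 ltr0n lef_pV2 ?posrE ?e2.
have far g c : inA g -> c < 1 -> ~ forall x k, torus x -> w x * rot k (F x - g x) <= c.
  move=> Ag c1 H; apply: nog; exists g.
  have H' x k : torus x -> rot k (F x - g x) <= (w x)^-1.
    move=> Tx; have /andP[w0 _] := w_itv x Tx.
    by rewrite -[leRHS]mul1r ler_pdivlMr// mulrC (le_trans (H _ _ Tx))// ltW.
  have RI x : torus x -> `|complex.Re (F x - g x)| <= (w x)^-1 /\
                         `|complex.Im (F x - g x)| <= (w x)^-1.
    move=> Tx; have h0 := H' x 0 Tx; have h1 := H' x 1 Tx.
    have h2 := H' x 2%:R Tx; have h3 := H' x 3%:R Tx.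
    rewrite rot0 in h0; rewrite rot1 in h1; rewrite rot2 in h2; rewrite rot3 in h3.
    by rewrite !ler_norml h0 h3 !andbT lerNl h2 lerNl h1.
  split => //.
    move=> x Sx; rewrite -FE//; apply: le_trans (cabs_le _) _.
    have [] := RI x (ST _ Sx); rewrite /w mem_set// invrK => h1 h2.
    by rewrite mulr_natl mulr2n lerD.
  move=> x Tx; have [h1 h2] := RI x Tx; have [h3 h4] := F1 x.
  have w2 : (w x)^-1 <= 2 by rewrite /w; case: ifP => _; rewrite invrK.
  apply: le_trans (cabs_le _) _.
  have hr : `|complex.Re (g x)| <= 3.
    rewrite (_ : complex.Re (g x) = complex.Re (F x) - complex.Re (F x - g x)); last first.
      by rewrite ReD ReN; ring.
    apply: le_trans (ler_normB _ _) _; have -> : 3 = 1 + 2 :> R by ring.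
    by apply: lerD => //; exact: le_trans h1 w2.
  have hi : `|complex.Im (g x)| <= 3.
    rewrite (_ : complex.Im (g x) = complex.Im (F x) - complex.Im (F x - g x)); last first.
      by rewrite ImD ImN; ring.
    apply: le_trans (ler_normB _ _) _; have -> : 3 = 1 + 2 :> R by ring.
    by apply: lerD => //; exact: le_trans h2 w2.
  have -> : 6 = 3 + 3 :> R by ring.
  exact: lerD.
have [mu [muA muF mu_le]] := separating_measure w_itv cFT far.
have mu0 := (ctotvar_eq0 mu mS).1 (nS mu muA).
pose chi m x : R[i] := (ramp S m x)%:C%C.
have cchi m : cont_on cdist cdist1 torus (chi m).
  move=> x _ d d0; have [r r0 rP] := @ramp_cont R n S m setT S0 x I d d0.
  exists r => // y _ xy; rewrite /cdist1 /chi -rmorphB cabs_real; exact: rP.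
have cT := @torus_compact R n.
have cchi' m : cont_on cdist cdist1 torus (fun x => 1 - chi m x).
  move=> x Tx d d0; have [r r0 rP] := cchi m x Tx d d0; exists r => // y Ty xy.
  by have := rP y Ty xy; rewrite /cdist1 cabsBC (_ : 1 - _ - _ = chi m y - chi m x)//; ring.
(* The function vanishes on [S], where the weight is large; elsewhere its rotations are at most 1
   and the weight is 1/2. *)
have half m : complex.Re (cint mu (fun x => chi m x * F x)) <= 2^-1.
  apply: mu_le; first exact: (cont_onM cT (cchi m) cFT).
  move=> x k Tx; have -> : rot k (chi m x * F x) = ramp S m x * rot k (F x).
    by rewrite -[chi m x * _]addr0 rot_linear /rot mulr0 addr0.
  have /andP[r0 r1] := ramp01 m x S0.
  rewrite /w; case: (boolP (x \in S)) => [/set_mem Sx|_].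
    by rewrite ramp_in// mul0r mulr0 invr_ge0.
  rewrite -[leRHS]mulr1 ler_pM2l ?invr_gt0//.
  have [h3 h4] := F1 x; have := rot_le1 k h3 h4 => rk.
  by apply: le_trans (ler_wpM2l r0 rk) _; rewrite mulr1.
pose U m x := (1 - chi m x) * F x.
have cU m : cont_on cdist cdist1 torus (U m) by exact: (cont_onM cT (cchi' m) cFT).
(* Since [F] has an integral of real part 1, the remainder [U m] keeps at least 1/2. As [S] is not
   charged, this is an integral over the complement of [S], where [1 - ramp S m] tends to 0. *)
have bound m : 2^-1 <= 2 * \sum_(k < 4) \int[cm_part mu k]_(x in (torus : set BCn))
     (2 * (\1_(~` S) x * (1 - ramp S m x))).
  have split1 : cint mu F = cint mu (fun x => chi m x * F x) + cint mu (U m).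
    rewrite -cintD; [|exact: cbm_cont (cont_onM cT (cchi m) cFT)|exact: cbm_cont (cU m)].
    by apply: cint_ext => x _; rewrite /U; ring.
  have mC := measurableC mS.
  have split2 : cint mu (U m) = cint mu (on_set (~` S) (U m)).
    rewrite -[RHS]add0r -(cint_on_null (U m) mS ST mu0) -cintD.
    - by apply: cint_ext => x _; exact: on_set_split.
    - exact: cbm_on_set mS (cbm_cont (cU m)).
    - exact: cbm_on_set mC (cbm_cont (cU m)).
  have : 2^-1 <= complex.Re (cint mu (U m)).
    have := half m; move: muF; rewrite split1 ReD.
    by move: (complex.Re _) (complex.Re _); clear => a b; lra.
  move=> /le_trans; apply; apply: le_trans (ler_norm _) _.
  apply: le_trans (Re_cabs _) _; rewrite split2; apply: cint_bound.
  - exact: cbm_on_set mC (cbm_cont (cU m)).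
  - apply: bmeasM; first exact: bmeas_cst.
    apply: bmeasM; first exact: bmeas_indic.
    split.
      apply: measurable_funB; first exact: measurable_cst.
      exact: (cont_on_measurable (ramp_cont m S0)).
    exists 1 => x _; have /andP[h1 h2] := ramp01 m x S0.
    by rewrite ger0_norm ?subr_ge0// lerBlDr lerDl.
  - move=> x Tx; rewrite cabs_on_set mulrCA; have /andP[h3 h4] := indic01 (~` S) x.
    apply: ler_wpM2l => //; rewrite /U cabsM mulrC; have /andP[h1 h2] := ramp01 m x S0.
    apply: ler_pM; rewrite ?cabs_ge0//.
      have [h5 h6] := F1 x; apply: le_trans (cabs_le _) _.
      have -> : 2 = 1 + 1 :> R by ring.
      exact: lerD.
    by rewrite /chi -[1]/((1 : R)%:C%C) -rmorphB /= cabs_real ger0_norm ?subr_ge0.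
have := ramp_cvg mu S0 clS; move=> /cvgrPdist_lt/(_ 2^-1 ltac:(by rewrite invr_gt0)).
move=> [N _ /(_ N (leqnn _))]; rewrite sub0r normrN => /(le_lt_trans (ler_norm _)).
by rewrite ltNge bound.
Qed.

End NullApproximation.

Section Interpolation.
Context {R : realType} {n : nat}.
Notation Cn := 'rV[R[i]^o]_n.
Local Notation torus := (@Defs.torus R n).
Implicit Types (f g : Cn -> R[i]) (S : set Cn).

(** [null_approx] with [e = 1 / 6] yields the ratio 1/3 needed for the geometric series. *)
Lemma null_approx_scaled S f (c : R) : compact S -> S `<=` torus -> S !=set0 ->
  null_for_perp (@inA R n) S -> 0 < c -> cont_on cdist cdist1 S f ->
  (forall x, S x -> cabs (f x) <= c) ->
  exists g, [/\ inA g, forall x, S x -> cabs (f x - g x) <= c / 3 &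
    forall x, torus x -> cabs (g x) <= 6 * c].
Proof.
move=> cS ST S0 nS c0 cf fc; pose a : R[i] := (c^-1)%:C%C.
have ca : c%:C%C * a = 1 by rewrite /a -rmorphM divff ?gt_eqF// rmorph1.
have cabsc : cabs c%:C%C = c by rewrite cabs_real gtr0_norm.
have cca : cont_on cdist cdist1 S (fun=> a) by exact: (inA_cont_on ST (@inA_cst R n a)).
have caf := cont_onM cS cca cf.
have af1 x : S x -> cabs (a * f x) <= 1.
  move=> Sx; rewrite cabsM cabs_real gtr0_norm ?invr_gt0// mulrC ler_pdivrMr// mul1r.
  exact: fc.
have e6 : 0 < (6^-1 : R) <= 2.
  by rewrite invr_gt0 ltr0n /= invf_ple ?posrE// (@le_trans _ _ 1)// ?invf_le1 ?ler1n.
have [|g [Ag gS gT]] := null_approx cS ST S0 nS e6 caf.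
  move=> x /af1 h; split; first exact: le_trans (Re_cabs _) h.
  exact: le_trans (Im_cabs _) h.
exists (fun x => c%:C%C * g x); split.
- exact: (inAM (@inA_cst R n _) Ag).
- move=> x Sx; rewrite (_ : f x - _ = c%:C%C * (a * f x - g x)); last first.
    by rewrite mulrBr mulrA ca mul1r.
  rewrite cabsM cabsc ler_pM2l//.
  by apply: le_trans (gS _ Sx) _; rewrite le_eqVlt; apply/orP; left; apply/eqP; field.
- by move=> x Tx; rewrite cabsM cabsc mulrC ler_pM2r// gT.
Qed.

Theorem null_interpolation S : compact S -> S `<=` torus ->
  null_for_perp (@inA R n) S -> interpolation_set (@inA R n) S.
Proof.
move=> cS ST nS; apply/interpolation_setP => f cf.
have [S0|/set0P S0] := eqVneq S set0.
  by exists (fun=> 0); split; [exact: inA_cst|move=> z; rewrite S0].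
have [M M0 fM] := cont_on_bounded cS cf.
pose c k : R := (M + 1) / 3 ^+ k.
have c0 k : 0 < c k by rewrite divr_gt0 ?exprn_gt0// ltr_wpDl.
(* [A] is defined on all pairs and guarantees something only for a function continuous on [S] and at
   most [c k] there. The partial sums [F] can thus be a plain fixpoint whose properties are proved
   afterwards in [FP]. *)
have /choice[A AP] : forall fk : (Cn -> R[i]) * nat, exists g, cont_on cdist cdist1 S fk.1 ->
    (forall x, S x -> cabs (fk.1 x) <= c fk.2) ->
    [/\ inA g, forall x, S x -> cabs (fk.1 x - g x) <= c fk.2 / 3 &
      forall x, torus x -> cabs (g x) <= 6 * c fk.2].
  move=> [h k] /=; have [[ch hc]|nh] := pselect (cont_on cdist cdist1 S h /\
      forall x, S x -> cabs (h x) <= c k).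
    by have [g gP] := null_approx_scaled cS ST S0 nS (c0 k) ch hc; exists g.
  by exists (fun=> 0) => ch hc; case: nh.
pose F := fix F (k : nat) : Cn -> R[i] := if k is k'.+1 then
  fun x => F k' x + A ((fun z => f z - F k' z), k') x else fun=> 0.
have FP k : [/\ inA (F k), cont_on cdist cdist1 S (fun z => f z - F k z) &
    forall x, S x -> cabs (f x - F k x) <= c k].
  elim: k => [|k [AF cF Fc]].
    split; first exact: inA_cst.
      by move=> x Sx e /(cf _ Sx)[r r0 rP]; exists r => // y Sy /(rP _ Sy); rewrite /F !subr0.
    by move=> x Sx; rewrite /F subr0 /c expr0 divr1 (le_trans (fM _ Sx))// lerDl.
  have [Ag gS _] := AP ((fun z => f z - F k z), k) cF Fc.
  have AF' : inA (F k.+1) by exact: (inAD AF Ag).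
  split => //.
    have cN := cont_onM cS (inA_cont_on ST (@inA_cst R n (-1))) (inA_cont_on ST AF').
    move=> x Sx e /(cont_on_complexD cf cN Sx)[r r0 rP]; exists r => // y Sy /(rP _ Sy).
    by rewrite !mulN1r.
  by move=> x /gS; rewrite /= /c exprS invfM mulrCA mulrC -addrA -opprD.
(* The corrections are bounded on the torus; the maximum principle extends the bound to the closed
   polydisc, where [inA_lim] needs uniform convergence. *)
have step k z : cpolydisc z -> cabs (F k.+1 z - F k z) <= (6 * (M + 1)) / 3 ^+ k.
  have [AF cF Fc] := FP k; have [Ag _ gT] := AP ((fun z => f z - F k z), k) cF Fc.
  rewrite (_ : F k.+1 z - F k z = A ((fun z => f z - F k z), k) z); last by rewrite /= addrC addKr.
  by rewrite -mulrA; apply: max_modulus_polydisc z => //.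
have M1 : 0 <= 6 * (M + 1) by rewrite mulr_ge0// addr_ge0.
have [g gP] := geometric_limit M1 step.
exists g; split.
  apply: (@inA_lim _ _ F) => [k|e e0]; first by case: (FP k).
  have [N Ne] := pow3_small (6 * (M + 1) * (3 / 2)) e0; exists N => k Nk z cz.
  apply: le_trans (gP k z cz) _; apply: le_trans (ltW Ne).
  apply: ler_wpM2l; first by rewrite mulr_ge0// divr_ge0.
  by rewrite lef_pV2 ?posrE ?exprn_gt0// ler_weXn2l// ler1n.
move=> z Sz; apply/eqP; rewrite eq_sym -subr_eq0; apply/eqP/cabs_eq0/eqP.
rewrite eq_le cabs_ge0 andbT; apply/ler_addgt0Pr => e e0; rewrite add0r.
have e20 : 0 < e / 2 by rewrite divr_gt0.
have [N Ne] := pow3_small (6 * (M + 1) * (3 / 2)) e20.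
rewrite (_ : f z - g z = (f z - F N z) + (F N z - g z)); last by ring.
apply: le_trans (cabsD _ _) _; rewrite [e]splitr; apply: lerD.
  have [_ _ Fc] := FP N; apply: le_trans (Fc _ Sz) _; apply: le_trans (ltW Ne).
  apply: ler_wpM2r; first by rewrite invr_ge0 exprn_ge0.
  by rewrite mulrAC -[leLHS]mul1r; apply: ler_wpM2r; [rewrite addr_ge0|lra].
by apply: le_trans (gP N z _) (ltW Ne); exact/torus_cpolydisc/ST.
Qed.

End Interpolation.

Theorem theorem1 (R : realType) (n : nat) (hn : (0 < n)%N)
  (S : set 'rV[R[i]^o]_n) (hS : compact S) (hST : S `<=` @torus R n) :
  (interpolation_set (@inA R n) S <-> interpolation_set (@inA0 R n) S) /\
  (null_for_perp (@inA0 R n) S <-> null_for_perp (@inA R n) S) /\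
  (interpolation_set (@inA0 R n) S <-> null_for_perp (@inA0 R n) S).
Proof.
(* The witness is [coord_prod * h] and not [g], since the two are known to agree on the closed
   polydisc only. *)
have I0A : interpolation_set (@inA0 R n) S -> interpolation_set (@inA R n) S.
  move=> IS f /IS[g [[h [Ah gh]] gf]]; exists (fun z => coord_prod z * h z).
  split; first exact: (inAM (@inA_coord_prod R n) Ah).
  by move=> z Sz; rewrite -gf// gh//; exact/torus_cpolydisc/hST.
(* On [S] the conjugate of [coord_prod] is its inverse, so [h] is chosen to interpolate that
   conjugate times [f]. *)
have IA0 : interpolation_set (@inA R n) S -> interpolation_set (@inA0 R n) S.
  move=> /interpolation_setP IS; apply/interpolation_setP => f cf.
  have cP := cont_on_conj (inA_cont_on hST (@inA_coord_prod R n)).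
  have [h [Ah hf]] := IS _ (cont_onM hS cP cf).
  exists (fun z => coord_prod z * h z); split; first by exists h.
  move=> z Sz; rewrite hf// mulrA -sqr_cabs cabs_coord_prod ?expr1n ?mul1r//.
  exact: hST.
have N0A : null_for_perp (@inA0 R n) S -> null_for_perp (@inA R n) S.
  move=> nS mu muA; apply: nS => g [h [Ah gh]].
  rewrite -(muA _ (inAM (@inA_coord_prod R n) Ah)); apply: cint_ext => z Tz.
  by rewrite gh//; exact: torus_cpolydisc.
have NAI := null_interpolation hS hST.
have IN0 := interpolation_null hn hS hST.
by split; [|split]; split; auto.
Qed.
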